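(* Let $m\ge1$ be an integer and $f(z)=\sum_{n\ge0}a_nz^{-n/m}\in\mathbb{C}[[z^{-1/m}]]$ a Gevrey-1 series whose Borel transform $\widetilde f(\zeta)=\sum_{n\ge1}\frac{a_n\zeta^{n/m-1}}{\Gamma(n/m)}$ extends analytically to $\Omega^\star$, with $$\exists A>0,\ \exists B>0,\ \forall\zeta\in\Omega^\star:\ |\widetilde f(\zeta)\zeta^{\frac{m-1}{m}}|\le Ae^{B|\zeta|}.$$ Define the coefficients $d_n$ ($n\ge1$) as follows: for $l=1,\dots,m$ let $\widetilde g_l(\xi)=\big(\frac{\xi}{1-e^{-\xi}}\big)^{\frac lm-1}\sum_{k\ge0}\frac{a_{l+mk}\xi^k}{\Gamma(\frac lm+k)}$ (principal branch), which extends holomorphically to $\Delta$, and let $d_{l+mj}$, $j\ge0$, be given by the Taylor expansion $\widetilde g_l(-\ln s)=\sum_{j\ge0}d_{l+mj}(1-s)^j$ for $s\in D(1,1)$. Then the generalized factorial series $$a_0+\sum_{n=1}^{+\infty}\frac{\Gamma(\frac nm)\Gamma(z)\,d_n}{\Gamma(z+\frac nm)}$$ converges absolutely for $z\in P(\max(B,1))$ and its sum equals the Borel sum $\mathrm{S}_0f(z)=a_0+\int_0^{+\infty}\widetilde f(\zeta)e^{-z\zeta}d\zeta$ there.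
   Context: $\Delta$ is the image of the open disc $D(1,1)=\{s:|s-1|<1\}$ under $s\mapsto-\ln s$ (principal logarithm); $\Delta^\star=\Delta\setminus\{0\}$. $\mathbb{C}_m^\star$ is the $m$-sheeted covering of $\mathbb{C}^\star$: points $x=(|x|,\arg x)$, $\arg x\in\mathbb{R}/2\pi m\mathbb{Z}$, projection $\pi(x)=\dot x=|x|e^{i\arg x}$; $|\arg x|$ uses the representative in $]-m\pi,m\pi]$; $x^{k/m}$ has modulus $|x|^{k/m}$ and argument $\frac km\arg x$; complex values (e.g. $e^{-z\zeta}$, $\Gamma(z)$) are read via the projection. $\Omega^\star=\pi^{-1}(\Delta^\star)$. $P(B)=\{z\in\mathbb{C}_m^\star:|\arg z|\le\pi/2,\ \Re(\dot z)>B\}$. Gevrey-1 means $|a_n|\le CK^n\Gamma(1+n/m)$ for some constants. The Laplace integral is along the ray $\arg\zeta=0$. Equivalently, $\widetilde f(\zeta)=\sum_{n\ge1}d_n(1-e^{-\zeta})^{\frac nm-1}$ on $\Omega^\star$. *)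

(* Defs.v *)
From Stdlib Require Import Reals ClassicalEpsilon.
From Coquelicot Require Import Coquelicot.

Open Scope C_scope.

Definition cexp (z : C) : C :=
  (exp (Re z) * cos (Im z), exp (Re z) * sin (Im z))%R.

Definition Carg (z : C) : R :=
  let x := Re z in let y := Im z in
  if Rlt_dec 0 x then atan (y / x)
  else if Rlt_dec x 0 then
    (if Rle_dec 0 y then (atan (y / x) + PI)%R else (atan (y / x) - PI)%R)
  else if Rlt_dec 0 y then (PI / 2)%R
  else if Rlt_dec y 0 then (- (PI / 2))%R else 0%R.

(** Principal logarithm (used only at nonzero points). *)
Definition Cln (z : C) : C := (ln (Cmod z), Carg z).

(** Principal power b^e := exp (e Ln b) (used only for b <> 0). *)
Definition cpowc (b e : C) : C := cexp (e * Cln b).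

(** Euler Gamma function, defined by the (improper) Euler integral;
    it is only ever evaluated at arguments with positive real part. *)
Definition RGamma (x : R) : R :=
  RInt_gen (fun t => Rpower t (x - 1) * exp (- t))%R
           (at_right 0) (Rbar_locally p_infty).

Definition CGamma (z : C) : C :=
  @RInt_gen C_R_CompleteNormedModule
    (fun t => cexp ((z - 1) * RtoC (ln t)) * RtoC (exp (- t)))
    (at_right 0) (Rbar_locally p_infty).

Definition gevrey1 (m : nat) (a : nat -> C) : Prop :=
  exists Cc K : R, forall n : nat,
    (Cmod (a n) <= Cc * K ^ n * RGamma (1 + INR n / INR m))%R.

Definition in_Delta (xi : C) : Prop :=
  exists s : C, (Cmod (s - 1) < 1)%R /\ xi = - Cln s.

(** The m-sheeted covering C_m^star is identified with C^star through the chart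
    x |-> w = x^{1/m} (modulus |x|^{1/m}, argument arg(x)/m in ]-PI,PI]),
    whose inverse is w |-> (|w|^m, m Arg w); the projection is pi(x) = w^m
    and x^{k/m} = w^k.  In this chart Omega^star = pi^{-1}(Delta^star) becomes: *)
Definition in_Omega_chart (m : nat) (w : C) : Prop :=
  w <> 0 /\ in_Delta (w ^ m).

(** n-th term (n = k+1 >= 1) of the Borel transform
    a_n zeta^{n/m - 1} / Gamma(n/m), written in the chart zeta^{1/m} = w. *)
Definition borel_term (m : nat) (a : nat -> C) (w : C) (k : nat) : C :=
  a (S k) * w ^ (S k) / (w ^ m * RtoC (RGamma (INR (S k) / INR m))).

(** xi / (1 - e^{-xi}), extended by its limit 1 at xi = 0. *)
Definition qfun (xi : C) : C :=
  if excluded_middle_informative (xi = 0) then 1 else xi / (1 - cexp (- xi)).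

Definition taylor_coeffs_d (m : nat) (a d : nat -> C) (l : nat) : Prop :=
  exists r : R, (0 < r)%R /\
    forall s : C, (Cmod (s - 1) < r)%R ->
      let xi := - Cln s in
      exists sig : C,
        is_series (fun k => a (l + m * k)%nat * xi ^ k
                             / RtoC (RGamma (INR l / INR m + INR k))) sig /\
        is_series (fun j => d (l + m * j)%nat * (1 - s) ^ j)
                  (cpowc (qfun xi) (RtoC (INR l / INR m - 1)) * sig).

Definition fact_term (m : nat) (d : nat -> C) (z : C) (n : nat) : C :=
  RtoC (RGamma (INR n / INR m)) * CGamma z * d n
  / CGamma (z + RtoC (INR n / INR m)).

(* Main.v *)
Require Import Defs.
From Stdlib Require Import Reals Lra Lia ClassicalEpsilon.
From Coquelicot Require Import Coquelicot.

(** Put [sigma^m = 1 - exp (- zeta)].  The exponential bound makes the Borel transform, read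
    in the coordinate [sigma] and multiplied by [sigma^(m-1)], a holomorphic function on the
    punctured unit disc which is [O(|1 - sigma^m|^(-B))] near the unit circle, and by the
    definition of the [d n] it equals [sum d (n+1) sigma^n] near the origin.  Goursat's theorem
    in a logarithmic coordinate gives Cauchy's formula for these coefficients; the maximum
    principle (obtained from the mean value property and Moebius maps) extends the expansion to
    the whole disc, and averaging over circles of radius [1 - 1/(n+2)] gives [d n = O(n^(B-1))]
    as soon as [B > 1].  Integrating term by term produces Beta integrals [B(z, n/m)], of order
    [n^(- Re z)], so the series converges absolutely when [Re z > B].  The relation between
    [B(z, b)] and Gamma, as well as the fact that Gamma has no zero, come from the recursion for
    [B(z, b + n)] and Gauss's limit, without Fubini. *)

Open Scope C_scope.

(** * Elementary real analysis *)

Lemma exp_le_compat (a b : R) : a <= b -> exp a <= exp b.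
Proof. intros [H| ->]; [left; now apply exp_increasing|right; reflexivity]. Qed.

Lemma exp_nonpos_le_1 (a : R) : a <= 0 -> exp a <= 1.
Proof. rewrite <- exp_0; apply exp_le_compat. Qed.

Lemma exp_opp_lt_1 (t : R) : 0 < t -> 0 < exp (- t) < 1.
Proof. intros H; split; [apply exp_pos|]; rewrite <- exp_0; apply exp_increasing; lra. Qed.

Lemma ln_le_sub_1 (y : R) : 0 < y -> ln y <= y - 1.
Proof.
  intros Hy; pose proof (exp_ineq1_le (ln y)) as E; rewrite exp_ln in E by exact Hy; lra.
Qed.

Lemma Rinv_le_ln_sub (y : R) : 1 < y -> / y <= ln y - ln (y - 1).
Proof.
  intros Hy; rewrite <- Ropp_minus_distr, <- ln_div by lra.
  assert (H : ln ((y - 1) / y) <= (y - 1) / y - 1).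
  { apply ln_le_sub_1, Rdiv_lt_0_compat; lra. }
  replace ((y - 1) / y - 1)%R with (- / y)%R in H by (field; lra); lra.
Qed.

Lemma Rpower_base_1 (e : R) : Rpower 1 e = 1%R.
Proof. unfold Rpower; rewrite ln_1, Rmult_0_r; apply exp_0. Qed.

Lemma Rpower_minus_1 (x e : R) : 0 < x -> Rpower x (e - 1) = (Rpower x e / x)%R.
Proof.
  intros Hx; rewrite <- (Rpower_1 x) at 3 by exact Hx.
  unfold Rdiv; rewrite <- Rpower_Ropp, <- Rpower_plus; reflexivity.
Qed.

Lemma Rpower_le_1 (x e : R) : 0 < x <= 1 -> 0 <= e -> Rpower x e <= 1.
Proof. intros Hx He; rewrite <- (Rpower_base_1 e); now apply Rle_Rpower_l. Qed.

Lemma Rpower_Ropp_le (x y e : R) :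
  0 < x <= y -> 0 <= e -> Rpower y (- e) <= Rpower x (- e).
Proof.
  intros H He; rewrite !Rpower_Ropp; apply Rinv_le_contravar; [apply exp_pos|].
  apply Rle_Rpower_l; lra.
Qed.

Lemma Rpower_Ropp_Rdiv (x y e : R) :
  0 < x -> 0 < y -> Rpower (x / y) (- e) = (Rpower y e * Rpower x (- e))%R.
Proof.
  intros Hx Hy; unfold Rpower; rewrite ln_div, <- exp_plus by assumption; f_equal; ring.
Qed.

Lemma pow_le_1 (x : R) (n : nat) : 0 <= x <= 1 -> x ^ n <= 1.
Proof. intros Hx; rewrite <- (pow1 n); now apply pow_incr. Qed.

Lemma pow_le_self (x : R) (n : nat) : (1 <= n)%nat -> 0 <= x <= 1 -> x ^ n <= x.
Proof.
  intros Hn Hx; destruct n as [|k]; [lia|]; simpl; pose proof (pow_le_1 x k Hx); nra.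
Qed.

Lemma bernoulli_ineq (y : R) (n : nat) : 0 <= y <= 1 -> 1 - INR n * y <= (1 - y) ^ n.
Proof.
  intros Hy; induction n; [simpl; lra|]; rewrite S_INR; simpl pow; pose proof (pos_INR n).
  assert (0 <= (1 - y) ^ n) by (apply pow_le; lra). nra.
Qed.

Lemma Rle_of_sqr_le (x y : R) : 0 <= y -> x ^ 2 <= y ^ 2 -> x <= y.
Proof. intros Hy H; apply Rsqr_incr_0_var; [now rewrite !Rsqr_pow2|exact Hy]. Qed.

Lemma is_RInt_of_continuous (g : R -> R) (a b : R) :
  (forall t, Rmin a b <= t <= Rmax a b -> continuous g t) -> is_RInt g a b (RInt g a b).
Proof.
  intros H; apply (RInt_correct (V := R_CompleteNormedModule)).
  now apply (ex_RInt_continuous (V := R_CompleteNormedModule)).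
Qed.

Lemma continuous_of_ex_derive (f : R -> R) (t : R) : ex_derive f t -> continuous f t.
Proof. apply (ex_derive_continuous (V := R_NormedModule)). Qed.

(** * Modulus, limits and continuity of complex-valued functions *)

Lemma Cmod_sub_sym (x y : C) : Cmod (x - y) = Cmod (y - x).
Proof. rewrite <- Cmod_opp; f_equal; ring. Qed.

Lemma Cmod_le_add_sub (x y : C) : Cmod x <= Cmod y + Cmod (x - y).
Proof. replace x with (y + (x - y)) at 1 by ring; apply Cmod_triangle. Qed.

Lemma Cmod_sub_triangle (x y z : C) : Cmod (x - z) <= Cmod (x - y) + Cmod (y - z).
Proof. replace (x - z) with ((x - y) + (y - z)) by ring; apply Cmod_triangle. Qed.

Lemma Cmod_sub_le (x y : C) : Cmod (x - y) <= Cmod x + Cmod y.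
Proof. unfold Cminus; rewrite <- (Cmod_opp y); apply Cmod_triangle. Qed.

Lemma RtoC_neq_0 (x : R) : x <> 0%R -> RtoC x <> 0.
Proof. intros H E; apply H; now apply RtoC_inj. Qed.

Lemma Re_pos_neq_0 (z : C) : 0 < Re z -> z <> 0.
Proof. intros H E; rewrite E in H; simpl in H; lra. Qed.

Lemma C_Re_Im (z : C) : z = RtoC (Re z) + Ci * RtoC (Im z).
Proof. destruct z; unfold Ci, RtoC, Cplus, Cmult; simpl; f_equal; ring. Qed.

Lemma Cmod_le_re_im (z : C) : Cmod z <= Rabs (Re z) + Rabs (Im z).
Proof.
  rewrite (C_Re_Im z) at 1; eapply Rle_trans; [apply Cmod_triangle|].
  rewrite Cmod_mult, Cmod_Ci, !Cmod_R; lra.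
Qed.

Lemma locally_Cmod (x : C) (P : C -> Prop) :
  locally x P <-> exists d, 0 < d /\ forall y, Cmod (y - x) < d -> P y.
Proof.
  rewrite locally_C; split.
  - intros [d Hd]; exists d; split; [apply cond_pos|exact Hd].
  - intros [d [Hd H]]; exists (mkposreal d Hd); exact H.
Qed.

Lemma locally_Cmod_lt (x : C) (d : R) : 0 < d -> locally x (fun y : C => Cmod (y - x) < d).
Proof. intros Hd; apply locally_Cmod; now exists d. Qed.

Lemma locally_lt_Re (z : C) (c : R) : c < Re z -> locally z (fun q : C => c < Re q).
Proof.
  intros H; apply locally_Cmod; exists (Re z - c)%R; split; [lra|]; intros q Hq.
  pose proof (re_le_Cmod (z - q)) as L; rewrite Cmod_sub_sym in L.
  pose proof (Rle_abs (Re (z - q))) as A; destruct z, q; simpl in *; lra.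
Qed.

Lemma filterlim_Cmod {T : Type} (F : (T -> Prop) -> Prop) {FF : Filter F} (f : T -> C) (l : C) :
  filterlim f F (locally l) <->
  forall eps, 0 < eps -> F (fun x => Cmod (f x - l) < eps).
Proof.
  split.
  - intros H eps Heps; apply (H (fun y => Cmod (y - l) < eps)); now apply locally_Cmod_lt.
  - intros H P HP; apply locally_Cmod in HP; destruct HP as [d [Hd HP]].
    apply (filter_imp (F := F) (fun x => Cmod (f x - l) < d)); auto.
Qed.

Lemma filterlim_C_unique {T : Type} (F : (T -> Prop) -> Prop) {FF : ProperFilter F}
  (f : T -> C) (l l' : C) :
  filterlim f F (locally l) -> filterlim f F (locally l') -> l = l'.
Proof. exact (filterlim_locally_unique (V := C_R_NormedModule) f l l'). Qed.

Lemma Cmod_le_of_filterlim {T : Type} (F : (T -> Prop) -> Prop) {FF : ProperFilter F}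
  (f : T -> C) (l : C) (M : R) :
  filterlim f F (locally l) -> F (fun x => Cmod (f x) <= M) -> Cmod l <= M.
Proof.
  intros Hf HM; apply le_epsilon; intros eps Heps.
  destruct (filter_ex _ (filter_and _ _ HM (proj1 (filterlim_Cmod F f l) Hf eps Heps)))
    as [x [H1 H2]].
  rewrite Cmod_sub_sym in H2; pose proof (Cmod_le_add_sub l (f x)); lra.
Qed.

(** Multiplication and continuity are compatible with the norm uniformity of [C], which
    differs from the product uniformity used by [locally] on [C] but has the same filters. *)
Lemma filterlim_Cmult {T : Type} (F : (T -> Prop) -> Prop) {FF : Filter F} (f g : T -> C) (a b : C) :
  filterlim f F (locally a) -> filterlim g F (locally b) ->
  filterlim (fun x => f x * g x) F (locally (a * b)).
Proof.
  intros Hf Hg.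
  assert (ToNorm : forall x : C, filter_le (locally x) (locally (T := AbsRing_UniformSpace C_AbsRing) x)).
  { intros x P; apply locally_C. }
  eapply filterlim_filter_le_2; [intros P; apply locally_C|].
  apply (filterlim_comp_2 f g Cmult (filterlim_filter_le_2 f (ToNorm a) Hf)
    (filterlim_filter_le_2 g (ToNorm b) Hg)).
  apply (filterlim_mult (K := C_AbsRing)).
Qed.

Lemma filterlim_Cplus {T : Type} (F : (T -> Prop) -> Prop) {FF : Filter F} (f g : T -> C) (a b : C) :
  filterlim f F (locally a) -> filterlim g F (locally b) ->
  filterlim (fun x => f x + g x) F (locally (a + b)).
Proof.
  intros Hf Hg; apply (filterlim_comp_2 f g Cplus Hf Hg).
  apply (filterlim_plus (V := C_R_NormedModule)).
Qed.

Lemma filterlim_Cminus {T : Type} (F : (T -> Prop) -> Prop) {FF : Filter F} (f g : T -> C) (a b : C) :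
  filterlim f F (locally a) -> filterlim g F (locally b) ->
  filterlim (fun x => f x - g x) F (locally (a - b)).
Proof.
  intros Hf Hg; apply (filterlim_Cplus F); [exact Hf|].
  apply (filterlim_comp _ _ _ g Copp _ _ _ Hg), (filterlim_opp (V := C_R_NormedModule)).
Qed.

Lemma filterlim_Cmod_0 {T : Type} (F : (T -> Prop) -> Prop) {FF : Filter F}
  (f : T -> C) (l : C) (g : T -> R) :
  F (fun x => Cmod (f x - l) <= g x) -> filterlim g F (locally 0%R) ->
  filterlim f F (locally l).
Proof.
  intros Hfg Hg; apply (filterlim_Cmod F); intros eps Heps.
  assert (Hsmall : F (fun x => Rabs (g x - 0) < eps)).
  { apply (Hg (fun y => Rabs (y - 0) < eps)); now exists (mkposreal eps Heps). }
  apply filter_imp with (2 := filter_and _ _ Hfg Hsmall); intros x [H1 H2].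
  rewrite Rminus_0_r in H2; pose proof (Rle_abs (g x)); lra.
Qed.

Lemma continuous_Cmod (x : C) : continuous Cmod x.
Proof. exact (filterlim_norm (V := C_NormedModule) x). Qed.

Lemma filterlim_Cinv (a : C) : a <> 0 -> filterlim Cinv (locally a) (locally (/ a)).
Proof.
  intros Ha; assert (Hm : 0 < Cmod a) by now apply Cmod_gt_0.
  apply (filterlim_Cmod_0 (locally a) Cinv _ (fun x => 2 / (Cmod a * Cmod a) * Cmod (x - a))%R).
  - apply locally_Cmod; exists (Cmod a / 2)%R; split; [lra|]; intros x Hx.
    assert (Hx2 : Cmod a / 2 < Cmod x).
    { pose proof (Cmod_le_add_sub a x); rewrite Cmod_sub_sym in Hx; lra. }
    assert (Hx0 : x <> 0) by (apply Cmod_gt_0; lra).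
    replace (/ x - / a) with ((a - x) / (x * a)) by (field; auto).
    rewrite Cmod_div, Cmod_mult, Cmod_sub_sym by now apply Cmult_neq_0.
    unfold Rdiv at 1; rewrite Rmult_comm; apply Rmult_le_compat_r; [apply Cmod_ge_0|].
    replace (2 / (Cmod a * Cmod a))%R with (/ (Cmod a / 2 * Cmod a))%R by (field; lra).
    apply Rinv_le_contravar; [|apply Rmult_le_compat_r]; nra.
  - replace (locally 0%R) with (locally (2 / (Cmod a * Cmod a) * Cmod (a - a))%R).
    2:{ f_equal; replace (a - a) with (RtoC 0) by ring; rewrite Cmod_0; ring. }
    apply (continuous_scal_r (V := R_NormedModule) (2 / (Cmod a * Cmod a))%R
      (fun x : C => Cmod (x - a))).
    apply (continuous_comp (fun x : C => x - a) Cmod).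
    + exact (filterlim_Cminus (locally a) _ _ a a (filterlim_id _ _) (filterlim_const a)).
    + apply continuous_Cmod.
Qed.

Section Continuity.
Context {U : UniformSpace}.
Implicit Types f g : U -> C.

Lemma continuous_Cplus f g x :
  continuous f x -> continuous g x -> continuous (fun y => f y + g y) x.
Proof. exact (filterlim_Cplus _ f g _ _). Qed.

Lemma continuous_Cminus f g x :
  continuous f x -> continuous g x -> continuous (fun y => f y - g y) x.
Proof. exact (filterlim_Cminus _ f g _ _). Qed.

Lemma continuous_Cmult f g x :
  continuous f x -> continuous g x -> continuous (fun y => f y * g y) x.
Proof. exact (filterlim_Cmult _ f g _ _). Qed.

Lemma continuous_Cinv f x :
  continuous f x -> f x <> 0 -> continuous (fun y => / f y) x.
Proof. intros Hf H0; exact (filterlim_comp _ _ _ f Cinv _ _ _ Hf (filterlim_Cinv _ H0)). Qed.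

Lemma continuous_pair {V W : UniformSpace} (f : U -> V) (g : U -> W) x :
  continuous f x -> continuous g x -> continuous (fun y => (f y, g y)) x.
Proof.
  intros Hf Hg; apply (continuous_comp_2 f g (fun a b => (a, b))); auto.
  apply (continuous_ext (fun p => p)); [intros [a b]; reflexivity|apply continuous_id].
Qed.

Lemma continuous_RtoC (f : U -> R) x : continuous f x -> continuous (fun y => RtoC (f y)) x.
Proof. intros Hf; apply continuous_pair; [exact Hf|apply continuous_const]. Qed.

Lemma continuous_neq_0 f x : continuous f x -> f x <> 0 -> locally x (fun y => f y <> 0).
Proof.
  intros Hf H0; apply (Hf (fun w : C => w <> 0)), locally_Cmod.
  exists (Cmod (f x)); split; [now apply Cmod_gt_0|].
  intros w Hw ->; rewrite Cmod_sub_sym in Hw.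
  replace (f x - 0) with (f x) in Hw by ring; lra.
Qed.

End Continuity.

(** * Complex differentiability *)

Lemma is_derive_Cmod (f : C -> C) (p l : C) :
  is_derive f p l <->
  forall eps, 0 < eps -> locally p (fun q => Cmod (f q - f p - l * (q - p)) <= eps * Cmod (q - p)).
Proof.
  split.
  - intros [_ Hf] eps Heps; apply locally_C.
    apply filter_imp with (2 := Hf p (fun P H => H) (mkposreal eps Heps)); intros q Hq.
    rewrite (Cmult_comm l); exact Hq.
  - intros H; split; [apply is_linear_scal_l|]; intros x Hx eps.
    apply (is_filter_lim_locally_unique (V := AbsRing_NormedModule C_AbsRing)) in Hx; subst x.
    apply locally_C; apply filter_imp with (2 := H eps (cond_pos eps)); intros q Hq.
    rewrite (Cmult_comm l) in Hq; exact Hq.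
Qed.

Lemma is_derive_caratheodory (f : C -> C) (p l : C) :
  is_derive f p l <->
  exists phi : C -> C, continuous phi p /\ phi p = l /\ forall q, f q - f p = phi q * (q - p).
Proof.
  rewrite is_derive_Cmod; split.
  - intros Hf; exists (fun q => if Ceq_dec q p then l else (f q - f p) / (q - p)).
    split; [|split; [destruct (Ceq_dec p p); tauto|]].
    + apply (filterlim_Cmod (locally p)); intros eps Heps.
      destruct (Ceq_dec p p) as [_|n]; [|tauto].
      apply filter_imp with (2 := Hf (eps / 2)%R ltac:(lra)); intros q Hq.
      destruct (Ceq_dec q p) as [->|n].
      { replace (l - l) with (RtoC 0) by ring; rewrite Cmod_0; exact Heps. }
      apply Cminus_eq_contra in n; pose proof (proj1 (Cmod_gt_0 _) n) as Hm.
      replace ((f q - f p) / (q - p) - l) with ((f q - f p - l * (q - p)) / (q - p)) by (field; auto).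
      rewrite Cmod_div by exact n; apply Rle_lt_trans with (eps / 2)%R; [|lra].
      now apply Rle_div_l.
    + intros q; destruct (Ceq_dec q p) as [->|n]; [ring|].
      field; now apply Cminus_eq_contra.
  - intros [phi [Hc [<- E]]] eps Heps.
    apply filter_imp with (2 := proj1 (filterlim_Cmod (locally p) phi (phi p)) Hc eps Heps).
    intros q Hq; rewrite E.
    replace (phi q * (q - p) - phi p * (q - p)) with ((phi q - phi p) * (q - p)) by ring.
    rewrite Cmod_mult; apply Rmult_le_compat_r; [apply Cmod_ge_0|lra].
Qed.

Lemma ex_derive_caratheodory (f : C -> C) (p : C) :
  ex_derive f p <-> exists phi : C -> C, continuous phi p /\ forall q, f q - f p = phi q * (q - p).
Proof.
  split.
  - intros [l Hl]; apply is_derive_caratheodory in Hl; destruct Hl as [phi [Hc [_ E]]]; now exists phi.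
  - intros [phi [Hc E]]; exists (phi p); apply is_derive_caratheodory; now exists phi.
Qed.

Lemma ex_derive_C_continuous (f : C -> C) (p : C) : ex_derive f p -> continuous f p.
Proof.
  intros H P HP; apply locally_C, (ex_derive_continuous (V := C_NormedModule) f p H), HP.
Qed.

Lemma is_derive_C_ext_loc (f g : C -> C) (p l : C) :
  locally p (fun q => f q = g q) -> is_derive f p l -> is_derive g p l.
Proof. intros E; apply (is_derive_ext_loc (V := C_NormedModule)); now apply locally_C. Qed.

Lemma ex_derive_C_ext_loc (f g : C -> C) (p : C) :
  locally p (fun q => f q = g q) -> ex_derive f p -> ex_derive g p.
Proof. intros E [l Hl]; exists l; revert Hl; now apply is_derive_C_ext_loc. Qed.

Lemma ex_derive_Cconst (c p : C) : ex_derive (fun _ => c) p.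
Proof. exact (ex_derive_const (V := C_NormedModule) c p). Qed.

Lemma ex_derive_Cid (p : C) : ex_derive (fun q : C => q) p.
Proof.
  apply ex_derive_caratheodory; exists (fun _ => RtoC 1); split; [apply continuous_const|intro; ring].
Qed.

Lemma ex_derive_Cplus (f g : C -> C) (p : C) :
  ex_derive f p -> ex_derive g p -> ex_derive (fun q => f q + g q) p.
Proof. exact (ex_derive_plus (V := C_NormedModule) f g p). Qed.

Lemma ex_derive_Copp (f : C -> C) (p : C) : ex_derive f p -> ex_derive (fun q => - f q) p.
Proof. exact (ex_derive_opp (V := C_NormedModule) f p). Qed.

Lemma ex_derive_Cminus (f g : C -> C) (p : C) :
  ex_derive f p -> ex_derive g p -> ex_derive (fun q => f q - g q) p.
Proof. exact (ex_derive_minus (V := C_NormedModule) f g p). Qed.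

Lemma ex_derive_Cmult (f g : C -> C) (p : C) :
  ex_derive f p -> ex_derive g p -> ex_derive (fun q => f q * g q) p.
Proof.
  intros Hf Hg; pose proof (ex_derive_C_continuous _ _ Hg) as Cg.
  apply ex_derive_caratheodory in Hf; destruct Hf as [u [Hu Eu]].
  apply ex_derive_caratheodory in Hg; destruct Hg as [v [Hv Ev]].
  apply ex_derive_caratheodory; exists (fun q => u q * g q + f p * v q); split.
  - apply continuous_Cplus; apply continuous_Cmult; auto using continuous_const.
  - intro q; replace (f q * g q - f p * g p)
      with ((f q - f p) * g q + f p * (g q - g p)) by ring.
    rewrite Eu, Ev; ring.
Qed.

Lemma ex_derive_Ccomp (f g : C -> C) (p : C) :
  ex_derive g (f p) -> ex_derive f p -> ex_derive (fun q => g (f q)) p.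
Proof.
  intros Hg Hf; pose proof (ex_derive_C_continuous _ _ Hf) as Cf.
  apply ex_derive_caratheodory in Hf; destruct Hf as [u [Hu Eu]].
  apply ex_derive_caratheodory in Hg; destruct Hg as [v [Hv Ev]].
  apply ex_derive_caratheodory; exists (fun q => v (f q) * u q); split.
  - apply continuous_Cmult; [now apply continuous_comp|exact Hu].
  - intro q; rewrite Ev, Eu; ring.
Qed.

Lemma ex_derive_Cinv (p : C) : p <> 0 -> ex_derive Cinv p.
Proof.
  intros H0; assert (Nz : locally p (fun q : C => q <> 0)).
  { exact (continuous_neq_0 (fun q : C => q) p (continuous_id p) H0). }
  apply (ex_derive_C_ext_loc (fun q => / p + - (/ p * / q) * (q - p))).
  - apply filter_imp with (2 := Nz); intros q Hq; field; auto.
  - apply ex_derive_caratheodory; exists (fun q => - (1) * (/ p * / q)); split.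
    + apply continuous_Cmult; [apply continuous_const|].
      apply continuous_Cmult; [apply continuous_const|].
      apply (continuous_Cinv (fun q => q)); [apply continuous_id|exact H0].
    + intro q; ring.
Qed.

Lemma ex_derive_Cdiv (f g : C -> C) (p : C) :
  ex_derive f p -> ex_derive g p -> g p <> 0 -> ex_derive (fun q => f q / g q) p.
Proof.
  intros Hf Hg H0; apply ex_derive_Cmult; [exact Hf|].
  apply (ex_derive_Ccomp g Cinv); [now apply ex_derive_Cinv|exact Hg].
Qed.

Lemma ex_derive_Cpow (p : C) (n : nat) : ex_derive (fun q : C => q ^ n) p.
Proof.
  induction n; simpl; [apply ex_derive_Cconst|apply ex_derive_Cmult; [apply ex_derive_Cid|exact IHn]].
Qed.

Lemma filterdiff_of_is_derive (f : C -> C) (p l : C) :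
  is_derive f p l ->
  filterdiff (U := C_R_NormedModule) (V := C_R_NormedModule) f (locally p) (fun h => h * l).
Proof.
  intros [_ Hf]; split.
  - split.
    + intros x y; apply Cmult_plus_distr_r.
    + intros k x; rewrite !scal_R_Cmult; symmetry; apply Cmult_assoc.
    + exists (Cmod l + 1)%R; split; [pose proof (Cmod_ge_0 l); lra|]; intros x.
      rewrite <- !Cmod_norm, Cmod_mult; pose proof (Cmod_ge_0 x); nra.
  - intros x Hx eps.
    apply (is_filter_lim_locally_unique (V := C_R_NormedModule)) in Hx; subst x.
    specialize (Hf p (fun P H => H) eps); apply locally_C in Hf.
    revert Hf; apply (filter_imp (F := locally (T := C_UniformSpace) p)).
    intros q Hq; rewrite <- !Cmod_norm; exact Hq.
Qed.

(** * Complex-valued functions of a real variable *)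

Lemma is_derive_Ccomp (f : C -> C) (g : R -> C) (t : R) (l h : C) :
  is_derive f (g t) l -> is_derive g t h -> is_derive (fun s => f (g s)) t (h * l).
Proof.
  intros Hf Hg; apply filterdiff_of_is_derive in Hf.
  apply (filterdiff_ext_lin _ (fun y : R => @scal R_Ring C_R_ModuleSpace y h * l)).
  - exact (filterdiff_comp' (V := C_R_NormedModule) (W := C_R_NormedModule) g f t _
      (fun h => h * l) Hg Hf).
  - intros y; rewrite !scal_R_Cmult; symmetry; apply Cmult_assoc.
Qed.

Lemma is_derive_Re_Im (f : R -> C) (t : R) (l : C) :
  is_derive f t l <->
  is_derive (fun s => Re (f s)) t (Re l) /\ is_derive (fun s => Im (f s)) t (Im l).
Proof.
  split.
  - intros Hf; split.
    + exact (filterdiff_comp' f fst t _ fst Hf (filterdiff_linear fst is_linear_fst)).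
    + exact (filterdiff_comp' f snd t _ snd Hf (filterdiff_linear snd is_linear_snd)).
  - assert (Decomp : forall z : C,
      @plus C_R_NormedModule (scal (Re z) (RtoC 1)) (scal (Im z) Ci) = z).
    { intros z; rewrite !scal_R_Cmult; rewrite (C_Re_Im z) at 3.
      change (RtoC (Re z) * 1 + RtoC (Im z) * Ci = RtoC (Re z) + Ci * RtoC (Im z)); ring. }
    intros [Hre Him]; rewrite <- (Decomp l).
    apply (is_derive_ext (V := C_R_NormedModule) _ _ t _ (fun s => Decomp (f s))).
    exact (is_derive_plus (V := C_R_NormedModule) _ _ t _ _
      (is_derive_scal_l _ t _ (RtoC 1) Hre) (is_derive_scal_l _ t _ Ci Him)).
Qed.

Lemma is_derive_RtoC (f : R -> R) (t l : R) :
  is_derive f t l -> is_derive (fun s => RtoC (f s)) t (RtoC l).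
Proof.
  intros Hf; apply is_derive_Re_Im; split; [exact Hf|].
  exact (is_derive_const (V := R_NormedModule) 0%R t).
Qed.

Lemma is_derive_Cmult (f g : R -> C) (t : R) (l l' : C) :
  is_derive f t l -> is_derive g t l' -> is_derive (fun s => f s * g s) t (l * g t + f t * l').
Proof.
  intros Hf Hg; apply is_derive_Re_Im in Hf, Hg; destruct Hf as [F1 F2], Hg as [G1 G2].
  assert (M : forall u v du dv, is_derive u t du -> is_derive v t dv ->
    is_derive (fun s => u s * v s)%R t (du * v t + u t * dv)%R).
  { intros; now apply (is_derive_mult (K := R_AbsRing)); [..|apply Rmult_comm]. }
  apply is_derive_Re_Im; split.
  - replace (Re _) with ((Re l * Re (g t) + Re (f t) * Re l')
      - (Im l * Im (g t) + Im (f t) * Im l'))%R by (unfold Re, Im; simpl; ring).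
    exact (is_derive_minus (V := R_NormedModule) _ _ t _ _ (M _ _ _ _ F1 G1) (M _ _ _ _ F2 G2)).
  - replace (Im _) with ((Re l * Im (g t) + Re (f t) * Im l')
      + (Im l * Re (g t) + Im (f t) * Re l'))%R by (unfold Re, Im; simpl; ring).
    exact (is_derive_plus (V := R_NormedModule) _ _ t _ _ (M _ _ _ _ F1 G2) (M _ _ _ _ F2 G1)).
Qed.

Lemma is_derive_C_continuous (f : R -> C) (t : R) (l : C) : is_derive f t l -> continuous f t.
Proof. intros Hf; apply (ex_derive_continuous (V := C_R_NormedModule)); now exists l. Qed.

Lemma is_derive_Cmult_l (a : C) (g : R -> C) (t : R) (h : C) :
  is_derive g t h -> is_derive (fun s => a * g s) t (a * h).
Proof.
  intros Hg; replace (a * h) with (0 * g t + a * h) by ring.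
  apply (is_derive_Cmult (fun _ => a)); [exact (is_derive_const (V := C_R_NormedModule) a t)|exact Hg].
Qed.

Notation CRInt := (RInt (V := C_R_CompleteNormedModule)).

Lemma is_RInt_CRInt (f : R -> C) (a b : R) :
  (forall t, Rmin a b <= t <= Rmax a b -> continuous f t) -> is_RInt f a b (CRInt f a b).
Proof.
  intros H; apply (RInt_correct (V := C_R_CompleteNormedModule)).
  now apply (ex_RInt_continuous (V := C_R_CompleteNormedModule)).
Qed.

Lemma CRInt_unique (f : R -> C) (a b : R) (l : C) : is_RInt f a b l -> CRInt f a b = l.
Proof. exact (is_RInt_unique (V := C_R_CompleteNormedModule) f a b l). Qed.

Lemma is_RInt_Cplus (f g : R -> C) (a b : R) (l l' : C) :
  is_RInt f a b l -> is_RInt g a b l' -> is_RInt (fun t => f t + g t) a b (l + l').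
Proof. exact (is_RInt_plus (V := C_R_NormedModule) f g a b l l'). Qed.

Lemma is_RInt_Cminus (f g : R -> C) (a b : R) (l l' : C) :
  is_RInt f a b l -> is_RInt g a b l' -> is_RInt (fun t => f t - g t) a b (l - l').
Proof. exact (is_RInt_minus (V := C_R_NormedModule) f g a b l l'). Qed.

Lemma is_RInt_Cconst (c : C) (a b : R) : is_RInt (fun _ => c) a b (RtoC (b - a) * c).
Proof. rewrite <- scal_R_Cmult; exact (is_RInt_const (V := C_R_NormedModule) a b c). Qed.

Lemma is_RInt_C0 (a b : R) : is_RInt (fun _ => RtoC 0) a b (RtoC 0).
Proof. pose proof (is_RInt_Cconst 0 a b) as Z; now rewrite Cmult_0_r in Z. Qed.

Lemma is_RInt_Re (f : R -> C) (a b : R) (l : C) :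
  is_RInt f a b l -> is_RInt (fun t => Re (f t)) a b (Re l).
Proof. exact (is_RInt_fct_extend_fst (U := R_NormedModule) (V := R_NormedModule) f a b l). Qed.

Lemma is_RInt_Im (f : R -> C) (a b : R) (l : C) :
  is_RInt f a b l -> is_RInt (fun t => Im (f t)) a b (Im l).
Proof. exact (is_RInt_fct_extend_snd (U := R_NormedModule) (V := R_NormedModule) f a b l). Qed.

Lemma is_RInt_Cmult_l (c : C) (f : R -> C) (a b : R) (l : C) :
  is_RInt f a b l -> is_RInt (fun t => c * f t) a b (c * l).
Proof.
  intros H; pose proof (is_RInt_Re f a b l H) as H1; pose proof (is_RInt_Im f a b l H) as H2.
  destruct c as [u v].
  apply (is_RInt_fct_extend_pair (U := R_NormedModule) (V := R_NormedModule)).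
  - exact (is_RInt_minus (V := R_NormedModule) _ _ a b _ _
      (is_RInt_scal (V := R_NormedModule) _ a b u _ H1)
      (is_RInt_scal (V := R_NormedModule) _ a b v _ H2)).
  - exact (is_RInt_plus (V := R_NormedModule) _ _ a b _ _
      (is_RInt_scal (V := R_NormedModule) _ a b u _ H2)
      (is_RInt_scal (V := R_NormedModule) _ a b v _ H1)).
Qed.

Lemma is_RInt_RtoC (f : R -> R) (a b l : R) :
  is_RInt f a b l -> is_RInt (fun t => RtoC (f t)) a b (RtoC l).
Proof.
  intros H; apply (is_RInt_fct_extend_pair (U := R_NormedModule) (V := R_NormedModule)); [exact H|].
  change (is_RInt (fun _ : R => 0%R) a b 0%R); rewrite <- (Rmult_0_r (b - a)) at 1.
  exact (is_RInt_const (V := R_NormedModule) a b 0%R).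
Qed.

Lemma Cmod_RInt_le (f : R -> C) (g : R -> R) (a b : R) (l : C) (lg : R) :
  a <= b -> (forall t, a <= t <= b -> Cmod (f t) <= g t) ->
  is_RInt f a b l -> is_RInt g a b lg -> Cmod l <= lg.
Proof.
  intros Hab Hfg Hf Hg; rewrite Cmod_norm.
  apply (norm_RInt_le (V := C_R_NormedModule) f g a b l lg Hab); auto.
  intros t Ht; rewrite <- Cmod_norm; auto.
Qed.

Lemma Cmod_RInt_le_const (f : R -> C) (a b : R) (l : C) (M : R) :
  a <= b -> (forall t, a <= t <= b -> Cmod (f t) <= M) -> is_RInt f a b l -> Cmod l <= (b - a) * M.
Proof.
  intros Hab HM Hf; apply (Cmod_RInt_le f (fun _ => M) a b); auto.
  exact (is_RInt_const (V := R_NormedModule) a b M).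
Qed.

Lemma is_RInt_C_derive (f df : R -> C) (a b : R) :
  (forall t, Rmin a b <= t <= Rmax a b -> is_derive f t (df t)) ->
  (forall t, Rmin a b <= t <= Rmax a b -> continuous df t) ->
  is_RInt df a b (f b - f a).
Proof. exact (is_RInt_derive (V := C_R_CompleteNormedModule) f df a b). Qed.

(** * The complex exponential *)

Lemma cexp_plus (x y : C) : cexp (x + y) = cexp x * cexp y.
Proof.
  destruct x as [a b], y as [c d]; unfold cexp, Cmult, Cplus; simpl.
  rewrite exp_plus, cos_plus, sin_plus; f_equal; ring.
Qed.

Lemma cexp_0 : cexp 0 = 1.
Proof. unfold cexp; simpl; rewrite exp_0, cos_0, sin_0; unfold RtoC; f_equal; ring. Qed.

Lemma Cmod_cexp (x : C) : Cmod (cexp x) = exp (Re x).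
Proof.
  unfold cexp, Cmod; simpl; set (E := exp (Re x)).
  replace (E * cos (Im x) * (E * cos (Im x) * 1) + E * sin (Im x) * (E * sin (Im x) * 1))%R
    with (E * E * ((sin (Im x))² + (cos (Im x))²))%R by (unfold Rsqr; ring).
  rewrite sin2_cos2, Rmult_1_r; apply sqrt_square; left; apply exp_pos.
Qed.

Lemma cexp_neq_0 (x : C) : cexp x <> 0.
Proof. apply Cmod_gt_0; rewrite Cmod_cexp; apply exp_pos. Qed.

Lemma cexp_RtoC (x : R) : cexp (RtoC x) = RtoC (exp x).
Proof. unfold cexp, RtoC; simpl; rewrite cos_0, sin_0; f_equal; ring. Qed.

Lemma cexp_opp (x : C) : cexp (- x) = / cexp x.
Proof.
  assert (H : cexp (- x) * cexp x = 1).
  { rewrite <- cexp_plus, Cplus_comm, Cplus_opp_r; apply cexp_0. }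
  replace (/ cexp x) with ((cexp (- x) * cexp x) / cexp x) by (rewrite H; field; apply cexp_neq_0).
  field; apply cexp_neq_0.
Qed.

Lemma cexp_pow (x : C) (n : nat) : cexp x ^ n = cexp (RtoC (INR n) * x).
Proof.
  induction n; simpl Cpow.
  - simpl INR; rewrite Cmult_0_l; now rewrite cexp_0.
  - rewrite IHn, <- cexp_plus, S_INR, RtoC_plus; f_equal; ring.
Qed.

Lemma Re_Cmult_RtoC_opp (z : C) (t : R) : Re (- z * RtoC t) = (- (Re z * t))%R.
Proof. rewrite re_scal_r, re_opp; ring. Qed.

Lemma is_derive_cexp_line (a : C) (t : R) :
  is_derive (fun s => cexp (a * RtoC s)) t (a * cexp (a * RtoC t)).
Proof.
  destruct a as [x y]; apply is_derive_Re_Im; unfold cexp, Re, Im, Cmult, RtoC; simpl.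
  split; auto_derive; auto; unfold Rminus; ring.
Qed.

Lemma is_RInt_cexp_line (a : C) : is_RInt (fun t => a * cexp (a * RtoC t)) 0 1 (cexp a - 1).
Proof.
  replace (cexp a - 1) with (cexp (a * RtoC 1) - cexp (a * RtoC 0)).
  2:{ rewrite Cmult_1_r, Cmult_0_r, cexp_0; reflexivity. }
  apply (is_RInt_C_derive (fun t => cexp (a * RtoC t))); intros t _; [apply is_derive_cexp_line|].
  apply continuous_Cmult; [apply continuous_const|eapply is_derive_C_continuous, is_derive_cexp_line].
Qed.

Lemma Cmod_cexp_sub_1_le (h : C) : Cmod h <= 1 -> Cmod (cexp h - 1) <= 3 * Cmod h.
Proof.
  intros Hh; replace (3 * Cmod h)%R with ((1 - 0) * (3 * Cmod h))%R by ring.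
  eapply Cmod_RInt_le_const; [lra| |apply is_RInt_cexp_line].
  intros t Ht; cbv beta; rewrite Cmod_mult, Cmod_cexp, Rmult_comm.
  apply Rmult_le_compat_r; [apply Cmod_ge_0|].
  apply Rle_trans with (exp 1); [apply exp_le_compat|apply exp_le_3].
  eapply Rle_trans; [apply Rle_abs|]; eapply Rle_trans; [apply re_le_Cmod|].
  rewrite Cmod_mult, Cmod_R, Rabs_pos_eq by lra; pose proof (Cmod_ge_0 h); nra.
Qed.

Lemma Cmod_cexp_sub_1_sub_le (h : C) : Cmod h <= 1 -> Cmod (cexp h - 1 - h) <= 3 * (Cmod h * Cmod h).
Proof.
  intros Hh; pose proof (Cmod_ge_0 h).
  assert (I := is_RInt_Cminus _ _ _ _ _ _ (is_RInt_cexp_line h) (is_RInt_Cconst h 0 1)).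
  rewrite Rminus_0_r, Cmult_1_l in I.
  replace (3 * (Cmod h * Cmod h))%R with ((1 - 0) * (Cmod h * (3 * Cmod h)))%R by ring.
  eapply Cmod_RInt_le_const; [lra| |exact I].
  intros t Ht; cbv beta.
  replace (h * cexp (h * RtoC t) - h) with (h * (cexp (h * RtoC t) - 1)) by ring.
  rewrite Cmod_mult; apply Rmult_le_compat_l; [lra|].
  assert (Hht : Cmod (h * RtoC t) <= Cmod h) by (rewrite Cmod_mult, Cmod_R, Rabs_pos_eq by lra; nra).
  eapply Rle_trans; [apply Cmod_cexp_sub_1_le|]; lra.
Qed.

Lemma is_derive_cexp (p : C) : is_derive cexp p (cexp p).
Proof.
  apply is_derive_Cmod; intros eps Heps; pose proof (Cmod_ge_0 (cexp p)) as H0.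
  set (K := (3 * Cmod (cexp p) + 1)%R).
  apply locally_Cmod; exists (Rmin 1 (eps / K)); split.
  { apply Rmin_pos; [lra|apply Rdiv_lt_0_compat; unfold K; lra]. }
  intros q Hq; pose proof (Rmin_l 1 (eps / K)) as H1; pose proof (Rmin_r 1 (eps / K)) as H2.
  replace (cexp q - cexp p - cexp p * (q - p)) with (cexp p * (cexp (q - p) - 1 - (q - p))).
  2:{ replace q with (p + (q - p)) at 3 by ring; rewrite cexp_plus; ring. }
  pose proof (Cmod_cexp_sub_1_sub_le (q - p) ltac:(lra)) as HB; pose proof (Cmod_ge_0 (q - p)).
  assert (H3 : Cmod (q - p) * K <= eps) by (apply Rle_div_r; unfold K in *; lra).
  rewrite Cmod_mult; apply Rle_trans with (Cmod (cexp p) * (3 * (Cmod (q - p) * Cmod (q - p))))%R.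
  - now apply Rmult_le_compat_l.
  - unfold K in H3; nra.
Qed.

Lemma ex_derive_cexp (p : C) : ex_derive cexp p.
Proof. exists (cexp p); apply is_derive_cexp. Qed.

Lemma continuous_cexp (p : C) : continuous cexp p.
Proof. apply ex_derive_C_continuous, ex_derive_cexp. Qed.

(** * Goursat's theorem *)

Record rectangle := Rectangle { xmin : R; xmax : R; ymin : R; ymax : R }.

Definition well_formed (r : rectangle) : Prop := xmin r <= xmax r /\ ymin r <= ymax r.

Definition in_rect (r : rectangle) (z : C) : Prop :=
  xmin r <= Re z <= xmax r /\ ymin r <= Im z <= ymax r.

Definition subrect (r s : rectangle) : Prop :=
  well_formed r /\ xmin s <= xmin r /\ xmax r <= xmax s /\ ymin s <= ymin r /\ ymax r <= ymax s.

Definition semiperimeter (r : rectangle) : R := ((xmax r - xmin r) + (ymax r - ymin r))%R.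

Definition rect_int (f : C -> C) (r : rectangle) : C :=
  CRInt (fun x => f (x, ymin r)) (xmin r) (xmax r)
  + Ci * CRInt (fun y => f (xmax r, y)) (ymin r) (ymax r)
  - CRInt (fun x => f (x, ymax r)) (xmin r) (xmax r)
  - Ci * CRInt (fun y => f (xmin r, y)) (ymin r) (ymax r).

Ltac rect_lra := unfold subrect, well_formed, in_rect, semiperimeter in *; simpl in *; lra.

Lemma in_rect_subrect (r s : rectangle) (z : C) : subrect r s -> in_rect r z -> in_rect s z.
Proof. rect_lra. Qed.

Lemma subrect_trans (r s t : rectangle) : subrect r s -> subrect s t -> subrect r t.
Proof. rect_lra. Qed.

Section RectangleIntegral.
Variables (f : C -> C) (r : rectangle).
Hypothesis f_continuous : forall z, in_rect r z -> continuous f z.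

Lemma is_RInt_horizontal (y u v : R) :
  ymin r <= y <= ymax r -> xmin r <= u <= v -> v <= xmax r ->
  is_RInt (fun x => f (x, y)) u v (CRInt (fun x => f (x, y)) u v).
Proof.
  intros Hy Hu Hv; apply is_RInt_CRInt; intros t Ht; rewrite Rmin_left, Rmax_right in Ht by lra.
  apply (continuous_comp (fun x => (x, y)) f); [|apply f_continuous; rect_lra].
  apply continuous_pair; [apply continuous_id|apply continuous_const].
Qed.

Lemma is_RInt_vertical (x u v : R) :
  xmin r <= x <= xmax r -> ymin r <= u <= v -> v <= ymax r ->
  is_RInt (fun y => f (x, y)) u v (CRInt (fun y => f (x, y)) u v).
Proof.
  intros Hx Hu Hv; apply is_RInt_CRInt; intros t Ht; rewrite Rmin_left, Rmax_right in Ht by lra.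
  apply (continuous_comp (fun y => (x, y)) f); [|apply f_continuous; rect_lra].
  apply continuous_pair; [apply continuous_const|apply continuous_id].
Qed.

Lemma rect_int_split_x (m : R) : well_formed r -> xmin r <= m <= xmax r ->
  rect_int f r = rect_int f (Rectangle (xmin r) m (ymin r) (ymax r))
    + rect_int f (Rectangle m (xmax r) (ymin r) (ymax r)).
Proof.
  intros Hr Hm; unfold rect_int; simpl.
  assert (Split : forall y, ymin r <= y <= ymax r -> CRInt (fun x => f (x, y)) (xmin r) (xmax r) =
    CRInt (fun x => f (x, y)) (xmin r) m + CRInt (fun x => f (x, y)) m (xmax r)).
  { intros y Hy; apply CRInt_unique, (is_RInt_Chasles (V := C_R_NormedModule) _ _ m);
      apply is_RInt_horizontal; rect_lra. }
  rewrite !Split by rect_lra; ring.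
Qed.

Lemma rect_int_split_y (m : R) : well_formed r -> ymin r <= m <= ymax r ->
  rect_int f r = rect_int f (Rectangle (xmin r) (xmax r) (ymin r) m)
    + rect_int f (Rectangle (xmin r) (xmax r) m (ymax r)).
Proof.
  intros Hr Hm; unfold rect_int; simpl.
  assert (Split : forall x, xmin r <= x <= xmax r -> CRInt (fun y => f (x, y)) (ymin r) (ymax r) =
    CRInt (fun y => f (x, y)) (ymin r) m + CRInt (fun y => f (x, y)) m (ymax r)).
  { intros x Hx; apply CRInt_unique, (is_RInt_Chasles (V := C_R_NormedModule) _ _ m);
      apply is_RInt_vertical; rect_lra. }
  rewrite !Split by rect_lra; ring.
Qed.

Lemma Cmod_rect_int_le (M : R) : well_formed r -> (forall z, in_rect r z -> Cmod (f z) <= M) ->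
  Cmod (rect_int f r) <= 2 * M * semiperimeter r.
Proof.
  intros Hr HM.
  assert (Hh : forall y, ymin r <= y <= ymax r ->
    Cmod (CRInt (fun x => f (x, y)) (xmin r) (xmax r)) <= (xmax r - xmin r) * M).
  { intros y Hy; eapply Cmod_RInt_le_const; [rect_lra| |apply is_RInt_horizontal; rect_lra].
    intros; apply HM; rect_lra. }
  assert (Hv : forall x, xmin r <= x <= xmax r ->
    Cmod (CRInt (fun y => f (x, y)) (ymin r) (ymax r)) <= (ymax r - ymin r) * M).
  { intros x Hx; eapply Cmod_RInt_le_const; [rect_lra| |apply is_RInt_vertical; rect_lra].
    intros; apply HM; rect_lra. }
  unfold rect_int.
  eapply Rle_trans; [apply Cmod_sub_le|].
  eapply Rle_trans; [apply Rplus_le_compat_r, Cmod_sub_le|].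
  eapply Rle_trans; [apply Rplus_le_compat_r, Rplus_le_compat_r, Cmod_triangle|].
  rewrite !Cmod_mult, Cmod_Ci.
  pose proof (Hv (xmin r) ltac:(rect_lra)); pose proof (Hv (xmax r) ltac:(rect_lra)).
  pose proof (Hh (ymin r) ltac:(rect_lra)); pose proof (Hh (ymax r) ltac:(rect_lra)).
  unfold semiperimeter; lra.
Qed.

End RectangleIntegral.

Lemma rect_int_quarter (f : C -> C) (r : rectangle) :
  (forall z, in_rect r z -> continuous f z) -> well_formed r ->
  exists s, subrect s r /\ semiperimeter s = (semiperimeter r / 2)%R /\
    Cmod (rect_int f r) <= 4 * Cmod (rect_int f s).
Proof.
  intros Hc Hr; set (x := ((xmin r + xmax r) / 2)%R); set (y := ((ymin r + ymax r) / 2)%R).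
  assert (Hx : xmin r <= x <= xmax r) by (unfold x; rect_lra).
  assert (Hy : ymin r <= y <= ymax r) by (unfold y; rect_lra).
  set (q1 := Rectangle (xmin r) x (ymin r) y); set (q2 := Rectangle (xmin r) x y (ymax r)).
  set (q3 := Rectangle x (xmax r) (ymin r) y); set (q4 := Rectangle x (xmax r) y (ymax r)).
  assert (Sum : rect_int f r = (rect_int f q1 + rect_int f q2) + (rect_int f q3 + rect_int f q4)).
  { rewrite (rect_int_split_x f r Hc x) by assumption.
    rewrite (rect_int_split_y f (Rectangle (xmin r) x (ymin r) (ymax r))) with (m := y)
      by (try (intros; apply Hc); rect_lra).
    rewrite (rect_int_split_y f (Rectangle x (xmax r) (ymin r) (ymax r))) with (m := y)
      by (try (intros; apply Hc); rect_lra).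
    reflexivity. }
  pose proof (Cmod_triangle (rect_int f q1 + rect_int f q2) (rect_int f q3 + rect_int f q4)) as T.
  pose proof (Cmod_triangle (rect_int f q1) (rect_int f q2)) as T1.
  pose proof (Cmod_triangle (rect_int f q3) (rect_int f q4)) as T2.
  rewrite <- Sum in T.
  assert (Largest : exists s, (s = q1 \/ s = q2 \/ s = q3 \/ s = q4) /\
    Cmod (rect_int f r) <= 4 * Cmod (rect_int f s)).
  { destruct (Rle_dec (Cmod (rect_int f r)) (4 * Cmod (rect_int f q1))); [exists q1; auto|].
    destruct (Rle_dec (Cmod (rect_int f r)) (4 * Cmod (rect_int f q2))); [exists q2; auto|].
    destruct (Rle_dec (Cmod (rect_int f r)) (4 * Cmod (rect_int f q3))); [exists q3; auto|].
    exists q4; split; [auto|lra]. }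
  destruct Largest as [s [Hs Hle]]; exists s.
  split; [|split; [|exact Hle]]; destruct Hs as [-> | [-> | [-> | ->]]]; unfold x, y in *; rect_lra.
Qed.

Lemma rect_int_subdivision (f : C -> C) (r : rectangle) :
  (forall z, in_rect r z -> continuous f z) -> well_formed r ->
  exists s : nat -> rectangle, subrect (s 0%nat) r /\ forall n, subrect (s (S n)) (s n) /\
    semiperimeter (s n) = (semiperimeter r / 2 ^ n)%R /\
    Cmod (rect_int f r) <= 4 ^ n * Cmod (rect_int f (s n)).
Proof.
  intros Hc Hr.
  set (quarter := fun s => epsilon (inhabits s) (fun q => subrect q s /\
    semiperimeter q = (semiperimeter s / 2)%R /\ Cmod (rect_int f s) <= 4 * Cmod (rect_int f q))).
  assert (Hquarter : forall s, subrect s r -> subrect (quarter s) s /\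
    semiperimeter (quarter s) = (semiperimeter s / 2)%R /\
    Cmod (rect_int f s) <= 4 * Cmod (rect_int f (quarter s))).
  { intros s Hs; unfold quarter; apply epsilon_spec, rect_int_quarter; [|rect_lra].
    intros z Hz; now apply Hc, (in_rect_subrect s). }
  set (s := fun n => Nat.iter n quarter r).
  assert (Hs : forall n, subrect (s n) r).
  { induction n; [rect_lra|]; apply (subrect_trans _ (s n)); [now apply Hquarter|exact IHn]. }
  exists s; split; [apply Hs|]; intros n; split; [now apply Hquarter|].
  induction n as [|n [IHsize IHle]].
  - simpl; split; [field|lra].
  - destruct (Hquarter (s n) (Hs n)) as [_ [Hsize Hle]].
    change (s (S n)) with (quarter (s n)); split.
    + rewrite Hsize, IHsize; simpl; field; apply pow_nonzero; lra.
    + assert (0 < 4 ^ n) by (apply pow_lt; lra).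
      apply Rmult_le_compat_l with (r := (4 ^ n)%R) in Hle; simpl; lra.
Qed.

Lemma nested_intervals (a b : nat -> R) :
  Un_growing a -> Un_decreasing b -> (forall n, a n <= b n) -> exists x, forall n, a n <= x <= b n.
Proof.
  intros Ha Hb Hab.
  assert (Cross : forall n k, a n <= b k).
  { intros n k; pose proof (growing_prop a (n + k) n Ha ltac:(lia)).
    pose proof (decreasing_prop b k (n + k) Hb ltac:(lia)); specialize (Hab (n + k)%nat); lra. }
  destruct (completeness (fun x => exists n, x = a n)) as [x [Hup Hleast]].
  - exists (b 0%nat); intros x [n ->]; apply Cross.
  - exists (a 0%nat), 0%nat; reflexivity.
  - exists x; intros n; split; [apply Hup; now exists n|].
    apply Hleast; intros y [k ->]; apply Cross.
Qed.

Lemma nested_rectangles (s : nat -> rectangle) :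
  (forall n, subrect (s (S n)) (s n)) -> exists p, forall n, in_rect (s n) p.
Proof.
  intros Hs.
  destruct (nested_intervals (fun n => xmin (s n)) (fun n => xmax (s n))) as [x Hx];
    try (intros n; specialize (Hs n); rect_lra).
  destruct (nested_intervals (fun n => ymin (s n)) (fun n => ymax (s n))) as [y Hy];
    try (intros n; specialize (Hs n); rect_lra).
  exists (x, y); split; [apply Hx|apply Hy].
Qed.

Lemma is_derive_horizontal (y t : R) : is_derive (fun x => (x, y) : C) t (RtoC 1).
Proof.
  apply is_derive_Re_Im; split; simpl; [exact (is_derive_id (K := R_AbsRing) t)|].
  exact (is_derive_const (V := R_NormedModule) y t).
Qed.

Lemma is_derive_vertical (x t : R) : is_derive (fun y => (x, y) : C) t Ci.
Proof.
  apply is_derive_Re_Im; split; simpl; [exact (is_derive_const (V := R_NormedModule) x t)|].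
  exact (is_derive_id (K := R_AbsRing) t).
Qed.

Lemma rect_int_primitive (f G : C -> C) (r : rectangle) :
  (forall z, continuous f z) -> (forall z, is_derive G z (f z)) -> rect_int f r = 0.
Proof.
  intros Hf HG; unfold rect_int.
  assert (Hh : forall y u v, CRInt (fun x => f (x, y)) u v = G (v, y) - G (u, y)).
  { intros y u v; apply CRInt_unique, (is_RInt_C_derive (fun x => G (x, y))); intros t _.
    - rewrite <- (Cmult_1_l (f (t, y))).
      apply (is_derive_Ccomp G (fun x => (x, y))); [apply HG|apply is_derive_horizontal].
    - apply (continuous_comp (fun x => (x, y)) f); [|apply Hf].
      eapply is_derive_C_continuous, is_derive_horizontal. }
  assert (Hv : forall x u v, Ci * CRInt (fun y => f (x, y)) u v = G (x, v) - G (x, u)).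
  { intros x u v.
    assert (Hc : forall t, continuous (fun y : R => f (x, y)) t).
    { intros t; apply (continuous_comp (fun y => (x, y)) f); [|apply Hf].
      eapply is_derive_C_continuous, is_derive_vertical. }
    rewrite <- (CRInt_unique _ _ _ _ (is_RInt_Cmult_l Ci _ u v _ (is_RInt_CRInt _ u v (fun t _ => Hc t)))).
    apply CRInt_unique, (is_RInt_C_derive (fun y => G (x, y))); intros t _.
    - apply (is_derive_Ccomp G (fun y => (x, y))); [apply HG|apply is_derive_vertical].
    - apply continuous_Cmult; [apply continuous_const|apply Hc]. }
  rewrite !Hh, !Hv; ring.
Qed.

Lemma rect_int_affine (a b : C) (r : rectangle) : rect_int (fun z => a + b * z) r = 0.
Proof.
  apply (rect_int_primitive _ (fun z => a * z + b / 2 * (z * z))).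
  - intros z; apply continuous_Cplus; [apply continuous_const|].
    apply continuous_Cmult; [apply continuous_const|apply continuous_id].
  - intros z; apply is_derive_caratheodory; exists (fun q => a + b / 2 * (q + z)); split.
    + apply continuous_Cplus; [apply continuous_const|].
      apply continuous_Cmult; [apply continuous_const|].
      apply continuous_Cplus; [apply continuous_id|apply continuous_const].
    + split; [field|intros q; ring].
Qed.

Lemma rect_int_Cminus (f g : C -> C) (r : rectangle) :
  (forall z, in_rect r z -> continuous f z) -> (forall z, in_rect r z -> continuous g z) ->
  well_formed r -> rect_int (fun z => f z - g z) r = rect_int f r - rect_int g r.
Proof.
  intros Hf Hg Hr; unfold rect_int.
  assert (Hh : forall y, ymin r <= y <= ymax r -> CRInt (fun x => f (x, y) - g (x, y)) (xmin r) (xmax r) =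
    CRInt (fun x => f (x, y)) (xmin r) (xmax r) - CRInt (fun x => g (x, y)) (xmin r) (xmax r)).
  { intros y Hy; apply CRInt_unique, is_RInt_Cminus; apply (is_RInt_horizontal _ r); auto; rect_lra. }
  assert (Hv : forall x, xmin r <= x <= xmax r -> CRInt (fun y => f (x, y) - g (x, y)) (ymin r) (ymax r) =
    CRInt (fun y => f (x, y)) (ymin r) (ymax r) - CRInt (fun y => g (x, y)) (ymin r) (ymax r)).
  { intros x Hx; apply CRInt_unique, is_RInt_Cminus; apply (is_RInt_vertical _ r); auto; rect_lra. }
  rewrite !Hh, !Hv by rect_lra; ring.
Qed.

(** The affine part of [f] at [p] has zero integral; only the remainder contributes. *)
Lemma rect_int_near_ex_derive (f : C -> C) (p : C) (eps : R) : ex_derive f p -> 0 < eps ->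
  exists del, 0 < del /\ forall r, well_formed r -> in_rect r p -> semiperimeter r < del ->
    (forall z, in_rect r z -> continuous f z) -> Cmod (rect_int f r) <= eps * semiperimeter r ^ 2.
Proof.
  intros [l Hl] Heps; pose proof (proj1 (is_derive_Cmod f p l) Hl (eps / 2)%R ltac:(lra)) as Hrem.
  apply locally_Cmod in Hrem; destruct Hrem as [del [Hdel Hrem]].
  exists del; split; [exact Hdel|]; intros r Hr Hp Hsize Hc.
  set (aff := fun z : C => (f p - l * p) + l * z).
  assert (Haff : forall z, continuous aff z).
  { intros z; apply continuous_Cplus; [apply continuous_const|].
    apply continuous_Cmult; [apply continuous_const|apply continuous_id]. }
  assert (E : rect_int f r = rect_int (fun z => f z - aff z) r).
  { rewrite rect_int_Cminus by auto; unfold aff; rewrite rect_int_affine; ring. }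
  rewrite E; replace (eps * semiperimeter r ^ 2)%R
    with (2 * (eps / 2 * semiperimeter r) * semiperimeter r)%R by field.
  apply Cmod_rect_int_le; [|exact Hr|].
  - intros z Hz; apply continuous_Cminus; auto.
  - intros z Hz.
    assert (Hdist : Cmod (z - p) <= semiperimeter r).
    { eapply Rle_trans; [apply Cmod_le_re_im|].
      assert (Rabs (Re (z - p)) <= xmax r - xmin r) by (destruct z, p; apply Rabs_le; rect_lra).
      assert (Rabs (Im (z - p)) <= ymax r - ymin r) by (destruct z, p; apply Rabs_le; rect_lra).
      rect_lra. }
    replace (f z - aff z) with (f z - f p - l * (z - p)) by (unfold aff; ring).
    eapply Rle_trans; [apply Hrem; lra|]; apply Rmult_le_compat_l; lra.
Qed.

Theorem goursat (f : C -> C) (r : rectangle) :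
  well_formed r -> (forall z, in_rect r z -> ex_derive f z) -> rect_int f r = 0.
Proof.
  intros Hr Hf.
  assert (Hc : forall z, in_rect r z -> continuous f z) by (intros; now apply ex_derive_C_continuous, Hf).
  destruct (rect_int_subdivision f r Hc Hr) as [s [Hs0 Hs]].
  assert (Hsub : forall n, subrect (s n) r).
  { induction n; [exact Hs0|]; apply (subrect_trans _ (s n)); [apply Hs|exact IHn]. }
  destruct (nested_rectangles s) as [p Hp]; [intros n; apply Hs|].
  set (D := semiperimeter r); assert (HD : 0 <= D) by (unfold D; rect_lra).
  apply Cmod_eq_0, Rle_antisym; [|apply Cmod_ge_0].
  apply le_epsilon; intros eps Heps; rewrite Rplus_0_l.
  destruct (rect_int_near_ex_derive f p (eps / (D ^ 2 + 1))) as [del [Hdel Hsmall]].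
  { apply Hf, (in_rect_subrect (s 0%nat)); auto. }
  { apply Rdiv_lt_0_compat; nra. }
  destruct (pow_lt_1_zero (/ 2) ltac:(rewrite Rabs_pos_eq; lra) (del / (D + 1))%R
    ltac:(apply Rdiv_lt_0_compat; lra)) as [n Hn].
  specialize (Hn n (le_n n)); rewrite Rabs_pos_eq, pow_inv in Hn by (apply pow_le; lra).
  assert (H2n : 0 < 2 ^ n) by (apply pow_lt; lra).
  destruct (Hs n) as [_ [Hsize Hle]]; fold D in Hsize.
  assert (Hlocal : Cmod (rect_int f (s n)) <= eps / (D ^ 2 + 1) * (D / 2 ^ n) ^ 2).
  { rewrite <- Hsize; apply Hsmall; [| |rewrite Hsize|].
    - specialize (Hsub n); rect_lra.
    - apply Hp.
    - apply Rle_lt_trans with ((D + 1) * / 2 ^ n)%R.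
      + apply Rmult_le_compat_r; [left; now apply Rinv_0_lt_compat|lra].
      + rewrite Rmult_comm; apply Rlt_div_r; [lra|exact Hn].
    - intros z Hz; now apply Hc, (in_rect_subrect (s n)). }
  apply Rmult_le_compat_l with (r := (4 ^ n)%R) in Hlocal; [|apply pow_le; lra].
  eapply Rle_trans; [exact Hle|]; eapply Rle_trans; [exact Hlocal|].
  replace (4 ^ n * (eps / (D ^ 2 + 1) * (D / 2 ^ n) ^ 2))%R with (eps * (D ^ 2 / (D ^ 2 + 1)))%R.
  - assert (D ^ 2 / (D ^ 2 + 1) <= 1) by (apply Rle_div_l; nra). nra.
  - replace (4 ^ n)%R with (2 ^ n * 2 ^ n)%R by (rewrite <- Rpow_mult_distr; f_equal; ring).
    field; nra.
Qed.

(** * Mean values and the maximum principle *)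

Definition polar (r t : R) : C := (r * cos t, r * sin t)%R.

Lemma cexp_polar (u t : R) : cexp (u, t) = polar (exp u) t.
Proof. reflexivity. Qed.

Lemma polar_cexp_ln (r t : R) : 0 < r -> polar r t = cexp (ln r, t).
Proof. intros H; now rewrite cexp_polar, exp_ln. Qed.

Lemma Cmod_polar (r t : R) : 0 < r -> Cmod (polar r t) = r.
Proof. intros H; rewrite polar_cexp_ln, Cmod_cexp by exact H; now apply exp_ln. Qed.

Lemma polar_neq_0 (r t : R) : 0 < r -> polar r t <> 0.
Proof. intros H; apply Cmod_gt_0; now rewrite Cmod_polar. Qed.

Lemma polar_2PI (r : R) : polar r (2 * PI) = polar r 0.
Proof. unfold polar; now rewrite cos_2PI, sin_2PI, cos_0, sin_0. Qed.

Lemma polar_pow (r t : R) (n : nat) : 0 < r -> polar r t ^ n = polar (r ^ n) (INR n * t).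
Proof.
  intros H; rewrite !polar_cexp_ln, cexp_pow by (try apply pow_lt; exact H).
  f_equal; rewrite <- Rpower_pow, ln_Rpower by exact H.
  unfold Cmult, RtoC; simpl; f_equal; ring.
Qed.

Lemma continuous_polar (r t : R) : continuous (polar r) t.
Proof. apply continuous_pair; apply continuous_of_ex_derive; auto_derive; auto. Qed.

(** In the coordinate [log q] the circles become vertical segments, and the two
    horizontal sides of a rectangle of height [2 PI] cancel. *)
Lemma circle_int_independent (f : C -> C) (r1 r2 : R) : 0 < r1 <= r2 ->
  (forall q, r1 <= Cmod q <= r2 -> ex_derive f q) ->
  CRInt (fun t => f (polar r1 t)) 0 (2 * PI) = CRInt (fun t => f (polar r2 t)) 0 (2 * PI).
Proof.
  intros Hr Hf; pose proof PI_RGT_0.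
  assert (Hln : ln r1 <= ln r2) by (apply ln_le; lra).
  assert (G : rect_int (fun p => f (cexp p)) (Rectangle (ln r1) (ln r2) 0 (2 * PI)) = 0).
  { apply goursat; [rect_lra|]; intros p [Hp _]; simpl in Hp.
    apply ex_derive_Ccomp; [apply Hf|apply ex_derive_cexp].
    rewrite Cmod_cexp, <- (exp_ln r1), <- (exp_ln r2) by lra.
    split; apply exp_le_compat; lra. }
  unfold rect_int in G; simpl in G.
  set (X := CRInt (fun t => f (polar r1 t)) 0 (2 * PI)).
  set (Y := CRInt (fun t => f (polar r2 t)) 0 (2 * PI)).
  assert (Horizontal : CRInt (fun x => f (cexp (x, 2 * PI)%R)) (ln r1) (ln r2)
    = CRInt (fun x => f (cexp (x, 0%R))) (ln r1) (ln r2)).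
  { apply (RInt_ext (V := C_R_CompleteNormedModule)); intros x _.
    now rewrite !cexp_polar, polar_2PI. }
  assert (Left : CRInt (fun y => f (cexp (ln r1, y))) 0 (2 * PI) = X).
  { apply (RInt_ext (V := C_R_CompleteNormedModule)); intros t _; now rewrite polar_cexp_ln by lra. }
  assert (Right : CRInt (fun y => f (cexp (ln r2, y))) 0 (2 * PI) = Y).
  { apply (RInt_ext (V := C_R_CompleteNormedModule)); intros t _; now rewrite polar_cexp_ln by lra. }
  rewrite Horizontal, Left, Right in G; apply Ceq_minus.
  destruct (Ceq_dec (X - Y) 0) as [E|N]; [exact E|exfalso].
  apply (Cmult_neq_0 Ci (X - Y) Ci_nz N).
  replace (Ci * (X - Y)) with (- (RtoC 0)) by (rewrite <- G; ring); ring.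
Qed.

Lemma mean_value (f : C -> C) (rho : R) (L : C) : 0 < rho ->
  (forall q, 0 < Cmod q <= rho -> ex_derive f q) -> filterlim f (locally' (RtoC 0)) (locally L) ->
  is_RInt (fun t => f (polar rho t)) 0 (2 * PI) (RtoC (2 * PI) * L).
Proof.
  intros Hrho Hf HL; pose proof PI_RGT_0.
  assert (Int : forall r, 0 < r <= rho -> is_RInt (fun t => f (polar r t)) 0 (2 * PI)
    (CRInt (fun t => f (polar r t)) 0 (2 * PI))).
  { intros r Hr; apply is_RInt_CRInt; intros t _.
    apply (continuous_comp (polar r) f); [apply continuous_polar|apply ex_derive_C_continuous, Hf].
    rewrite Cmod_polar; lra. }
  set (X := CRInt (fun t => f (polar rho t)) 0 (2 * PI)).
  replace (RtoC (2 * PI) * L) with X; [apply Int; lra|].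
  apply Ceq_minus, Cmod_eq_0, Rle_antisym; [|apply Cmod_ge_0].
  apply le_epsilon; intros eps Heps; rewrite Rplus_0_l.
  pose proof (proj1 (filterlim_Cmod (locally' (RtoC 0)) f L) HL (eps / (2 * PI))%R
    ltac:(apply Rdiv_lt_0_compat; lra)) as Hnear.
  apply locally_Cmod in Hnear; destruct Hnear as [del [Hdel Hnear]].
  set (r := Rmin rho (del / 2)).
  assert (Hr : 0 < r <= rho) by (split; [apply Rmin_pos; lra|apply Rmin_l]).
  assert (Hrdel : r < del) by (pose proof (Rmin_r rho (del / 2)); unfold r; lra).
  assert (EX : CRInt (fun t => f (polar r t)) 0 (2 * PI) = X).
  { apply circle_int_independent; [exact Hr|intros; apply Hf; lra]. }
  assert (Diff : is_RInt (fun t => f (polar r t) - L) 0 (2 * PI) (X - RtoC (2 * PI) * L)).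
  { rewrite <- (Rminus_0_r (2 * PI)) at 2; rewrite <- EX.
    apply is_RInt_Cminus; [now apply Int|apply is_RInt_Cconst]. }
  replace eps with ((2 * PI - 0) * (eps / (2 * PI)))%R by (field; lra).
  eapply Cmod_RInt_le_const; [lra| |exact Diff]; intros t _; left; apply Hnear.
  - replace (polar r t - 0) with (polar r t) by ring; rewrite Cmod_polar; lra.
  - apply polar_neq_0; lra.
Qed.

Definition mobius (rho : R) (a t : C) : C :=
  RtoC (rho * rho) * (t + a) / (RtoC (rho * rho) + Cconj a * t).

Section Mobius.
Variables (rho : R) (a : C).
Hypothesis a_lt_rho : Cmod a < rho.

Let rho_pos : 0 < rho.
Proof. pose proof (Cmod_ge_0 a); lra. Qed.

Lemma mobius_den_neq_0 (t : C) : Cmod t <= rho -> RtoC (rho * rho) + Cconj a * t <> 0.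
Proof.
  intros Ht Z; pose proof (Cmod_ge_0 a); pose proof (Cmod_ge_0 t).
  assert (E : RtoC (rho * rho) = - (Cconj a * t)).
  { replace (RtoC (rho * rho)) with (RtoC (rho * rho) + Cconj a * t - Cconj a * t) by ring.
    rewrite Z; ring. }
  apply (f_equal Cmod) in E; rewrite Cmod_opp, Cmod_mult, Cmod_conj, Cmod_R in E.
  rewrite Rabs_pos_eq in E by nra; nra.
Qed.

Lemma Cmod_mobius_identity (t : C) :
  ((rho * Cmod (RtoC (rho * rho) + Cconj a * t)) ^ 2 =
   (rho * rho * Cmod (t + a)) ^ 2
   + (rho * rho) * (rho * rho - Cmod t ^ 2) * (rho * rho - Cmod a ^ 2))%R.
Proof. rewrite !Rpow_mult_distr, !Cmod2_alt; destruct t, a; simpl; ring. Qed.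

Lemma Cmod_mobius (t : C) : Cmod t <= rho ->
  Cmod (mobius rho a t) = (rho * rho * Cmod (t + a) / Cmod (RtoC (rho * rho) + Cconj a * t))%R.
Proof.
  intros Ht; unfold mobius; rewrite Cmod_div by now apply mobius_den_neq_0.
  rewrite Cmod_mult, Cmod_R, Rabs_pos_eq by nra; reflexivity.
Qed.

Lemma Cmod_mobius_le (t : C) : Cmod t <= rho -> Cmod (mobius rho a t) <= rho.
Proof.
  intros Ht; pose proof (proj1 (Cmod_gt_0 _) (mobius_den_neq_0 t Ht)) as Hden.
  rewrite Cmod_mobius by exact Ht; apply Rle_div_l; [exact Hden|].
  apply Rle_of_sqr_le; [nra|]; rewrite Cmod_mobius_identity.
  pose proof (Cmod_ge_0 a); pose proof (Cmod_ge_0 t).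
  assert (0 <= (rho * rho - Cmod t ^ 2) * (rho * rho - Cmod a ^ 2)) by (apply Rmult_le_pos; nra).
  assert (0 <= rho * rho) by nra; nra.
Qed.

Lemma Cmod_mobius_circle (t : C) : Cmod t = rho -> Cmod (mobius rho a t) = rho.
Proof.
  intros Ht; pose proof (proj1 (Cmod_gt_0 _) (mobius_den_neq_0 t (Req_le _ _ Ht))) as Hden.
  rewrite Cmod_mobius by lra; apply Rmult_eq_reg_r with (Cmod (RtoC (rho * rho) + Cconj a * t)); [|lra].
  unfold Rdiv; rewrite Rmult_assoc, Rinv_l, Rmult_1_r by lra.
  pose proof (Cmod_mobius_identity t) as Id; rewrite Ht in Id; pose proof (Cmod_ge_0 (t + a)).
  apply Rle_antisym; apply Rle_of_sqr_le; try (apply Rmult_le_pos; nra); rewrite Id; nra.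
Qed.

Lemma ex_derive_mobius (t : C) : Cmod t <= rho -> ex_derive (mobius rho a) t.
Proof.
  intros Ht; apply ex_derive_Cdiv; [| |now apply mobius_den_neq_0].
  - apply ex_derive_Cmult; [apply ex_derive_Cconst|].
    apply ex_derive_Cplus; [apply ex_derive_Cid|apply ex_derive_Cconst].
  - apply ex_derive_Cplus; [apply ex_derive_Cconst|].
    apply ex_derive_Cmult; [apply ex_derive_Cconst|apply ex_derive_Cid].
Qed.

Lemma mobius_0 : mobius rho a 0 = a.
Proof. unfold mobius; rewrite RtoC_mult; field; apply RtoC_neq_0; lra. Qed.

End Mobius.

(** Moving the point to the centre of the disc by a Moebius map turns the mean value
    property into the maximum principle. *)
Lemma maximum_principle (f : C -> C) (rho : R) (a : C) (M : R) : Cmod a < rho ->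
  (forall q, Cmod q <= rho -> ex_derive f q) -> (forall q, Cmod q = rho -> Cmod (f q) <= M) ->
  Cmod (f a) <= M.
Proof.
  intros Ha Hf HM; pose proof PI_RGT_0; pose proof (Cmod_ge_0 a).
  set (g := fun t => f (mobius rho a t)).
  assert (Hg : forall t, Cmod t <= rho -> ex_derive g t).
  { intros t Ht; apply (ex_derive_Ccomp (mobius rho a) f);
      [now apply Hf, Cmod_mobius_le|now apply ex_derive_mobius]. }
  assert (Mean : is_RInt (fun t => g (polar rho t)) 0 (2 * PI) (RtoC (2 * PI) * g 0)).
  { apply mean_value; [lra|intros; apply Hg; lra|].
    apply (filterlim_filter_le_1 (F := locally (RtoC 0))); [apply filter_le_within|].
    apply ex_derive_C_continuous, Hg; rewrite Cmod_0; lra. }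
  assert (Bound : Cmod (RtoC (2 * PI) * g 0) <= (2 * PI - 0) * M).
  { eapply Cmod_RInt_le_const; [lra| |exact Mean]; intros t _.
    apply HM, Cmod_mobius_circle; [exact Ha|apply Cmod_polar; lra]. }
  unfold g in Bound; rewrite mobius_0, Cmod_mult, Cmod_R, Rabs_pos_eq in Bound by lra.
  apply Rmult_le_reg_l with (2 * PI)%R; lra.
Qed.

(** * Series and Cauchy's coefficient formula *)

(** Unlike [sum_n u n], the sum [csum u n] has [n] terms, so that the remainder after
    [csum u n] of a power series is of order [n]. *)
Fixpoint csum (u : nat -> C) (n : nat) : C :=
  match n with O => 0 | S k => csum u k + u k end.

Lemma sum_n_csum (u : nat -> C) (n : nat) : sum_n u n = csum u (S n).
Proof.
  induction n; [rewrite sum_O; simpl; now rewrite Cplus_0_l|].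
  rewrite sum_Sn, IHn; reflexivity.
Qed.

Lemma is_series_csum (u : nat -> C) (l : C) :
  is_series u l <-> filterlim (csum u) eventually (locally l).
Proof.
  split; intros H P HP; destruct (H P HP) as [N HN].
  - exists (S N); intros [|n] Hn; [lia|]; rewrite <- sum_n_csum; apply HN; lia.
  - exists N; intros n Hn; rewrite sum_n_csum; apply HN; lia.
Qed.

Lemma csum_ext (u v : nat -> C) (n : nat) :
  (forall k, (k < n)%nat -> u k = v k) -> csum u n = csum v n.
Proof. induction n; intros H; simpl; [reflexivity|]; rewrite IHn, H; auto. Qed.

Lemma csum_Cmult_l (c : C) (u : nat -> C) (n : nat) : csum (fun k => c * u k) n = c * csum u n.
Proof. induction n; simpl; [ring|rewrite IHn; ring]. Qed.

Lemma csum_Cplus (u v : nat -> C) (n : nat) : csum (fun k => u k + v k) n = csum u n + csum v n.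
Proof. induction n; simpl; [ring|rewrite IHn; ring]. Qed.

Lemma csum_add (u : nat -> C) (a b : nat) : csum u (a + b) = csum u a + csum (fun k => u (k + a)%nat) b.
Proof.
  induction b; [rewrite Nat.add_0_r; simpl; ring|].
  rewrite Nat.add_succ_r; simpl; rewrite IHb, (Nat.add_comm b a); ring.
Qed.

Lemma Cmod_csum_le (u : nat -> C) (M : R) (n : nat) :
  (forall k, (k < n)%nat -> Cmod (u k) <= M) -> Cmod (csum u n) <= INR n * M.
Proof.
  induction n; intros H; [simpl; rewrite Cmod_0; lra|].
  rewrite S_INR; simpl csum; eapply Rle_trans; [apply Cmod_triangle|].
  pose proof (H n ltac:(lia)); pose proof (IHn ltac:(intros; apply H; lia)); lra.
Qed.

Lemma filterlim_csum {T : Type} (F : (T -> Prop) -> Prop) {FF : Filter F}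
  (u : nat -> T -> C) (l : nat -> C) (n : nat) :
  (forall k, (k < n)%nat -> filterlim (u k) F (locally (l k))) ->
  filterlim (fun x => csum (fun k => u k x) n) F (locally (csum l n)).
Proof.
  induction n; intros H; simpl; [apply filterlim_const|].
  apply (filterlim_Cplus F); [apply IHn; intros; apply H|apply H]; lia.
Qed.

Lemma is_RInt_csum (u : nat -> R -> C) (I : nat -> C) (a b : R) (n : nat) :
  (forall k, is_RInt (u k) a b (I k)) -> is_RInt (fun t => csum (fun k => u k t) n) a b (csum I n).
Proof.
  intros H; induction n; simpl; [apply is_RInt_C0|apply is_RInt_Cplus; [exact IHn|apply H]].
Qed.

Lemma is_series_C_unique (u : nat -> C) (l l' : C) : is_series u l -> is_series u l' -> l = l'.
Proof. apply (filterlim_C_unique eventually). Qed.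

Lemma is_series_Cmult_l (c : C) (u : nat -> C) (l : C) :
  is_series u l -> is_series (fun k => c * u k) (c * l).
Proof. exact (is_series_scal (V := C_NormedModule) c u l). Qed.

Lemma is_series_bounded (u : nat -> C) (l : C) : is_series u l -> exists M, forall k, Cmod (u k) <= M.
Proof.
  intros H; apply is_series_csum in H.
  destruct (filterlim_bounded (V := C_NormedModule) (csum u)) as [M HM]; [now exists l|].
  exists (M + M)%R; intros k.
  replace (u k) with (csum u (S k) - csum u k) by (simpl; ring).
  eapply Rle_trans; [apply Cmod_sub_le|apply Rplus_le_compat; apply HM].
Qed.

Lemma is_series_terms_0 (u : nat -> C) (l : C) :
  is_series u l -> filterlim u eventually (locally (RtoC 0)).
Proof.
  intros H; apply is_series_csum in H.
  apply (filterlim_ext (fun k => csum u (S k) - csum u k)); [intros k; simpl; ring|].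
  replace (RtoC 0) with (l - l) by ring; apply (filterlim_Cminus eventually); [|exact H].
  apply (filterlim_comp _ _ _ S (csum u) _ eventually); [|exact H].
  apply eventually_subseq; intros n; lia.
Qed.

Section TelescopingMajorant.
Variables (u : nat -> C) (g : nat -> R).
Hypothesis u_le : forall k, Cmod (u k) <= g k - g (S k).
Hypothesis g_ge_0 : forall k, 0 <= g k.

Lemma Cmod_csum_tail_le (n p : nat) : Cmod (csum u (n + p) - csum u n) <= g n.
Proof.
  enough (Cmod (csum u (n + p) - csum u n) <= g n - g (n + p)%nat) by (pose proof (g_ge_0 (n + p)); lra).
  induction p.
  - rewrite Nat.add_0_r; replace (csum u n - csum u n) with (RtoC 0) by ring; rewrite Cmod_0; lra.
  - rewrite Nat.add_succ_r; simpl csum.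
    replace (csum u (n + p) + u (n + p)%nat - csum u n)
      with ((csum u (n + p) - csum u n) + u (n + p)%nat) by ring.
    eapply Rle_trans; [apply Cmod_triangle|]; pose proof (u_le (n + p)); lra.
Qed.

Lemma Cmod_series_tail_le (l : C) (n : nat) : is_series u l -> Cmod (l - csum u n) <= g n.
Proof.
  intros H; apply is_series_csum in H; rewrite Cmod_sub_sym.
  apply (Cmod_le_of_filterlim eventually (fun p => csum u n - csum u p)).
  - apply (filterlim_Cminus eventually); [apply filterlim_const|exact H].
  - exists n; intros p Hp; replace p with (n + (p - n))%nat by lia.
    rewrite Cmod_sub_sym; apply Cmod_csum_tail_le.
Qed.

End TelescopingMajorant.

Lemma is_series_of_tail (u : nat -> C) (l : C) (g : nat -> R) :
  (forall n, Cmod (l - csum u n) <= g n) -> is_lim_seq g 0 -> is_series u l.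
Proof.
  intros H Hg; apply is_series_csum.
  apply (filterlim_Cmod_0 eventually (csum u) l g); [|exact Hg].
  exists 0%nat; intros n _; rewrite Cmod_sub_sym; apply H.
Qed.

Section GeometricMajorant.
Variables (c : nat -> C) (r K y : R) (q : C).
Hypothesis y_range : 0 <= y < 1.
Hypothesis c_le : forall k, Cmod (c k) * r ^ k <= K.
Hypothesis q_le : Cmod q <= y * r.

Let majorant (k : nat) : R := (K * y ^ k / (1 - y))%R.

Let K_ge_0 : 0 <= K.
Proof. pose proof (c_le 0); pose proof (Cmod_ge_0 (c 0%nat)); simpl in *; lra. Qed.

Let Cmod_term_le (k : nat) : Cmod (c k * q ^ k) <= majorant k - majorant (S k).
Proof.
  replace (majorant k - majorant (S k))%R with (K * y ^ k)%R by (unfold majorant; simpl; field; lra).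
  rewrite Cmod_mult, Cmod_pow; apply Rle_trans with (Cmod (c k) * (y * r) ^ k)%R.
  - apply Rmult_le_compat_l; [apply Cmod_ge_0|]; apply pow_incr; split; [apply Cmod_ge_0|exact q_le].
  - rewrite Rpow_mult_distr; specialize (c_le k).
    assert (0 <= y ^ k) by (apply pow_le; lra). nra.
Qed.

Let majorant_ge_0 (k : nat) : 0 <= majorant k.
Proof.
  apply Rmult_le_pos; [|left; apply Rinv_0_lt_compat; lra].
  apply Rmult_le_pos; [exact K_ge_0|apply pow_le; lra].
Qed.

Lemma Cmod_power_csum_le (n : nat) : Cmod (csum (fun k => c k * q ^ k) n) <= K / (1 - y).
Proof.
  pose proof (Cmod_csum_tail_le _ majorant Cmod_term_le majorant_ge_0 0 n) as T.
  simpl in T; unfold majorant in T; simpl in T; rewrite Rmult_1_r in T.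
  now replace (csum _ n) with (csum (fun k => c k * q ^ k) n - 0) by ring.
Qed.

Lemma Cmod_power_series_tail_le (l : C) (n : nat) :
  is_series (fun k => c k * q ^ k) l -> Cmod (l - csum (fun k => c k * q ^ k) n) <= K * y ^ n / (1 - y).
Proof. exact (Cmod_series_tail_le _ majorant Cmod_term_le majorant_ge_0 l n). Qed.

End GeometricMajorant.

Lemma is_derive_cexp_vertical (a : C) (u t : R) :
  is_derive (fun t => cexp (a * (u, t))) t (a * Ci * cexp (a * (u, t))).
Proof.
  apply (is_derive_Ccomp cexp (fun t => a * (u, t))); [apply is_derive_cexp|].
  apply is_derive_Cmult_l, is_derive_vertical.
Qed.

Lemma is_RInt_inv_circle_pow (rho : R) (j : nat) : 0 < rho -> (0 < j)%nat ->
  is_RInt (fun t => / polar rho t ^ j) 0 (2 * PI) (RtoC 0).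
Proof.
  intros Hrho Hj; set (a := - RtoC (INR j)).
  assert (Ha : a * Ci <> 0).
  { apply Cmult_neq_0; [|exact Ci_nz]; unfold a; rewrite <- RtoC_opp; apply RtoC_neq_0.
    apply lt_0_INR in Hj; lra. }
  assert (E : forall t, / polar rho t ^ j = cexp (a * (ln rho, t))).
  { intros t; rewrite polar_cexp_ln, cexp_pow, <- cexp_opp by exact Hrho; f_equal; unfold a; ring. }
  replace (RtoC 0) with (/ (a * Ci) * cexp (a * (ln rho, 2 * PI)%R) - / (a * Ci) * cexp (a * (ln rho, 0%R))).
  2:{ rewrite <- !E, polar_2PI; ring. }
  apply (is_RInt_C_derive (fun t => / (a * Ci) * cexp (a * (ln rho, t)))); intros t _.
  - rewrite E; replace (cexp (a * (ln rho, t))) with (/ (a * Ci) * (a * Ci * cexp (a * (ln rho, t)))).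
    + apply is_derive_Cmult_l, is_derive_cexp_vertical.
    + rewrite Cmult_assoc, Cinv_l by exact Ha; ring.
  - apply (continuous_ext (fun t => cexp (a * (ln rho, t)))); [intros; now rewrite E|].
    eapply is_derive_C_continuous, is_derive_cexp_vertical.
Qed.

Lemma polar_surjective (q : C) : exists t, 0 <= t <= 2 * PI /\ q = polar (Cmod q) t.
Proof.
  destruct (Ceq_dec q 0) as [->|n].
  { exists 0%R; pose proof PI_RGT_0; split; [lra|]; unfold polar; rewrite Cmod_0; unfold RtoC; f_equal; ring. }
  apply Cmod_gt_0 in n; set (r := Cmod q) in *.
  pose proof (Cmod2_alt q) as Sq; fold r in Sq.
  assert (Hx : - 1 <= Re q / r <= 1).
  { pose proof (re_le_Cmod q) as L; apply Rabs_le_between in L; fold r in L.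
    split; [apply Rle_div_r|apply Rle_div_l]; lra. }
  assert (Hs : (r * sqrt (1 - (Re q / r)²) = Rabs (Im q))%R).
  { rewrite <- (sqrt_Rsqr r) at 1 by lra; rewrite <- sqrt_mult by (unfold Rsqr; nra).
    rewrite <- sqrt_Rsqr_abs; f_equal; unfold Rsqr.
    replace (r * r * (1 - Re q / r * (Re q / r)))%R with (r ^ 2 - Re q ^ 2)%R by (field; lra).
    rewrite Sq; ring. }
  pose proof (acos_bound (Re q / r)).
  assert (Hre : (r * (Re q / r) = Re q)%R) by (field; lra).
  destruct (Rle_dec 0 (Im q)) as [Hi|Hi].
  - exists (acos (Re q / r)); split; [lra|]; unfold polar.
    rewrite cos_acos, sin_acos, Hs, Hre, Rabs_pos_eq by assumption; apply surjective_pairing.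
  - exists (2 * PI - acos (Re q / r))%R; split; [lra|]; unfold polar.
    rewrite cos_minus, sin_minus, cos_2PI, sin_2PI, cos_acos, sin_acos by assumption.
    rewrite (surjective_pairing q) at 1; fold (Re q) (Im q).
    rewrite Rabs_left in Hs by lra; f_equal; lra.
Qed.

Definition taylor_quotient (H : C -> C) (c : nat -> C) (n : nat) (q : C) : C :=
  if Ceq_dec q 0 then c n else (H q - csum (fun k => c k * q ^ k) n) / q ^ n.

Section PowerSeries.
Variables (H : C -> C) (c : nat -> C) (r0 : R).
Hypothesis H_derive : forall q, 0 < Cmod q < 1 -> ex_derive H q.
Hypothesis r0_pos : 0 < r0.
Hypothesis H_series : forall q, 0 < Cmod q < r0 -> is_series (fun k => c k * q ^ k) (H q).

Let T (n : nat) (q : C) : C := taylor_quotient H c n q.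

Lemma taylor_quotient_0 (n : nat) : T n 0 = c n.
Proof. unfold T, taylor_quotient; destruct (Ceq_dec 0 0); tauto. Qed.

Lemma taylor_quotient_neq_0 (n : nat) (q : C) :
  q <> 0 -> T n q = (H q - csum (fun k => c k * q ^ k) n) / q ^ n.
Proof. intros Hq; unfold T, taylor_quotient; destruct (Ceq_dec q 0); tauto. Qed.

Lemma taylor_quotient_succ (n : nat) (q : C) : T n q = c n + q * T (S n) q.
Proof.
  destruct (Ceq_dec q 0) as [->|Hq]; [rewrite !taylor_quotient_0; ring|].
  rewrite !taylor_quotient_neq_0 by exact Hq; simpl; field; split; [now apply Cpow_nz|exact Hq].
Qed.

Lemma taylor_quotient_bounded_near_0 (n : nat) :
  exists M, locally (RtoC 0) (fun q => Cmod (T n q) <= M).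
Proof.
  set (r := (r0 / 2)%R); assert (Hr : 0 < r < r0) by (unfold r; lra).
  destruct (is_series_bounded _ _ (H_series (RtoC r) ltac:(rewrite Cmod_R, Rabs_pos_eq; lra))) as [K HK].
  assert (HK' : forall k, Cmod (c k) * r ^ k <= K).
  { intros k; specialize (HK k); rewrite Cmod_mult, Cmod_pow, Cmod_R, Rabs_pos_eq in HK; lra. }
  assert (Hrn : 0 < r ^ n) by (apply pow_lt; lra).
  exists (2 * K / r ^ n)%R; apply locally_Cmod; exists (r / 2)%R; split; [lra|].
  intros q Hq; replace (q - 0) with q in Hq by ring.
  apply Rle_div_r; [exact Hrn|].
  destruct (Ceq_dec q 0) as [->|n0].
  { rewrite taylor_quotient_0; specialize (HK' n).
    assert (0 <= Cmod (c n) * r ^ n) by (apply Rmult_le_pos; [apply Cmod_ge_0|lra]); lra. }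
  pose proof (proj1 (Cmod_gt_0 _) n0) as Hq0; set (y := (Cmod q / r)%R).
  assert (Hy : 0 <= y < / 2) by (split; [apply Rle_div_r|apply Rlt_div_l]; lra).
  pose proof (Cmod_power_series_tail_le c r K y q ltac:(lra) HK'
    ltac:(right; unfold y; field; lra) (H q) n (H_series q ltac:(lra))) as Tail.
  rewrite taylor_quotient_neq_0, Cmod_div, Cmod_pow by (try apply Cpow_nz; exact n0).
  assert (Hqn : 0 < Cmod q ^ n) by now apply pow_lt.
  unfold Rdiv at 1; rewrite Rmult_assoc, <- (Rmult_comm (r ^ n)), <- Rmult_assoc.
  apply Rle_div_l; [exact Hqn|].
  apply (Rmult_le_compat_r (r ^ n)) in Tail; [|lra]; eapply Rle_trans; [exact Tail|].
  replace (Cmod q ^ n)%R with (y ^ n * r ^ n)%R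
    by (rewrite <- Rpow_mult_distr; f_equal; unfold y; field; lra).
  rewrite <- Rmult_assoc; apply Rmult_le_compat_r; [lra|].
  assert (HKy : 0 <= K * y ^ n).
  { apply Rmult_le_pos; [|apply pow_le; lra].
    specialize (HK' 0%nat); pose proof (Cmod_ge_0 (c 0%nat)); simpl in HK'; lra. }
  apply Rle_div_l; nra.
Qed.

Lemma continuous_taylor_quotient_0 (n : nat) : continuous (T n) (RtoC 0).
Proof.
  destruct (taylor_quotient_bounded_near_0 (S n)) as [M HM].
  apply (filterlim_Cmod_0 (locally (RtoC 0)) _ _ (fun q => Cmod q * M)%R).
  - revert HM; apply filter_imp; intros q Hq; rewrite taylor_quotient_0, (taylor_quotient_succ n q).
    replace (c n + q * T (S n) q - c n) with (q * T (S n) q) by ring.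
    rewrite Cmod_mult; apply Rmult_le_compat_l; [apply Cmod_ge_0|exact Hq].
  - replace (locally 0%R) with (locally (Cmod 0 * M)%R) by (f_equal; rewrite Cmod_0; ring).
    apply (continuous_mult (K := R_AbsRing) Cmod (fun _ => M)); [apply continuous_Cmod|apply continuous_const].
Qed.

Lemma ex_derive_taylor_quotient (n : nat) (q : C) : Cmod q < 1 -> ex_derive (T n) q.
Proof.
  intros Hq; destruct (Ceq_dec q 0) as [->|Hq0].
  - apply ex_derive_caratheodory; exists (T (S n)); split; [apply continuous_taylor_quotient_0|].
    intros p; rewrite taylor_quotient_0, (taylor_quotient_succ n p); ring.
  - apply (ex_derive_C_ext_loc (fun q => (H q - csum (fun k => c k * q ^ k) n) / q ^ n)).
    + generalize (continuous_neq_0 (fun q : C => q) q (continuous_id q) Hq0); apply filter_imp.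
      intros p Hp; symmetry; now apply taylor_quotient_neq_0.
    + apply ex_derive_Cdiv; [|apply ex_derive_Cpow|now apply Cpow_nz].
      apply ex_derive_Cminus; [apply H_derive; split; [now apply Cmod_gt_0|exact Hq]|].
      clear; induction n; simpl; [apply ex_derive_Cconst|apply ex_derive_Cplus; [exact IHn|]].
      apply ex_derive_Cmult; [apply ex_derive_Cconst|apply ex_derive_Cpow].
Qed.

Lemma is_RInt_taylor_polynomial (n j : nat) (rho : R) : 0 < rho ->
  is_RInt (fun t => csum (fun k => c k * polar rho t ^ k) n / polar rho t ^ (n + j)) 0 (2 * PI) (RtoC 0).
Proof.
  intros Hrho; revert j; induction n as [|n IHn]; intros j.
  - apply (is_RInt_ext (V := C_R_NormedModule) (fun _ => RtoC 0)).
    + intros t _; simpl; unfold Cdiv; symmetry; apply Cmult_0_l.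
    + apply is_RInt_C0.
  - replace (RtoC 0) with (0 + c n * 0) by ring.
    apply (is_RInt_ext (V := C_R_NormedModule) (fun t =>
      csum (fun k => c k * polar rho t ^ k) n / polar rho t ^ (n + S j) + c n * / polar rho t ^ S j)).
    + intros t _; rewrite Nat.add_succ_r, Nat.add_succ_l, Cpow_S, Cpow_add_r; simpl csum.
      assert (polar rho t <> 0) by now apply polar_neq_0.
      change (csum (fun k => c k * polar rho t ^ k) n / (polar rho t * (polar rho t ^ n * polar rho t ^ j))
        + c n * / polar rho t ^ S j = (csum (fun k => c k * polar rho t ^ k) n + c n * polar rho t ^ n)
        / (polar rho t * (polar rho t ^ n * polar rho t ^ j))); simpl.
      field; repeat split; try apply Cpow_nz; assumption.
    + apply is_RInt_Cplus; [apply IHn|apply is_RInt_Cmult_l, is_RInt_inv_circle_pow; [exact Hrho|lia]].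
Qed.

Lemma cauchy_coefficient_formula (n : nat) (rho : R) : 0 < rho < 1 ->
  is_RInt (fun t => H (polar rho t) / polar rho t ^ n) 0 (2 * PI) (RtoC (2 * PI) * c n).
Proof.
  intros Hrho; replace (RtoC (2 * PI) * c n) with (RtoC (2 * PI) * T n 0 + 0)
    by (rewrite taylor_quotient_0; ring).
  apply (is_RInt_ext (V := C_R_NormedModule) (fun t => T n (polar rho t)
    + csum (fun k => c k * polar rho t ^ k) n / polar rho t ^ (n + 0))).
  - intros t _; rewrite Nat.add_0_r, taylor_quotient_neq_0 by (apply polar_neq_0; lra).
    unfold Cdiv, Cminus; rewrite <- Cmult_plus_distr_r, <- Cplus_assoc, (Cplus_comm (- _)), Cplus_opp_r.
    now rewrite Cplus_0_r.
  - apply is_RInt_Cplus; [|apply is_RInt_taylor_polynomial; lra].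
    apply mean_value; [lra|intros; apply ex_derive_taylor_quotient; lra|].
    apply (filterlim_filter_le_1 (F := locally (RtoC 0))); [apply filter_le_within|].
    apply continuous_taylor_quotient_0.
Qed.

Lemma cauchy_coefficient_le (n : nat) (rho : R) (g : R -> R) (lg : R) : 0 < rho < 1 ->
  (forall t, 0 <= t <= 2 * PI -> Cmod (H (polar rho t)) <= g t) -> is_RInt g 0 (2 * PI) lg ->
  2 * PI * (Cmod (c n) * rho ^ n) <= lg.
Proof.
  intros Hrho Hg Ig; pose proof PI_RGT_0; assert (Hp : 0 < rho ^ n) by (apply pow_lt; lra).
  pose proof (is_RInt_Cmult_l (RtoC (rho ^ n)) _ _ _ _ (cauchy_coefficient_formula n rho Hrho)) as Int.
  replace (2 * PI * (Cmod (c n) * rho ^ n))%R with (Cmod (RtoC (rho ^ n) * (RtoC (2 * PI) * c n))).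
  2:{ rewrite !Cmod_mult, !Cmod_R, !Rabs_pos_eq by lra; ring. }
  apply Cmod_RInt_le with (3 := Int) (4 := Ig); [lra|]; intros t Ht.
  assert (polar rho t <> 0) by (apply polar_neq_0; lra).
  rewrite Cmod_mult, Cmod_div, Cmod_R, Cmod_pow, Cmod_polar, Rabs_pos_eq by (try apply Cpow_nz; auto; lra).
  eapply Rle_trans; [|apply Hg, Ht]; right; field; lra.
Qed.

Lemma bounded_on_circle (rho : R) : 0 < rho < 1 ->
  exists M, 0 <= M /\ forall q, Cmod q = rho -> Cmod (H q) <= M.
Proof.
  intros Hrho.
  destruct (bounded_continuity (V := C_NormedModule) (fun t => H (polar rho t)) 0 (2 * PI)) as [M HM].
  { intros t _; apply (continuous_comp (polar rho) H); [apply continuous_polar|].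
    apply ex_derive_C_continuous, H_derive; rewrite Cmod_polar; lra. }
  exists M; split.
  - pose proof PI_RGT_0; pose proof (HM 0%R ltac:(lra)) as L.
    change (Cmod (H (polar rho 0)) < M) in L; pose proof (Cmod_ge_0 (H (polar rho 0))); lra.
  - intros q Hq; destruct (polar_surjective q) as [t [Ht ->]]; rewrite Hq; left; exact (HM t Ht).
Qed.

Lemma cauchy_estimate (n : nat) (rho M : R) : 0 < rho < 1 ->
  (forall q, Cmod q = rho -> Cmod (H q) <= M) -> Cmod (c n) * rho ^ n <= M.
Proof.
  intros Hrho HM; pose proof PI_RGT_0.
  apply Rmult_le_reg_l with (2 * PI)%R; [lra|].
  replace (2 * PI * M)%R with ((2 * PI - 0) * M)%R by ring.
  apply (cauchy_coefficient_le n rho (fun _ => M) _ Hrho).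
  - intros t _; apply HM, Cmod_polar; lra.
  - exact (is_RInt_const (V := R_NormedModule) 0 (2 * PI) M).
Qed.

(** The maximum principle for [T n] turns bounds on a circle into the estimate
    [Cmod (H q - csum _ n) <= M * (Cmod q / r1) ^ n] inside it. *)
Lemma is_series_in_unit_disc (q : C) : 0 < Cmod q < 1 -> is_series (fun k => c k * q ^ k) (H q).
Proof.
  intros Hq; set (r1 := ((2 * Cmod q + 1) / 3)%R); set (r2 := ((Cmod q + 2) / 3)%R).
  assert (Hr1 : Cmod q < r1 < r2) by (unfold r1, r2; lra); assert (Hr2 : r2 < 1) by (unfold r2; lra).
  destruct (bounded_on_circle r1) as [M1 [HM1 Hr1b]]; [lra|].
  destruct (bounded_on_circle r2) as [M2 [HM2 Hr2b]]; [lra|].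
  set (y := (r1 / r2)%R); assert (Hy : 0 <= y < 1) by (split; [apply Rle_div_r|apply Rlt_div_l]; lra).
  set (M := (M1 + M2 / (1 - y))%R).
  assert (Quotient : forall n, Cmod (T n q) <= M / r1 ^ n).
  { intros n; apply (maximum_principle _ r1); [lra|intros; apply ex_derive_taylor_quotient; lra|].
    intros p Hp; assert (Hp0 : p <> 0) by (apply Cmod_gt_0; lra).
    rewrite taylor_quotient_neq_0, Cmod_div, Cmod_pow, Hp by (try apply Cpow_nz; exact Hp0).
    apply Rmult_le_compat_r; [left; apply Rinv_0_lt_compat, pow_lt; lra|].
    eapply Rle_trans; [apply Cmod_sub_le|]; apply Rplus_le_compat; [now apply Hr1b|].
    apply (Cmod_power_csum_le c r2 M2 y p); [exact Hy| |right; rewrite Hp; unfold y; field; lra].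
    intros k; apply cauchy_estimate; [lra|exact Hr2b]. }
  apply (is_series_of_tail _ _ (fun n => M * (Cmod q / r1) ^ n)%R).
  - intros n; assert (Hq0 : q <> 0) by (apply Cmod_gt_0; lra).
    replace (H q - csum (fun k => c k * q ^ k) n) with (T n q * q ^ n)
      by (rewrite taylor_quotient_neq_0 by exact Hq0; field; now apply Cpow_nz).
    rewrite Cmod_mult, Cmod_pow; unfold Rdiv; rewrite Rpow_mult_distr, pow_inv.
    apply Rle_trans with (M / r1 ^ n * Cmod q ^ n)%R; [|right; unfold Rdiv; ring].
    apply Rmult_le_compat_r; [apply pow_le; lra|apply Quotient].
  - replace 0%R with (M * 0)%R by ring; apply is_lim_seq_mult'; [apply is_lim_seq_const|].
    apply is_lim_seq_geom; rewrite Rabs_pos_eq; [apply Rlt_div_l|apply Rle_div_r]; lra.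
Qed.

End PowerSeries.

(** * Integrals over the half-line *)

Notation pos_ends := (filter_prod (at_right 0) (Rbar_locally p_infty)).

Definition continuous_pos {U : UniformSpace} (f : R -> U) : Prop :=
  forall t, 0 < t -> continuous f t.

Lemma pos_ends_between (a b : R) : 0 < a -> pos_ends (fun p => 0 < fst p < a /\ b < snd p).
Proof.
  intros Ha; exists (fun t => 0 < t < a) (fun t => b < t).
  - exists (mkposreal a Ha); intros t Ht Ht0; split; [exact Ht0|].
    change (Rabs (t - 0) < a) in Ht; rewrite Rminus_0_r in Ht; pose proof (Rle_abs t); lra.
  - exists b; auto.
  - auto.
Qed.

Lemma pos_ends_ordered : pos_ends (fun p => 0 < fst p < snd p).
Proof. generalize (pos_ends_between 1 1 Rlt_0_1); apply filter_imp; intros p Hp; lra. Qed.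

Section HalfLine.
Context {V : CompleteNormedModule R_AbsRing}.

Lemma is_RInt_pos (f : R -> V) (t1 t2 : R) :
  continuous_pos f -> 0 < t1 <= t2 -> is_RInt f t1 t2 (RInt f t1 t2).
Proof.
  intros Hf Ht; apply RInt_correct, ex_RInt_continuous; intros t Ht'; apply Hf.
  rewrite Rmin_left in Ht'; lra.
Qed.

Lemma is_RInt_gen_pos (f : R -> V) (l : V) : continuous_pos f ->
  is_RInt_gen f (at_right 0) (Rbar_locally p_infty) l <->
  filterlim (fun p => RInt f (fst p) (snd p)) pos_ends (locally l).
Proof.
  intros Hf; split; intros H P HP.
  - generalize (H P HP); apply (filter_imp (F := pos_ends)); intros p [y [Hy HPy]].
    now rewrite (is_RInt_unique _ _ _ _ Hy).
  - generalize (filter_and (F := pos_ends) _ _ pos_ends_ordered (H P HP)).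
    apply (filter_imp (F := pos_ends)); intros p [Hp HPp].
    exists (RInt f (fst p) (snd p)); split; [apply is_RInt_pos; [exact Hf|lra]|exact HPp].
Qed.

Lemma RInt_pos_Chasles (f : R -> V) (t1 a b t2 : R) : continuous_pos f -> 0 < t1 <= a -> a <= b <= t2 ->
  RInt f t1 t2 = plus (plus (RInt f t1 a) (RInt f a b)) (RInt f b t2).
Proof.
  intros Hf H1 H2; apply is_RInt_unique.
  apply (is_RInt_Chasles (V := V) f t1 b t2); [apply (is_RInt_Chasles (V := V) f t1 a b)|];
    apply is_RInt_pos; auto; lra.
Qed.

End HalfLine.

Lemma RInt_pos_tails_small (g : R -> R) (M eps : R) : continuous_pos g ->
  (forall t1 t2, 0 < t1 <= t2 -> RInt g t1 t2 <= M) -> 0 < eps ->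
  exists a b, 0 < a <= b /\ forall t1 t2, 0 < t1 <= a -> b <= t2 -> RInt g t1 a + RInt g b t2 <= eps.
Proof.
  intros Hg HM Heps.
  destruct (completeness (fun x => exists t1 t2, 0 < t1 <= t2 /\ x = RInt g t1 t2)) as [S [Hup Hleast]].
  { exists M; intros x [t1 [t2 [Ht ->]]]; auto. }
  { exists (RInt g 1 1), 1%R, 1%R; split; [lra|reflexivity]. }
  assert (Near : exists a b, 0 < a <= b /\ S - eps < RInt g a b).
  { apply Classical_Prop.NNPP; intros N; apply (Rlt_irrefl S).
    apply Rle_lt_trans with (S - eps)%R; [|lra].
    apply Hleast; intros x [a [b [Hab ->]]]; apply Rnot_lt_le; intros L; apply N; now exists a, b. }
  destruct Near as [a [b [Hab Hlt]]]; exists a, b; split; [exact Hab|]; intros t1 t2 H1 H2.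
  pose proof (RInt_pos_Chasles (V := R_CompleteNormedModule) g t1 a b t2 Hg ltac:(lra) ltac:(lra)) as E.
  assert (RInt g t1 t2 <= S) by (apply Hup; exists t1, t2; split; [lra|reflexivity]).
  unfold plus in E; simpl in E; lra.
Qed.

Lemma minus_plus_middle {G : AbelianGroup} (x y z : G) : minus (plus (plus x y) z) y = plus x z.
Proof.
  unfold minus; rewrite <- (plus_assoc x), (plus_comm y), plus_assoc.
  rewrite <- plus_assoc; etransitivity; [apply f_equal, plus_opp_r|apply plus_zero_r].
Qed.

Lemma ex_RInt_gen_dominated {V : CompleteNormedModule R_AbsRing} (f : R -> V) (g : R -> R) (M : R) :
  continuous_pos f -> continuous_pos g -> (forall t, 0 < t -> norm (f t) <= g t) ->
  (forall t1 t2, 0 < t1 <= t2 -> RInt g t1 t2 <= M) ->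
  ex_RInt_gen f (at_right 0) (Rbar_locally p_infty).
Proof.
  intros Hf Hg Hfg HM.
  assert (Norm : forall t1 t2, 0 < t1 <= t2 -> norm (RInt f t1 t2) <= RInt g t1 t2).
  { intros t1 t2 Ht; apply (norm_RInt_le f g t1 t2); [lra|intros t Ht'; apply Hfg; lra| |].
    - now apply is_RInt_pos.
    - now apply (is_RInt_pos (V := R_CompleteNormedModule)). }
  destruct (proj1 (filterlim_locally_cauchy (F := pos_ends) (fun p => RInt f (fst p) (snd p)))) as [l Hl].
  - intros eps; destruct (RInt_pos_tails_small g M (eps / 3) Hg HM) as [a [b [Hab Tails]]].
    { pose proof (cond_pos eps); lra. }
    assert (Close : forall t1 t2, 0 < t1 < a -> b < t2 ->
      norm (minus (RInt f t1 t2) (RInt f a b)) <= eps / 3).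
    { intros t1 t2 H1 H2.
      replace (minus (RInt f t1 t2) (RInt f a b)) with (plus (RInt f t1 a) (RInt f b t2)).
      - eapply Rle_trans; [apply (norm_triangle (V := V))|].
        pose proof (Norm t1 a ltac:(lra)); pose proof (Norm b t2 ltac:(lra)).
        pose proof (Tails t1 t2 ltac:(lra) ltac:(lra)); lra.
      - rewrite (RInt_pos_Chasles f t1 a b t2) by (auto; lra); symmetry.
        exact (minus_plus_middle (G := V) _ _ _). }
    exists (fun p => 0 < fst p < a /\ b < snd p); split; [apply pos_ends_between; lra|].
    intros [u1 u2] [v1 v2]; simpl; intros [Hu1 Hu2] [Hv1 Hv2]; apply (norm_compat1 (V := V)).
    rewrite (minus_trans (RInt f a b)); eapply Rle_lt_trans; [apply (norm_triangle (V := V))|].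
    apply Rle_lt_trans with (eps / 3 + eps / 3)%R; [|pose proof (cond_pos eps); lra].
    apply Rplus_le_compat; [now apply Close|].
    rewrite <- (norm_opp (V := V)), (opp_minus (G := V)); now apply Close.
  - exists l; now apply is_RInt_gen_pos.
Qed.

Lemma Cmod_RInt_gen_le (f : R -> C) (l : C) (M : R) : continuous_pos f ->
  is_RInt_gen f (at_right 0) (Rbar_locally p_infty) l ->
  (forall t1 t2, 0 < t1 <= t2 -> Cmod (CRInt f t1 t2) <= M) -> Cmod l <= M.
Proof.
  intros Hf Hl HM; apply (is_RInt_gen_pos (V := C_R_CompleteNormedModule)) in Hl; [|exact Hf].
  apply (Cmod_le_of_filterlim pos_ends) with (1 := Hl).
  generalize pos_ends_ordered; apply filter_imp; intros p Hp; apply HM; lra.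
Qed.

Lemma is_RInt_gen_C_unique (f : R -> C) (l l' : C) :
  is_RInt_gen f (at_right 0) (Rbar_locally p_infty) l ->
  is_RInt_gen f (at_right 0) (Rbar_locally p_infty) l' -> l = l'.
Proof.
  intros H H'.
  rewrite <- (is_RInt_gen_unique (V := C_R_CompleteNormedModule) f l H).
  exact (is_RInt_gen_unique (V := C_R_CompleteNormedModule) f l' H').
Qed.

Lemma is_RInt_gen_Cplus (f g : R -> C) (l l' : C) :
  is_RInt_gen f (at_right 0) (Rbar_locally p_infty) l ->
  is_RInt_gen g (at_right 0) (Rbar_locally p_infty) l' ->
  is_RInt_gen (fun t => f t + g t) (at_right 0) (Rbar_locally p_infty) (l + l').
Proof. exact (is_RInt_gen_plus (V := C_R_NormedModule) f g l l'). Qed.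

Lemma is_RInt_gen_Cmult_l (c : C) (f : R -> C) (l : C) :
  is_RInt_gen f (at_right 0) (Rbar_locally p_infty) l ->
  is_RInt_gen (fun t => c * f t) (at_right 0) (Rbar_locally p_infty) (c * l).
Proof.
  intros H P HP.
  assert (Hc : continuous (fun w => c * w) l).
  { apply continuous_Cmult; [apply continuous_const|apply continuous_id]. }
  generalize (H _ (Hc P HP)); apply (filter_imp (F := pos_ends)); intros p [y [Hy HPy]].
  exists (c * y); split; [now apply is_RInt_Cmult_l|exact HPy].
Qed.

Lemma is_RInt_gen_RtoC (f : R -> R) (l : R) :
  is_RInt_gen f (at_right 0) (Rbar_locally p_infty) l ->
  is_RInt_gen (fun t => RtoC (f t)) (at_right 0) (Rbar_locally p_infty) (RtoC l).
Proof.
  intros H P HP.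
  assert (Hc : continuous RtoC l) by apply continuous_RtoC, continuous_id.
  generalize (H _ (Hc P HP)); apply (filter_imp (F := pos_ends)); intros p [y [Hy HPy]].
  exists (RtoC y); split; [now apply is_RInt_RtoC|exact HPy].
Qed.

Lemma is_RInt_gen_C_derive (f df : R -> C) (l0 l1 : C) :
  (forall t, 0 < t -> is_derive f t (df t)) -> continuous_pos df ->
  filterlim f (at_right 0) (locally l0) -> filterlim f (Rbar_locally p_infty) (locally l1) ->
  is_RInt_gen df (at_right 0) (Rbar_locally p_infty) (l1 - l0).
Proof.
  intros Hf Hdf H0 H1; apply (is_RInt_gen_pos (V := C_R_CompleteNormedModule)); [exact Hdf|].
  apply (filterlim_ext_loc (F := pos_ends) (fun p => f (snd p) - f (fst p))).
  - generalize pos_ends_ordered; apply filter_imp; intros p Hp; symmetry.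
    apply CRInt_unique, is_RInt_C_derive; intros t Ht; rewrite Rmin_left in Ht by lra;
      [apply Hf|apply Hdf]; lra.
  - apply (filterlim_Cminus pos_ends); eapply filterlim_comp;
      [apply filterlim_snd|exact H1|apply filterlim_fst|exact H0].
Qed.

Lemma RInt_le_of_derive (g G dG : R -> R) (a b : R) : a <= b ->
  (forall t, a <= t <= b -> continuous g t) -> (forall t, a <= t <= b -> is_derive G t (dG t)) ->
  (forall t, a <= t <= b -> continuous dG t) -> (forall t, a <= t <= b -> g t <= dG t) ->
  RInt g a b <= G b - G a.
Proof.
  intros Hab Hg HG HdG Hle.
  assert (Int : is_RInt dG a b (G b - G a)%R).
  { apply (is_RInt_derive (V := R_CompleteNormedModule) G dG); intros t Ht;
      rewrite Rmin_left, Rmax_right in Ht by lra; auto. }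
  apply (is_RInt_le g dG a b); [exact Hab| |exact Int|intros t Ht; apply Hle; lra].
  apply is_RInt_of_continuous; intros t Ht; rewrite Rmin_left, Rmax_right in Ht by lra; auto.
Qed.

(** The substitution [u = N exp (- t)], which reverses the half-line. *)
Lemma is_RInt_subst_exp {V : CompleteNormedModule R_AbsRing} (f : R -> V) (N t1 t2 : R) :
  0 < N -> continuous_pos f ->
  is_RInt (fun t => scal (N * exp (- t))%R (f (N * exp (- t))%R)) t1 t2
    (RInt f (N * exp (- t2)) (N * exp (- t1))).
Proof.
  intros HN Hf.
  assert (Hu : forall t, 0 < N * exp (- t)) by (intros; apply Rmult_lt_0_compat; [exact HN|apply exp_pos]).
  assert (Int : is_RInt (fun t => scal (- (N * exp (- t)))%R (f (N * exp (- t))%R)) t1 t2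
    (RInt f (N * exp (- t1)) (N * exp (- t2)))).
  { apply (is_RInt_comp f (fun t => N * exp (- t))%R (fun t => - (N * exp (- t)))%R).
    - intros; apply Hf, Hu.
    - intros t _; split; [auto_derive; auto; ring|].
      apply continuous_of_ex_derive; auto_derive; auto. }
  rewrite <- (opp_RInt_swap f (N * exp (- t1)) (N * exp (- t2))).
  - apply is_RInt_opp in Int; eapply is_RInt_ext; [|exact Int]; intros t _; simpl.
    refine (eq_trans (eq_sym (scal_opp_l _ _)) _); f_equal; unfold opp; simpl; ring.
  - apply ex_RInt_continuous; intros u Hu'; apply Hf.
    apply Rlt_le_trans with (Rmin (N * exp (- t1)) (N * exp (- t2))); [apply Rmin_pos; apply Hu|apply Hu'].
Qed.

(** * The Gamma function *)

Definition gamma_integrand (x t : R) : R := (Rpower t (x - 1) * exp (- t))%R.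

Definition Cgamma_integrand (z : C) (t : R) : C :=
  cexp ((z - 1) * RtoC (ln t)) * RtoC (exp (- t)).

Lemma continuous_cexp_Cmult (a : C) (g : R -> R) (t : R) :
  continuous g t -> continuous (fun t => cexp (a * RtoC (g t))) t.
Proof.
  intros Hg; apply (continuous_comp (fun t => a * RtoC (g t)) cexp); [|apply continuous_cexp].
  apply continuous_Cmult; [apply continuous_const|now apply continuous_RtoC].
Qed.

Lemma continuous_gamma_integrand (x : R) : continuous_pos (gamma_integrand x).
Proof.
  intros t Ht; apply continuous_of_ex_derive; unfold gamma_integrand, Rpower; auto_derive; auto.
Qed.

Lemma continuous_Cgamma_integrand (z : C) : continuous_pos (Cgamma_integrand z).
Proof.
  intros t Ht; apply continuous_Cmult.
  - now apply continuous_cexp_Cmult, continuous_ln.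
  - apply continuous_RtoC, continuous_of_ex_derive; auto_derive; auto.
Qed.

Lemma Cmod_Cgamma_integrand (z : C) (t : R) :
  Cmod (Cgamma_integrand z t) = gamma_integrand (Re z) t.
Proof.
  unfold Cgamma_integrand, gamma_integrand, Rpower.
  rewrite Cmod_mult, Cmod_cexp, Cmod_R, Rabs_pos_eq by (left; apply exp_pos).
  rewrite re_scal_r; destruct z; reflexivity.
Qed.

Lemma Cgamma_integrand_RtoC (x t : R) : Cgamma_integrand (RtoC x) t = RtoC (gamma_integrand x t).
Proof.
  unfold Cgamma_integrand, gamma_integrand, Rpower.
  now rewrite <- RtoC_minus, <- RtoC_mult, cexp_RtoC, <- RtoC_mult.
Qed.

Lemma exp_opp_le_Rpower (K t : R) : 0 < K -> 0 < t ->
  exp (- t) <= exp (K * ln K + 1 - K) * Rpower (1 + t) (- K).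
Proof.
  intros HK Ht; unfold Rpower; rewrite <- exp_plus; apply exp_le_compat.
  pose proof (ln_le_sub_1 ((1 + t) / K) ltac:(apply Rdiv_lt_0_compat; lra)) as L.
  rewrite ln_div in L by lra; apply (Rmult_le_compat_l K) in L; [|lra].
  replace (K * ((1 + t) / K - 1))%R with (1 + t - K)%R in L by (field; lra); lra.
Qed.

(** [Rpower (t / (1 + t)) x / x] is a bounded primitive of [t ^ (x - 1) / (1 + t) ^ (x + 1)]. *)
Lemma RInt_gamma_integrand_bounded (x : R) : 0 < x ->
  exists M, 0 < M /\ forall t1 t2, 0 < t1 <= t2 -> RInt (gamma_integrand x) t1 t2 <= M.
Proof.
  intros Hx; set (A := exp ((x + 1) * ln (x + 1) + 1 - (x + 1))); assert (HA : 0 < A) by apply exp_pos.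
  exists (A / x)%R; split; [now apply Rdiv_lt_0_compat|]; intros t1 t2 Ht.
  set (G := fun t => (A * (exp (x * (ln t - ln (1 + t))) / x))%R).
  assert (HG : RInt (gamma_integrand x) t1 t2 <= G t2 - G t1).
  { apply (RInt_le_of_derive _ G (fun t => A * (Rpower t (x - 1) * Rpower (1 + t) (- (x + 1))))%R);
      [lra|intros t Htt; assert (Ht0 : 0 < t) by lra ..].
    - now apply continuous_gamma_integrand.
    - unfold G; auto_derive; [repeat split; lra|].
      replace (exp (x * (ln t + - ln (1 + t)))) with
        (Rpower t (x - 1) * Rpower (1 + t) (- (x + 1)) * (t * (1 + t)))%R; [field; lra|].
      rewrite <- (exp_ln t) at 3 by lra; rewrite <- (exp_ln (1 + t)) at 2 by lra.
      unfold Rpower; rewrite <- !exp_plus; f_equal; ring.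
    - apply continuous_of_ex_derive; unfold Rpower; auto_derive; repeat split; lra.
    - replace (A * (Rpower t (x - 1) * Rpower (1 + t) (- (x + 1))))%R
        with (Rpower t (x - 1) * (A * Rpower (1 + t) (- (x + 1))))%R by ring.
      apply Rmult_le_compat_l; [left; apply exp_pos|apply exp_opp_le_Rpower; lra]. }
  assert (G0 : 0 < G t1) by (apply Rmult_lt_0_compat, Rdiv_lt_0_compat; auto using exp_pos).
  assert (G1 : G t2 <= A / x).
  { unfold G, Rdiv; rewrite <- (Rmult_1_l (/ x)) at 2; apply Rmult_le_compat_l; [lra|].
    apply Rmult_le_compat_r; [left; now apply Rinv_0_lt_compat|]; apply exp_nonpos_le_1.
    assert (ln t2 <= ln (1 + t2)) by (apply ln_le; lra); nra. }
  lra.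
Qed.

Lemma is_RInt_gen_CGamma (z : C) : 0 < Re z ->
  is_RInt_gen (Cgamma_integrand z) (at_right 0) (Rbar_locally p_infty) (CGamma z).
Proof.
  intros Hz; destruct (RInt_gamma_integrand_bounded (Re z) Hz) as [M [_ HM]].
  apply (RInt_gen_correct (V := C_R_CompleteNormedModule)).
  apply (ex_RInt_gen_dominated (V := C_R_CompleteNormedModule) _ (gamma_integrand (Re z)) M); auto.
  - apply continuous_Cgamma_integrand.
  - apply continuous_gamma_integrand.
  - intros t _; rewrite <- Cmod_norm; right; apply Cmod_Cgamma_integrand.
Qed.

Lemma is_RInt_gen_RGamma (x : R) : 0 < x ->
  is_RInt_gen (gamma_integrand x) (at_right 0) (Rbar_locally p_infty) (RGamma x).
Proof.
  intros Hx; destruct (RInt_gamma_integrand_bounded x Hx) as [M [_ HM]].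
  apply (RInt_gen_correct (V := R_CompleteNormedModule)).
  apply (ex_RInt_gen_dominated (V := R_CompleteNormedModule) _ (gamma_integrand x) M); auto.
  - apply continuous_gamma_integrand.
  - apply continuous_gamma_integrand.
  - intros t _; right; apply Rabs_pos_eq; left; apply Rmult_lt_0_compat; apply exp_pos.
Qed.

Lemma CGamma_RtoC (x : R) : 0 < x -> CGamma (RtoC x) = RtoC (RGamma x).
Proof.
  intros Hx; apply (is_RInt_gen_C_unique (fun t => RtoC (gamma_integrand x t))).
  - apply (is_RInt_gen_ext (V := C_R_NormedModule) (Cgamma_integrand (RtoC x)));
      [|now apply is_RInt_gen_CGamma].
    generalize pos_ends_ordered; apply filter_imp; intros p _ t _; apply Cgamma_integrand_RtoC.
  - now apply is_RInt_gen_RtoC, is_RInt_gen_RGamma.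
Qed.

(** * The Beta integral *)

Definition beta_integrand (x b t : R) : R := (exp (- (x * t)) * Rpower (1 - exp (- t)) (b - 1))%R.

Definition Cbeta_integrand (z : C) (b t : R) : C :=
  cexp (- z * RtoC t) * RtoC (Rpower (1 - exp (- t)) (b - 1)).

(** Euler's [B (z, b)], written with the variable [exp (- t)]. *)
Definition CBeta (z : C) (b : R) : C :=
  @RInt_gen C_R_CompleteNormedModule (Cbeta_integrand z b) (at_right 0) (Rbar_locally p_infty).

Lemma is_derive_Rpower_one_minus_exp (b t : R) : 0 < t ->
  is_derive (fun t => Rpower (1 - exp (- t)) b) t (b * exp (- t) * Rpower (1 - exp (- t)) (b - 1))%R.
Proof.
  intros Ht; pose proof (exp_opp_lt_1 t Ht); rewrite Rpower_minus_1 by lra.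
  unfold Rpower; auto_derive; [lra|unfold Rminus; field; lra].
Qed.

Lemma continuous_beta_integrand (x b : R) : continuous_pos (beta_integrand x b).
Proof.
  intros t Ht; pose proof (exp_opp_lt_1 t Ht).
  apply continuous_of_ex_derive; unfold beta_integrand, Rpower; auto_derive; lra.
Qed.

Lemma continuous_Cbeta_integrand (z : C) (b : R) : continuous_pos (Cbeta_integrand z b).
Proof.
  intros t Ht; apply continuous_Cmult.
  - apply (continuous_cexp_Cmult (- z) (fun t => t)), continuous_id.
  - apply continuous_RtoC, continuous_of_ex_derive; eexists; now apply is_derive_Rpower_one_minus_exp.
Qed.

Lemma Cmod_Cbeta_integrand (z : C) (b t : R) : Cmod (Cbeta_integrand z b t) = beta_integrand (Re z) b t.
Proof.
  unfold Cbeta_integrand, beta_integrand.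
  now rewrite Cmod_mult, Cmod_cexp, Re_Cmult_RtoC_opp, Cmod_R, Rabs_pos_eq by (left; apply exp_pos).
Qed.

Lemma Rpower_one_minus_exp_le_1 (b t : R) : 0 <= b -> 0 < t -> Rpower (1 - exp (- t)) b <= 1.
Proof. intros Hb Ht; pose proof (exp_opp_lt_1 t Ht); apply Rpower_le_1; lra. Qed.

Lemma beta_integrand_le (x b t : R) : 0 < x -> 0 < b -> 0 < t ->
  beta_integrand x b t <= 2 * (exp (- (x * t)) + exp (- t) * Rpower (1 - exp (- t)) (b - 1)).
Proof.
  intros Hx Hb Ht; pose proof (exp_opp_lt_1 t Ht) as Hs; unfold beta_integrand; set (s := exp (- t)) in *.
  assert (P1 : 0 < Rpower (1 - s) (b - 1)) by apply exp_pos.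
  assert (P2 : 0 < exp (- (x * t)) <= 1).
  { split; [apply exp_pos|apply exp_nonpos_le_1]; nra. }
  destruct (Rle_dec s (1 / 2)) as [h|h].
  - assert (P3 : Rpower (1 - s) (b - 1) <= 2).
    { rewrite Rpower_minus_1 by lra; apply Rle_div_l; [lra|].
      assert (Rpower (1 - s) b <= 1) by (apply Rpower_le_1; lra); lra. }
    assert (0 < s * Rpower (1 - s) (b - 1)) by nra; nra.
  - assert (exp (- (x * t)) <= 2 * s) by lra; nra.
Qed.

Lemma RInt_beta_integrand_le (x b t1 t2 : R) : 0 < x -> 0 < b -> 0 < t1 <= t2 ->
  RInt (beta_integrand x b) t1 t2 <= 2 * (/ x + / b).
Proof.
  intros Hx Hb Ht.
  set (G := fun t => (2 * (- (exp (- (x * t)) / x) + Rpower (1 - exp (- t)) b / b))%R).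
  assert (HG : RInt (beta_integrand x b) t1 t2 <= G t2 - G t1).
  { apply (RInt_le_of_derive _ G (fun t =>
      2 * (exp (- (x * t)) + exp (- t) * Rpower (1 - exp (- t)) (b - 1)))%R);
      [lra|intros t Htt; assert (Hs : 0 < exp (- t) < 1) by (apply exp_opp_lt_1; lra) ..].
    - apply continuous_beta_integrand; lra.
    - unfold G; rewrite Rpower_minus_1 by lra; unfold Rpower; auto_derive; [lra|].
      unfold Rminus; field; lra.
    - apply continuous_of_ex_derive; unfold Rpower; auto_derive; lra.
    - apply beta_integrand_le; lra. }
  assert (G1 : - (2 * / x) <= G t1).
  { assert (0 < Rpower (1 - exp (- t1)) b / b) by (apply Rdiv_lt_0_compat; [apply exp_pos|lra]).
    assert (exp (- (x * t1)) * / x <= 1 * / x); [|unfold G, Rdiv in *; lra].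
    apply Rmult_le_compat_r; [left; now apply Rinv_0_lt_compat|apply exp_nonpos_le_1; nra]. }
  assert (G2 : G t2 <= 2 * / b).
  { assert (0 < exp (- (x * t2)) / x) by (apply Rdiv_lt_0_compat; [apply exp_pos|lra]).
    assert (Rpower (1 - exp (- t2)) b * / b <= 1 * / b); [|unfold G, Rdiv in *; lra].
    apply Rmult_le_compat_r; [left; now apply Rinv_0_lt_compat|apply Rpower_one_minus_exp_le_1; lra]. }
  lra.
Qed.

Lemma Cmod_RInt_Cbeta_le (z : C) (b t1 t2 : R) (g : R -> R) (lg : R) : 0 < t1 <= t2 ->
  (forall t, t1 <= t <= t2 -> beta_integrand (Re z) b t <= g t) -> is_RInt g t1 t2 lg ->
  Cmod (CRInt (Cbeta_integrand z b) t1 t2) <= lg.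
Proof.
  intros Ht Hg Ig; apply Cmod_RInt_le with (f := Cbeta_integrand z b) (4 := Ig); [lra| |].
  - intros t Htt; rewrite Cmod_Cbeta_integrand; now apply Hg.
  - apply (is_RInt_pos (V := C_R_CompleteNormedModule)); [apply continuous_Cbeta_integrand|exact Ht].
Qed.

Lemma is_RInt_gen_CBeta (z : C) (b : R) : 0 < Re z -> 0 < b ->
  is_RInt_gen (Cbeta_integrand z b) (at_right 0) (Rbar_locally p_infty) (CBeta z b).
Proof.
  intros Hz Hb; apply (RInt_gen_correct (V := C_R_CompleteNormedModule)).
  apply (ex_RInt_gen_dominated (V := C_R_CompleteNormedModule) _ (beta_integrand (Re z) b)
    (2 * (/ Re z + / b))%R).
  - apply continuous_Cbeta_integrand.
  - apply continuous_beta_integrand.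
  - intros t _; rewrite <- Cmod_norm; right; apply Cmod_Cbeta_integrand.
  - intros; now apply RInt_beta_integrand_le.
Qed.

Lemma filterlim_Rpower_0 (b : R) : 0 < b -> filterlim (fun t => Rpower t b) (at_right 0) (locally 0%R).
Proof.
  intros Hb P [eps HP]; pose proof (cond_pos eps) as Heps.
  exists (mkposreal (Rpower eps (/ b)) (exp_pos _)); intros t Ht Ht0; apply HP.
  change (Rabs (t - 0) < Rpower eps (/ b)) in Ht; rewrite Rminus_0_r, Rabs_pos_eq in Ht by lra.
  change (Rabs (Rpower t b - 0) < eps); rewrite Rminus_0_r, Rabs_pos_eq by (left; apply exp_pos).
  apply Rlt_le_trans with (Rpower (Rpower eps (/ b)) b); [apply Rlt_Rpower_l; lra|].
  rewrite Rpower_mult, Rinv_l, Rpower_1; lra.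
Qed.

Lemma filterlim_exp_decay (x : R) : 0 < x ->
  filterlim (fun t => exp (- (x * t))) (Rbar_locally p_infty) (locally 0%R).
Proof.
  intros Hx P [eps HP]; pose proof (cond_pos eps) as Heps.
  exists (- ln eps / x)%R; intros t Ht; apply HP.
  change (Rabs (exp (- (x * t)) - 0) < eps).
  rewrite Rminus_0_r, Rabs_pos_eq by (left; apply exp_pos).
  rewrite <- (exp_ln eps) by exact Heps; apply exp_increasing.
  apply Rlt_div_l in Ht; lra.
Qed.

Lemma filterlim_cexp_decay (z : C) : 0 < Re z ->
  filterlim (fun t => cexp (- z * RtoC t)) (Rbar_locally p_infty) (locally (RtoC 0)).
Proof.
  intros Hz; apply (filterlim_Cmod_0 (Rbar_locally p_infty) _ _ _) with (2 := filterlim_exp_decay _ Hz).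
  exists 0%R; intros t _; replace (cexp (- z * RtoC t) - 0) with (cexp (- z * RtoC t)) by ring.
  rewrite Cmod_cexp, Re_Cmult_RtoC_opp; lra.
Qed.

Section BetaRecursion.
Variables (z : C) (b : R).
Hypotheses (Re_z_pos : 0 < Re z) (b_pos : 0 < b).

Let phi (t : R) : C := cexp (- z * RtoC t) * RtoC (Rpower (1 - exp (- t)) b).

Let Cmod_phi (t : R) : Cmod (phi t) = (exp (- (Re z * t)) * Rpower (1 - exp (- t)) b)%R.
Proof.
  unfold phi; now rewrite Cmod_mult, Cmod_cexp, Re_Cmult_RtoC_opp, Cmod_R, Rabs_pos_eq
    by (left; apply exp_pos).
Qed.

Let phi_at_0 : filterlim phi (at_right 0) (locally (RtoC 0)).
Proof.
  apply (filterlim_Cmod_0 (at_right 0) _ _ _) with (2 := filterlim_Rpower_0 b b_pos).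
  exists (mkposreal 1 Rlt_0_1); intros t _ Ht; replace (phi t - 0) with (phi t) by ring.
  rewrite Cmod_phi, <- (Rmult_1_l (Rpower t b)).
  pose proof (exp_opp_lt_1 t Ht); pose proof (exp_ineq1_le (- t)).
  apply Rmult_le_compat; try (left; apply exp_pos).
  - apply exp_nonpos_le_1; nra.
  - apply Rle_Rpower_l; lra.
Qed.

Let phi_at_infty : filterlim phi (Rbar_locally p_infty) (locally (RtoC 0)).
Proof.
  apply (filterlim_Cmod_0 (Rbar_locally p_infty) _ _ _) with (2 := filterlim_exp_decay _ Re_z_pos).
  exists 0%R; intros t Ht; replace (phi t - 0) with (phi t) by ring.
  rewrite Cmod_phi, <- Rmult_1_r; apply Rmult_le_compat_l; [left; apply exp_pos|apply Rpower_one_minus_exp_le_1; lra].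
Qed.

Let is_derive_phi (t : R) : 0 < t -> is_derive phi t
  (RtoC b * Cbeta_integrand z b t + - (z + RtoC b) * Cbeta_integrand z (b + 1) t).
Proof.
  intros Ht; pose proof (exp_opp_lt_1 t Ht).
  replace (RtoC b * Cbeta_integrand z b t + - (z + RtoC b) * Cbeta_integrand z (b + 1) t)
    with (- z * cexp (- z * RtoC t) * RtoC (Rpower (1 - exp (- t)) b)
      + cexp (- z * RtoC t) * RtoC (b * exp (- t) * Rpower (1 - exp (- t)) (b - 1))).
  - apply (is_derive_Cmult (fun t => cexp (- z * RtoC t)) (fun t => RtoC (Rpower (1 - exp (- t)) b)));
      [apply is_derive_cexp_line|].
    now apply is_derive_RtoC, is_derive_Rpower_one_minus_exp.
  - unfold Cbeta_integrand; replace (b + 1 - 1)%R with b by ring.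
    assert (E : Rpower (1 - exp (- t)) b = (Rpower (1 - exp (- t)) (b - 1) * (1 - exp (- t)))%R)
      by (rewrite Rpower_minus_1 by lra; field; lra).
    rewrite E, !RtoC_mult, RtoC_minus; ring.
Qed.

Lemma CBeta_succ : (z + RtoC b) * CBeta z (b + 1) = RtoC b * CBeta z b.
Proof.
  set (f := fun t => RtoC b * Cbeta_integrand z b t + - (z + RtoC b) * Cbeta_integrand z (b + 1) t).
  assert (E : RtoC b * CBeta z b + - (z + RtoC b) * CBeta z (b + 1) = 0 - 0).
  { apply (is_RInt_gen_C_unique f).
    - apply is_RInt_gen_Cplus; apply is_RInt_gen_Cmult_l; apply is_RInt_gen_CBeta; lra.
    - apply (is_RInt_gen_C_derive phi); auto; intros t Ht.
      apply continuous_Cplus; apply continuous_Cmult; try apply continuous_const;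
        now apply continuous_Cbeta_integrand. }
  replace ((z + RtoC b) * CBeta z (b + 1)) with
    (RtoC b * CBeta z b - (RtoC b * CBeta z b + - (z + RtoC b) * CBeta z (b + 1))) by ring.
  rewrite E; ring.
Qed.

End BetaRecursion.

Lemma CBeta_1 (z : C) : 0 < Re z -> CBeta z 1 = / z.
Proof.
  intros Hz; pose proof (Re_pos_neq_0 z Hz) as Hn.
  set (phi := fun t => - / z * cexp (- z * RtoC t)).
  apply (is_RInt_gen_C_unique (Cbeta_integrand z 1)); [apply is_RInt_gen_CBeta; lra|].
  replace (/ z) with (- / z * 0 - phi 0%R) by (unfold phi; rewrite !Cmult_0_r, cexp_0; ring).
  apply (is_RInt_gen_C_derive phi).
  - intros t Ht; pose proof (exp_opp_lt_1 t Ht).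
    replace (Cbeta_integrand z 1 t) with (- / z * (- z * cexp (- z * RtoC t))).
    + apply is_derive_Cmult_l, is_derive_cexp_line.
    + unfold Cbeta_integrand; rewrite Rminus_diag, Rpower_O by lra; field; exact Hn.
  - apply continuous_Cbeta_integrand.
  - apply (filterlim_filter_le_1 (F := locally 0%R)); [apply filter_le_within|].
    apply continuous_Cmult; [apply continuous_const|].
    apply (continuous_cexp_Cmult (- z) (fun t => t)), continuous_id.
  - apply (filterlim_Cmult (Rbar_locally p_infty)); [apply filterlim_const|now apply filterlim_cexp_decay].
Qed.

Lemma CBeta_shift (z : C) (b : R) (n : nat) : 0 < Re z -> 0 < b ->
  CBeta (z + RtoC b) (INR n + 1) * CBeta z b = CBeta (RtoC b) (INR n + 1) * CBeta z (INR n + 1 + b).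
Proof.
  intros Hz Hb; assert (Hzb : 0 < Re (z + RtoC b)) by (rewrite re_plus, re_RtoC; lra).
  induction n.
  - simpl INR; rewrite Rplus_0_l, !CBeta_1, Rplus_comm by (assumption || exact Hb).
    pose proof (CBeta_succ z b Hz Hb) as E.
    replace (CBeta z (b + 1)) with ((z + RtoC b) * CBeta z (b + 1) / (z + RtoC b)).
    + rewrite E; field; split; [now apply Re_pos_neq_0|apply RtoC_neq_0; lra].
    + field; now apply Re_pos_neq_0.
  - rewrite S_INR; pose proof (pos_INR n) as Hn; set (N := INR n) in *.
    pose proof (CBeta_succ (z + RtoC b) (N + 1) Hzb ltac:(lra)) as E1.
    pose proof (CBeta_succ (RtoC b) (N + 1) Hb ltac:(lra)) as E2.
    pose proof (CBeta_succ z (N + 1 + b) Hz ltac:(lra)) as E3.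
    replace (N + 1 + b + 1)%R with (N + 1 + 1 + b)%R in E3 by ring.
    rewrite (RtoC_plus (N + 1) b) in E3; set (k := RtoC (N + 1)) in *.
    assert (P1 : z + RtoC b + k <> 0) by (apply Re_pos_neq_0; unfold k; rewrite re_plus, re_RtoC; lra).
    assert (P2 : RtoC b + k <> 0) by (apply Re_pos_neq_0; unfold k; rewrite re_plus, !re_RtoC; lra).
    replace (CBeta (z + RtoC b) (N + 1 + 1)) with (k * CBeta (z + RtoC b) (N + 1) / (z + RtoC b + k))
      by (rewrite <- E1; field; exact P1).
    replace (CBeta (RtoC b) (N + 1 + 1)) with (k * CBeta (RtoC b) (N + 1) / (RtoC b + k))
      by (rewrite <- E2; field; exact P2).
    replace (CBeta z (N + 1 + 1 + b)) with ((k + RtoC b) * CBeta z (N + 1 + b) / (z + RtoC b + k))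
      by (rewrite <- E3; field; exact P1).
    replace (k * CBeta (z + RtoC b) (N + 1) / (z + RtoC b + k) * CBeta z b)
      with (k / (z + RtoC b + k) * (CBeta (z + RtoC b) (N + 1) * CBeta z b)) by (field; exact P1).
    rewrite IHn; field; auto.
Qed.

(** * Gauss's limit formula *)

Lemma pos_ends_elim (P : R * R -> Prop) :
  pos_ends P -> exists a b, 0 < a /\ forall t1 t2, 0 < t1 < a -> b < t2 -> P (t1, t2).
Proof.
  intros [Q1 Q2 [eps HQ1] [b HQ2] HP]; exists eps, b; split; [apply cond_pos|].
  intros t1 t2 H1 H2; apply HP; [|now apply HQ2]; apply HQ1; [|lra].
  change (Rabs (t1 - 0) < eps); rewrite Rminus_0_r, Rabs_pos_eq; lra.
Qed.

Lemma pos_ends_subst_exp (N a b : R) : 0 < N -> 0 < a -> 2 * b <= N ->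
  pos_ends (fun p => 0 < N * exp (- snd p) < a /\ b < N * exp (- fst p)).
Proof.
  intros HN Ha Hb; assert (HNa : 0 < N / a) by now apply Rdiv_lt_0_compat.
  assert (0 < ln 2) by (rewrite <- ln_1; apply ln_increasing; lra).
  generalize (pos_ends_between (ln 2) (ln (N / a)) ltac:(assumption)); apply filter_imp.
  intros [t1 t2]; simpl; intros [H1 H2]; pose proof (exp_pos (- t2)); repeat split; [nra| |].
  - apply Rlt_le_trans with (N * exp (- ln (N / a)))%R.
    + apply Rmult_lt_compat_l; [lra|apply exp_increasing; lra].
    + rewrite exp_Ropp, exp_ln by exact HNa; right; field; lra.
  - apply Rle_lt_trans with (N * exp (- ln 2))%R.
    + rewrite exp_Ropp, exp_ln by lra; lra.
    + apply Rmult_lt_compat_l; [lra|apply exp_increasing; lra].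
Qed.

Lemma one_minus_Rpower_le_exp (N c s : R) : 0 <= N -> 0 <= c -> 0 < s < 1 ->
  Rpower (1 - s) (N + c) <= exp (- (N * s)).
Proof.
  intros HN Hc Hs; apply exp_le_compat; pose proof (ln_le_sub_1 (1 - s) ltac:(lra)); nra.
Qed.

Lemma exp_mult_le_one_minus_pow (n : nat) (s : R) : 0 < s < 1 ->
  exp (- (INR n * s)) * (1 - INR n * (s * s)) <= (1 - s) ^ n.
Proof.
  intros Hs; apply Rle_trans with (exp (- (INR n * s)) * (1 - s * s) ^ n)%R.
  - apply Rmult_le_compat_l; [left; apply exp_pos|apply bernoulli_ineq; nra].
  - replace (exp (- (INR n * s))) with (exp (- s) ^ n)%R.
    + rewrite <- Rpow_mult_distr; apply pow_incr; pose proof (exp_pos (- s)).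
      assert (Hexp : exp (- s) * (1 + s) <= 1).
      { pose proof (exp_ineq1_le s); pose proof (exp_pos s).
        rewrite exp_Ropp, Rmult_comm; apply Rle_div_l; lra. }
      split; [apply Rmult_le_pos; nra|].
      replace (exp (- s) * (1 - s * s))%R with ((exp (- s) * (1 + s)) * (1 - s))%R by ring; nra.
    + rewrite <- (Rpower_pow n) by apply exp_pos; unfold Rpower; rewrite ln_exp; f_equal; ring.
Qed.

Lemma one_minus_Rpower_exp_error (n k : nat) (c s : R) : 0 <= c <= INR k -> 0 < s < 1 ->
  Rabs (Rpower (1 - s) (INR n + c) - exp (- (INR n * s)))
    <= exp (- (INR n * s)) * (INR n * (s * s) + INR k * s).
Proof.
  intros Hc Hs; pose proof (pos_INR n); pose proof (pos_INR k).
  pose proof (one_minus_Rpower_le_exp (INR n) c s ltac:(lra) ltac:(lra) Hs) as Upper.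
  set (E := exp (- (INR n * s))) in *; assert (HE : 0 < E) by apply exp_pos.
  set (a := (INR n * (s * s))%R); set (b := (INR k * s)%R).
  assert (Ha : 0 <= a) by (unfold a; nra); assert (Hb : 0 <= b) by (unfold b; nra).
  assert (Lower : E - E * (a + b) <= Rpower (1 - s) (INR n + c)).
  { assert (Hn : E * (1 - a) <= Rpower (1 - s) (INR n)).
    { rewrite Rpower_pow by lra; now apply exp_mult_le_one_minus_pow. }
    assert (Hk : 1 - b <= Rpower (1 - s) c).
    { apply Rle_trans with ((1 - s) ^ k)%R; [apply bernoulli_ineq; lra|].
      rewrite <- Rpower_pow by lra; apply exp_le_compat.
      pose proof (ln_le_sub_1 (1 - s) ltac:(lra)); nra. }
    assert (Pos : 0 < Rpower (1 - s) (INR n + c)) by apply exp_pos.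
    destruct (Rle_dec 1 (a + b)) as [Hab|Hab]; [nra|].
    rewrite Rpower_plus; apply Rle_trans with ((E * (1 - a)) * (1 - b))%R.
    - assert (0 <= a * b) by nra; nra.
    - apply Rmult_le_compat; nra. }
  assert (0 <= E * (a + b)) by (apply Rmult_le_pos; lra).
  apply Rabs_le; split; lra.
Qed.

Lemma RInt_gamma_subst_exp_bounded (x : R) : 0 < x ->
  exists M, 0 < M /\ forall N t1 t2, 0 < N -> 0 < t1 <= t2 ->
    exists I, is_RInt (fun t => N * exp (- t) * gamma_integrand x (N * exp (- t)))%R t1 t2 I /\ I <= M.
Proof.
  intros Hx; destruct (RInt_gamma_integrand_bounded x Hx) as [M [HM0 HM]]; exists M; split; [exact HM0|].
  intros N t1 t2 HN Ht; eexists; split.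
  - apply (is_RInt_subst_exp (V := R_CompleteNormedModule) (gamma_integrand x) N t1 t2 HN).
    apply continuous_gamma_integrand.
  - apply HM; split; [apply Rmult_lt_0_compat; [exact HN|apply exp_pos]|].
    apply Rmult_le_compat_l; [lra|apply exp_le_compat; lra].
Qed.

Lemma is_RInt_Cgamma_subst_exp (w : C) (N t1 t2 : R) : 0 < N ->
  is_RInt (fun t => RtoC (N * exp (- t)) * Cgamma_integrand w (N * exp (- t))) t1 t2
    (CRInt (Cgamma_integrand w) (N * exp (- t2)) (N * exp (- t1))).
Proof.
  intros HN; eapply (is_RInt_ext (V := C_R_NormedModule)).
  2:{ apply (is_RInt_subst_exp (V := C_R_CompleteNormedModule)); [exact HN|].
      apply continuous_Cgamma_integrand. }
  intros t _; apply scal_R_Cmult.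
Qed.

Lemma Cgamma_integrand_mult (w : C) (u : R) : 0 < u ->
  RtoC u * Cgamma_integrand w u = cexp (w * RtoC (ln u)) * RtoC (exp (- u)).
Proof.
  intros Hu; unfold Cgamma_integrand; rewrite Cmult_assoc; f_equal.
  rewrite <- (exp_ln u) at 1 by exact Hu; rewrite <- cexp_RtoC, <- cexp_plus; f_equal; ring.
Qed.

Lemma Cbeta_integrand_mult (w : C) (N b t : R) : 0 < N ->
  cexp (w * RtoC (ln N)) * Cbeta_integrand w (b + 1) t =
  cexp (w * RtoC (ln (N * exp (- t)))) * RtoC (Rpower (1 - exp (- t)) b).
Proof.
  intros HN; unfold Cbeta_integrand; replace (b + 1 - 1)%R with b by ring.
  rewrite Cmult_assoc, <- cexp_plus, ln_mult, ln_exp, RtoC_plus, RtoC_opp by (try apply exp_pos; exact HN).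
  f_equal; f_equal; ring.
Qed.

(** After the substitution [u = n exp (- t)] the Beta integrand only differs from Euler's
    integrand by the error in [(1 - u / n) ^ (n + c) ~ exp (- u)], of relative size [O(1 / n)]. *)
Lemma Cmod_scaled_beta_sub_gamma_le (w : C) (c : R) : 0 < Re w -> 0 <= c ->
  exists K, 0 <= K /\ forall n t1 t2, (1 <= n)%nat -> 0 < t1 <= t2 ->
    Cmod (cexp (w * RtoC (ln (INR n))) * CRInt (Cbeta_integrand w (INR n + c + 1)) t1 t2
      - CRInt (Cgamma_integrand w) (INR n * exp (- t2)) (INR n * exp (- t1))) <= K / INR n.
Proof.
  intros Hw Hc; set (x := Re w) in *.
  destruct (RInt_gamma_subst_exp_bounded (x + 2) ltac:(lra)) as [M2 [HM2 B2]].
  destruct (RInt_gamma_subst_exp_bounded (x + 1) ltac:(lra)) as [M1 [HM1 B1]].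
  destruct (INR_unbounded c) as [k Hk]; pose proof (pos_INR k).
  exists (M2 + INR k * M1)%R; split; [nra|]; intros n t1 t2 Hn Ht.
  set (N := INR n); assert (HN : 0 < N) by (apply lt_0_INR; lia).
  destruct (B2 N t1 t2 HN Ht) as [I2 [HI2 LI2]]; destruct (B1 N t1 t2 HN Ht) as [I1 [HI1 LI1]].
  apply Rle_trans with (/ N * (I2 + INR k * I1))%R.
  2:{ unfold Rdiv; rewrite Rmult_comm; apply Rmult_le_compat_r; [left; now apply Rinv_0_lt_compat|nra]. }
  eapply Cmod_RInt_le; [apply Ht| | |].
  3:{ apply (is_RInt_scal (V := R_NormedModule)), (is_RInt_plus (V := R_NormedModule)); [exact HI2|].
      apply (is_RInt_scal (V := R_NormedModule)); exact HI1. }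
  2:{ apply is_RInt_Cminus; [apply is_RInt_Cmult_l|now apply is_RInt_Cgamma_subst_exp].
      apply (is_RInt_pos (V := C_R_CompleteNormedModule)); [apply continuous_Cbeta_integrand|exact Ht]. }
  intros t Htt; pose proof (exp_opp_lt_1 t ltac:(lra)) as Hs; cbv beta.
  set (s := exp (- t)) in *; assert (Hu : 0 < N * s) by nra.
  rewrite Cbeta_integrand_mult, Cgamma_integrand_mult by assumption; fold s.
  replace (cexp (w * RtoC (ln (N * s))) * RtoC (Rpower (1 - s) (N + c))
      - cexp (w * RtoC (ln (N * s))) * RtoC (exp (- (N * s))))
    with (cexp (w * RtoC (ln (N * s))) * RtoC (Rpower (1 - s) (N + c) - exp (- (N * s))))
    by (rewrite RtoC_minus; ring).
  rewrite Cmod_mult, Cmod_cexp, re_scal_r, Cmod_R; fold x.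
  apply Rle_trans with (exp (x * ln (N * s)) * (exp (- (N * s)) * (N * (s * s) + INR k * s)))%R.
  { apply Rmult_le_compat_l; [left; apply exp_pos|]; apply one_minus_Rpower_exp_error; lra. }
  right; unfold scal, plus; simpl; unfold mult; simpl; unfold gamma_integrand.
  replace (x + 2 - 1)%R with (x + 1)%R by ring; replace (x + 1 - 1)%R with x by ring.
  rewrite Rpower_plus, Rpower_1 by exact Hu; unfold Rpower; field; lra.
Qed.

Theorem CBeta_gauss_limit (w : C) (c : R) : 0 < Re w -> 0 <= c ->
  filterlim (fun n => cexp (w * RtoC (ln (INR n))) * CBeta w (INR n + c + 1)) eventually
    (locally (CGamma w)).
Proof.
  intros Hw Hc; apply (filterlim_Cmod eventually); intros eps Heps.
  destruct (Cmod_scaled_beta_sub_gamma_le w c Hw Hc) as [K [HK Diff]].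
  pose proof (proj1 (is_RInt_gen_pos (V := C_R_CompleteNormedModule) _ _ (continuous_Cgamma_integrand w))
    (is_RInt_gen_CGamma w Hw)) as Gamma.
  destruct (pos_ends_elim _ (proj1 (filterlim_Cmod pos_ends _ _) Gamma (eps / 3)%R ltac:(lra)))
    as [a [b [Ha Near]]].
  destruct (INR_unbounded (Rmax (2 * b) (3 * K / eps))) as [n0 Hn0].
  exists (S n0); intros n Hn.
  pose proof (Rmax_l (2 * b) (3 * K / eps)); pose proof (Rmax_r (2 * b) (3 * K / eps)).
  assert (HnR : INR n0 <= INR n) by (apply le_INR; lia).
  assert (HN : 0 < INR n) by (apply lt_0_INR; lia).
  assert (HKn : K / INR n <= eps / 3).
  { apply Rle_div_l; [exact HN|]; assert (L : 3 * K / eps <= INR n) by lra.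
    apply Rle_div_l in L; lra. }
  apply Rle_lt_trans with (eps / 3 + eps / 3)%R; [|lra].
  pose proof (proj1 (is_RInt_gen_pos (V := C_R_CompleteNormedModule) _ _
    (continuous_Cbeta_integrand w (INR n + c + 1)))
    (is_RInt_gen_CBeta w (INR n + c + 1) Hw ltac:(lra))) as Beta.
  eapply (Cmod_le_of_filterlim pos_ends).
  - apply (filterlim_Cminus pos_ends); [|apply filterlim_const].
    apply (filterlim_Cmult pos_ends); [apply filterlim_const|exact Beta].
  - generalize (filter_and (F := pos_ends) _ _ pos_ends_ordered
      (pos_ends_subst_exp (INR n) a b HN Ha ltac:(lra))); apply filter_imp.
    intros [t1 t2]; simpl; intros [Ht [H2 H1]].
    eapply Rle_trans; [apply Cmod_sub_triangle|]; apply Rplus_le_compat.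
    + eapply Rle_trans; [apply Diff; [lia|lra]|exact HKn].
    + left; exact (Near _ _ H2 H1).
Qed.

Theorem CBeta_CGamma (z : C) (b : R) : 0 < Re z -> 0 < b ->
  CGamma (z + RtoC b) * CBeta z b = CGamma (RtoC b) * CGamma z.
Proof.
  intros Hz Hb; assert (Hzb : 0 < Re (z + RtoC b)) by (rewrite re_plus, re_RtoC; lra).
  apply (filterlim_C_unique eventually (fun n =>
    cexp ((z + RtoC b) * RtoC (ln (INR n))) * CBeta (z + RtoC b) (INR n + 0 + 1) * CBeta z b)).
  - apply (filterlim_Cmult eventually); [apply CBeta_gauss_limit; lra|apply filterlim_const].
  - apply (filterlim_ext (fun n => (cexp (RtoC b * RtoC (ln (INR n))) * CBeta (RtoC b) (INR n + 0 + 1))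
      * (cexp (z * RtoC (ln (INR n))) * CBeta z (INR n + b + 1)))).
    + intros n; pose proof (CBeta_shift z b n Hz Hb) as E.
      replace (INR n + 1 + b)%R with (INR n + b + 1)%R in E by ring; rewrite Rplus_0_r.
      rewrite <- (Cmult_assoc _ (CBeta (z + RtoC b) _)), E.
      replace ((z + RtoC b) * RtoC (ln (INR n)))
        with (RtoC b * RtoC (ln (INR n)) + z * RtoC (ln (INR n))) by ring.
      rewrite cexp_plus; ring.
    + apply (filterlim_Cmult eventually); apply CBeta_gauss_limit; simpl; lra.
Qed.

Lemma Cmod_plus_RtoC_le (w : C) (k : R) : 0 < k ->
  Cmod (w + RtoC k) <= k * exp (Re w / k + Cmod w ^ 2 / (2 * (k * k))).
Proof.
  intros Hk; apply Rle_of_sqr_le; [apply Rmult_le_pos; [lra|left; apply exp_pos]|].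
  rewrite Rpow_mult_distr.
  replace (exp (Re w / k + Cmod w ^ 2 / (2 * (k * k))) ^ 2)%R
    with (exp (2 * Re w / k + Cmod w ^ 2 / (k * k))).
  2:{ rewrite <- (Rsqr_pow2 (exp _)); unfold Rsqr; rewrite <- exp_plus; f_equal; field; lra. }
  pose proof (exp_ineq1_le (2 * Re w / k + Cmod w ^ 2 / (k * k))) as E.
  apply (Rmult_le_compat_l (k ^ 2)) in E; [|apply pow_le; lra].
  eapply Rle_trans; [|exact E]; right.
  replace (k ^ 2 * (1 + (2 * Re w / k + Cmod w ^ 2 / (k * k))))%R
    with (k ^ 2 + 2 * Re w * k + Cmod w ^ 2)%R by (field; lra).
  rewrite !Cmod2_alt; destruct w; simpl; ring.
Qed.

(** The exponent of [Cmod_plus_RtoC_le] is dominated by a telescoping difference. *)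
Lemma Cmod_plus_RtoC_le_telescope (w : C) (k : R) : 0 < Re w -> 1 <= k ->
  Cmod (w + RtoC k) <=
  k * exp (Re w * (ln (k + 1) - ln k) + (Re w + Cmod w ^ 2) * (/ k - / (k + 1))).
Proof.
  intros Hw Hk; eapply Rle_trans; [apply Cmod_plus_RtoC_le; lra|].
  apply Rmult_le_compat_l; [lra|apply exp_le_compat].
  assert (Hln : / (k + 1) <= ln (k + 1) - ln k).
  { replace k with (k + 1 - 1)%R at 3 by ring; apply Rinv_le_ln_sub; lra. }
  assert (Hdiff : (/ k - / (k + 1) = / (k * (k + 1)))%R) by (field; lra).
  assert (Hre : (Re w / k = Re w * / (k + 1) + Re w * / (k * (k + 1)))%R) by (field; lra).
  assert (Hsq : Cmod w ^ 2 / (2 * (k * k)) <= Cmod w ^ 2 * / (k * (k + 1))).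
  { apply Rmult_le_compat_l; [apply pow_le, Cmod_ge_0|apply Rinv_le_contravar; nra]. }
  assert (Re w * / (k + 1) <= Re w * (ln (k + 1) - ln k)) by (apply Rmult_le_compat_l; lra).
  rewrite Hdiff, Hre; lra.
Qed.

Lemma Cmod_CBeta_lower (w : C) (n : nat) : 0 < Re w ->
  / Cmod w * exp (- (Re w * ln (INR n + 1)) - (Re w + Cmod w ^ 2) * (1 - / (INR n + 1)))
    <= Cmod (CBeta w (INR n + 1)).
Proof.
  intros Hw; pose proof (Re_pos_neq_0 w Hw) as Hw0; pose proof (proj1 (Cmod_gt_0 w) Hw0) as Hm.
  set (x := Re w) in *; set (K := (x + Cmod w ^ 2)%R); induction n.
  - simpl INR; rewrite Rplus_0_l, CBeta_1, Cmod_inv, ln_1, Rinv_1 by assumption.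
    replace (- (x * 0) - K * (1 - 1))%R with 0%R by ring; rewrite exp_0; lra.
  - rewrite S_INR; pose proof (pos_INR n); set (k := (INR n + 1)%R) in *.
    assert (Hk : 1 <= k) by (unfold k; lra).
    pose proof (f_equal Cmod (CBeta_succ w k Hw ltac:(lra))) as E.
    rewrite !Cmod_mult, Cmod_R, Rabs_pos_eq in E by lra.
    assert (Hwk : 0 < Cmod (w + RtoC k)).
    { apply Cmod_gt_0, Re_pos_neq_0; rewrite re_plus, re_RtoC; fold x; lra. }
    apply Rmult_le_reg_l with (Cmod (w + RtoC k)); [exact Hwk|]; rewrite E.
    eapply Rle_trans; [|apply Rmult_le_compat_l; [lra|exact IHn]].
    set (X := exp (- (x * ln (k + 1)) - K * (1 - / (k + 1)))).
    replace (exp (- (x * ln k) - K * (1 - / k)))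
      with (exp (x * (ln (k + 1) - ln k) + K * (/ k - / (k + 1))) * X)%R
      by (unfold X; rewrite <- exp_plus; f_equal; ring).
    pose proof (Cmod_plus_RtoC_le_telescope w k Hw Hk) as T; fold x K in T.
    set (Y := exp (x * (ln (k + 1) - ln k) + K * (/ k - / (k + 1)))) in *.
    replace (k * (/ Cmod w * (Y * X)))%R with (k * Y * (/ Cmod w * X))%R by ring.
    apply Rmult_le_compat_r; [|exact T].
    apply Rmult_le_pos; [left; now apply Rinv_0_lt_compat|left; apply exp_pos].
Qed.

Theorem CGamma_neq_0 (w : C) : 0 < Re w -> CGamma w <> 0.
Proof.
  intros Hw Z; pose proof (proj1 (Cmod_gt_0 w) (Re_pos_neq_0 w Hw)) as Hm.
  set (K := (Re w + Cmod w ^ 2)%R); set (kappa := (/ Cmod w * exp (- (Re w * ln 2) - K))%R).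
  assert (Hkappa : 0 < kappa) by (apply Rmult_lt_0_compat; [now apply Rinv_0_lt_compat|apply exp_pos]).
  pose proof (CBeta_gauss_limit w 0 Hw (Rle_refl 0)) as Lim; rewrite Z in Lim.
  destruct (proj1 (filterlim_Cmod eventually _ _) Lim kappa Hkappa) as [n0 H].
  specialize (H (S n0) ltac:(lia)); set (N := INR (S n0)) in *.
  assert (HN : 1 <= N) by (unfold N; rewrite S_INR; pose proof (pos_INR n0); lra).
  rewrite Rplus_0_r in H.
  replace (_ * _ - 0) with (cexp (w * RtoC (ln N)) * CBeta w (N + 1)) in H by ring.
  rewrite Cmod_mult, Cmod_cexp, re_scal_r in H.
  apply (Rlt_irrefl kappa), Rle_lt_trans with (2 := H).
  eapply Rle_trans; [|apply Rmult_le_compat_l; [left; apply exp_pos|apply Cmod_CBeta_lower, Hw]].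
  fold N K; rewrite (Rmult_comm (exp _)), Rmult_assoc, <- exp_plus.
  apply Rmult_le_compat_l; [left; now apply Rinv_0_lt_compat|apply exp_le_compat].
  assert (Hln : ln (N + 1) <= ln 2 + ln N) by (rewrite <- ln_mult by lra; apply ln_le; lra).
  assert (0 <= K) by (unfold K; pose proof (pow_le (Cmod w) 2 (Rlt_le _ _ Hm)); lra).
  assert (0 < / (N + 1)) by (apply Rinv_0_lt_compat; lra).
  assert (Re w * ln (N + 1) <= Re w * (ln 2 + ln N)) by (apply Rmult_le_compat_l; lra).
  nra.
Qed.

Lemma Cmod_RInt_Cbeta_decay (z : C) : 0 < Re z ->
  exists M, 0 < M /\ forall b t1 t2, 1 < b -> 0 < t1 <= t2 ->
    Cmod (CRInt (Cbeta_integrand z b) t1 t2) <= M * Rpower (b - 1) (- Re z).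
Proof.
  intros Hz; set (x := Re z) in *.
  destruct (RInt_gamma_subst_exp_bounded x Hz) as [M [HM Bound]]; exists M; split; [exact HM|].
  intros b t1 t2 Hb Ht; set (N := (b - 1)%R); assert (HN : 0 < N) by (unfold N; lra).
  destruct (Bound N t1 t2 HN Ht) as [I [HI LI]]; rewrite Rmult_comm.
  assert (HP : 0 < Rpower N (- x)) by apply exp_pos.
  apply Rle_trans with (Rpower N (- x) * I)%R; [|apply Rmult_le_compat_l; lra].
  eapply Cmod_RInt_Cbeta_le; [exact Ht| |exact (is_RInt_scal (V := R_NormedModule) _ t1 t2 _ I HI)].
  intros t Htt; pose proof (exp_opp_lt_1 t ltac:(lra)) as Hs.
  unfold beta_integrand, scal; simpl; unfold mult; simpl; unfold gamma_integrand; fold x N.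
  assert (Hu : 0 < N * exp (- t)) by nra.
  assert (Hpow : (Rpower N (- x) * Rpower (N * exp (- t)) x = exp (- (x * t)))%R).
  { unfold Rpower; rewrite ln_mult, ln_exp, <- exp_plus by (try apply exp_pos; exact HN); f_equal; ring. }
  replace (Rpower N (- x) * _)%R with (exp (- (x * t)) * exp (- (N * exp (- t))))%R.
  - apply Rmult_le_compat_l; [left; apply exp_pos|].
    pose proof (one_minus_Rpower_le_exp N 0 (exp (- t)) ltac:(lra) ltac:(lra) Hs) as L.
    now rewrite Rplus_0_r in L.
  - rewrite Rpower_minus_1, <- Hpow by exact Hu; field; lra.
Qed.

Lemma Cmod_RInt_Cbeta_uniform_decay (z : C) (b0 : R) : 0 < Re z -> 0 < b0 ->
  exists M, 0 <= M /\ forall b t1 t2, b0 <= b -> 0 < t1 <= t2 ->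
    Cmod (CRInt (Cbeta_integrand z b) t1 t2) <= M * Rpower (b + 1) (- Re z).
Proof.
  intros Hz Hb0; destruct (Cmod_RInt_Cbeta_decay z Hz) as [M [HM Decay]].
  set (x := Re z) in *; set (M0 := (2 * (/ x + / b0))%R).
  assert (HM0 : 0 < M0).
  { pose proof (Rinv_0_lt_compat x Hz); pose proof (Rinv_0_lt_compat b0 Hb0); unfold M0; lra. }
  assert (H3 : 0 < Rpower 3 x) by apply exp_pos.
  exists ((M + M0) * Rpower 3 x)%R; split; [nra|]; intros b t1 t2 Hb Ht.
  assert (Hthird : Rpower ((b + 1) / 3) (- x) = (Rpower 3 x * Rpower (b + 1) (- x))%R)
    by (apply Rpower_Ropp_Rdiv; lra).
  rewrite Rmult_assoc, <- Hthird.
  assert (HP : 0 < Rpower ((b + 1) / 3) (- x)) by apply exp_pos.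
  destruct (Rle_dec 2 b) as [H2|H2].
  - eapply Rle_trans; [apply Decay; lra|].
    apply Rle_trans with (M * Rpower ((b + 1) / 3) (- x))%R; [|nra].
    apply Rmult_le_compat_l; [lra|apply Rpower_Ropp_le; lra].
  - apply Rle_trans with M0.
    + eapply Rle_trans; [eapply Cmod_RInt_Cbeta_le; [exact Ht|intros; apply Rle_refl|]|].
      * apply (is_RInt_pos (V := R_CompleteNormedModule)); [apply continuous_beta_integrand|exact Ht].
      * eapply Rle_trans; [apply RInt_beta_integrand_le; fold x; lra|].
        unfold M0; fold x; apply Rmult_le_compat_l; [lra|apply Rplus_le_compat_l, Rinv_le_contravar; lra].
    + assert (One : 1 <= Rpower ((b + 1) / 3) (- x)).
      { apply Rle_trans with (Rpower 1 (- x)); [right; now rewrite Rpower_base_1|apply Rpower_Ropp_le; lra]. }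
      nra.
Qed.

(** * The principal logarithm and the coordinate [sigma] *)

Lemma Carg_right (z : C) : 0 < Re z -> Carg z = atan (Im z / Re z).
Proof. intros H; unfold Carg; destruct (Rlt_dec 0 (Re z)); [reflexivity|lra]. Qed.

Lemma Cmod_right (z : C) : 0 < Re z -> Cmod z = (Re z * sqrt (1 + (Im z / Re z)²))%R.
Proof.
  intros H; destruct z as [x y]; simpl in *; unfold Cmod; simpl.
  rewrite <- (sqrt_square x) at 3 by lra; rewrite <- sqrt_mult.
  - f_equal; unfold Rsqr; field; lra.
  - nra.
  - pose proof (Rle_0_sqr (y / x)); lra.
Qed.

Lemma cexp_Cln (z : C) : 0 < Re z -> cexp (Cln z) = z.
Proof.
  intros H; assert (Hm : 0 < Cmod z) by (apply Cmod_gt_0, Re_pos_neq_0, H).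
  unfold cexp, Cln; simpl; rewrite exp_ln, Carg_right, cos_atan, sin_atan by assumption.
  rewrite Cmod_right by exact H.
  assert (S : sqrt (1 + (Im z / Re z)²) <> 0%R).
  { apply Rgt_not_eq, sqrt_lt_R0; pose proof (Rle_0_sqr (Im z / Re z)); lra. }
  destruct z as [x y]; simpl in *; f_equal; field; repeat split; solve [exact S | lra].
Qed.

Lemma Cln_RtoC (x : R) : 0 < x -> Cln (RtoC x) = RtoC (ln x).
Proof.
  intros H; unfold Cln; rewrite Carg_right, Cmod_R, Rabs_pos_eq by (simpl; lra).
  unfold RtoC; simpl; f_equal; replace (0 / x)%R with 0%R by (field; lra); apply atan_0.
Qed.

Lemma continuous_Cln (z : C) : 0 < Re z -> continuous Cln z.
Proof.
  intros H; assert (Hm : 0 < Cmod z) by (apply Cmod_gt_0, Re_pos_neq_0, H).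
  apply (continuous_ext_loc _ (fun q => (ln (Cmod q), atan (Im q / Re q)))).
  - generalize (locally_lt_Re z 0 H); apply filter_imp; intros q Hq.
    unfold Cln; now rewrite Carg_right.
  - apply continuous_pair.
    + apply (continuous_comp Cmod ln); [apply continuous_Cmod|now apply continuous_ln].
    + apply (continuous_comp (fun q => Im q / Re q)%R atan); [|apply continuous_atan].
      apply (continuous_mult (K := R_AbsRing) Im (fun q => / Re q)%R).
      * destruct z; apply continuous_snd.
      * apply (continuous_comp Re Rinv); [destruct z; apply continuous_fst|].
        apply continuous_Rinv; lra.
Qed.

Lemma is_derive_Cln (z : C) : 0 < Re z -> is_derive Cln z (/ z).
Proof.
  intros H; pose proof (continuous_Cln z H) as Hc.
  destruct (proj1 (is_derive_caratheodory cexp _ _) (is_derive_cexp (Cln z))) as [phi [Hphi [Ephi E]]].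
  rewrite cexp_Cln in Ephi by exact H.
  assert (Hcomp : continuous (fun q => phi (Cln q)) z) by now apply (continuous_comp Cln phi).
  assert (Hz : phi (Cln z) <> 0) by (rewrite Ephi; now apply Re_pos_neq_0).
  apply (is_derive_C_ext_loc (fun q => Cln z + / phi (Cln q) * (q - z))).
  - generalize (filter_and _ _ (continuous_neq_0 _ z Hcomp Hz) (locally_lt_Re z 0 H)).
    apply filter_imp; intros q [Nz Hq]; specialize (E (Cln q)); rewrite !cexp_Cln in E by assumption.
    rewrite E; field; exact Nz.
  - apply is_derive_caratheodory; exists (fun q => / phi (Cln q)); split; [now apply continuous_Cinv|].
    split; [now rewrite Ephi|intro q; ring].
Qed.

Lemma ex_derive_Cln (z : C) : 0 < Re z -> ex_derive Cln z.
Proof. intros H; exists (/ z); now apply is_derive_Cln. Qed.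

Definition neg_log1m (u : C) : C := - Cln (1 - u).

Lemma Re_one_minus_pos (u : C) : Cmod u < 1 -> 0 < Re (1 - u).
Proof.
  intros H; pose proof (re_le_Cmod u) as L; pose proof (Rle_abs (Re u)); destruct u; simpl in *; lra.
Qed.

Lemma neg_log1m_0 : neg_log1m 0 = 0.
Proof.
  unfold neg_log1m; replace (1 - 0) with (RtoC 1) by ring; rewrite Cln_RtoC, ln_1 by lra; ring.
Qed.

Lemma neg_log1m_RtoC (t : R) : neg_log1m (RtoC (1 - exp (- t))) = RtoC t.
Proof.
  unfold neg_log1m; rewrite <- RtoC_minus; replace (1 - (1 - exp (- t)))%R with (exp (- t)) by ring.
  rewrite Cln_RtoC, ln_exp, <- RtoC_opp by apply exp_pos; f_equal; ring.
Qed.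

Lemma cexp_opp_neg_log1m (u : C) : Cmod u < 1 -> cexp (- neg_log1m u) = 1 - u.
Proof.
  intros H; unfold neg_log1m; replace (- - Cln (1 - u)) with (Cln (1 - u)) by ring.
  now apply cexp_Cln, Re_one_minus_pos.
Qed.

Lemma ex_derive_neg_log1m (u : C) : Cmod u < 1 -> ex_derive neg_log1m u.
Proof.
  intros H; apply ex_derive_Copp, (ex_derive_Ccomp (fun u => 1 - u) Cln).
  - now apply ex_derive_Cln, Re_one_minus_pos.
  - apply ex_derive_Cminus; [apply ex_derive_Cconst|apply ex_derive_Cid].
Qed.

Lemma is_derive_segment (u : C) (t : R) : is_derive (fun t => 1 - u * RtoC t) t (- u).
Proof.
  replace (- u) with (0 - u * 1) by ring.
  apply (is_derive_minus (V := C_R_NormedModule) (fun _ => RtoC 1) (fun t => u * RtoC t)).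
  - exact (is_derive_const (V := C_R_NormedModule) (RtoC 1) t).
  - apply is_derive_Cmult_l, is_derive_RtoC; exact (is_derive_id (K := R_AbsRing) t).
Qed.

Lemma is_RInt_neg_log1m_div (u : C) : 0 < Cmod u < 1 ->
  is_RInt (fun t => / (1 - u * RtoC t)) 0 1 (neg_log1m u / u).
Proof.
  intros Hu; assert (Hu0 : u <> 0) by (apply Cmod_gt_0; lra).
  assert (Hseg : forall t, Rmin 0 1 <= t <= Rmax 0 1 -> 0 < Re (1 - u * RtoC t)).
  { intros t Ht; rewrite Rmin_left, Rmax_right in Ht by lra.
    apply Re_one_minus_pos; rewrite Cmod_mult, Cmod_R, Rabs_pos_eq by lra; nra. }
  replace (neg_log1m u / u) with (- / u * Cln (1 - u * RtoC 1) - - / u * Cln (1 - u * RtoC 0)).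
  2:{ replace (1 - u * RtoC 0) with (RtoC 1) by ring; rewrite Cmult_1_r, Cln_RtoC, ln_1 by lra.
      unfold neg_log1m; field; exact Hu0. }
  apply (is_RInt_C_derive (fun t => - / u * Cln (1 - u * RtoC t))); intros t Ht.
  - replace (/ (1 - u * RtoC t)) with (- / u * (- u * / (1 - u * RtoC t)))
      by (field; split; [now apply Re_pos_neq_0, Hseg|exact Hu0]).
    apply is_derive_Cmult_l, (is_derive_Ccomp Cln (fun t => 1 - u * RtoC t));
      [now apply is_derive_Cln, Hseg|apply is_derive_segment].
  - apply continuous_Cinv; [eapply is_derive_C_continuous, is_derive_segment|].
    now apply Re_pos_neq_0, Hseg.
Qed.

Lemma Re_Cinv_pos (z : C) : 0 < Re z -> 0 < Re (/ z).
Proof.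
  intros H; destruct z as [x y]; simpl in *; apply Rdiv_lt_0_compat; [exact H|nra].
Qed.

(** Hence the principal power of [neg_log1m u / u] is holomorphic on the whole disc. *)
Lemma Re_neg_log1m_div_pos (u : C) : 0 < Cmod u < 1 -> 0 < Re (neg_log1m u / u).
Proof.
  intros Hu; rewrite <- (is_RInt_unique _ _ _ _ (is_RInt_Re _ _ _ _ (is_RInt_neg_log1m_div u Hu))).
  assert (Hseg : forall t, 0 <= t <= 1 -> 0 < Re (1 - u * RtoC t)).
  { intros t Ht; apply Re_one_minus_pos; rewrite Cmod_mult, Cmod_R, Rabs_pos_eq by lra; nra. }
  apply RInt_gt_0; [lra|intros t Ht; apply Re_Cinv_pos, Hseg; lra|intros t Ht].
  apply (continuous_comp (fun t => / (1 - u * RtoC t)) Re).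
  - apply continuous_Cinv; [eapply is_derive_C_continuous, is_derive_segment|].
    now apply Re_pos_neq_0, Hseg.
  - destruct (/ (1 - u * RtoC t)); apply continuous_fst.
Qed.

Lemma Cmod_neg_log1m_lower (u : C) : Cmod u < 1 -> Cmod u / 4 <= Cmod (neg_log1m u).
Proof.
  intros Hu; pose proof (cexp_opp_neg_log1m u Hu) as E; set (xi := neg_log1m u) in *.
  destruct (Rle_dec (Cmod xi) 1) as [h|h]; [|lra].
  pose proof (Cmod_cexp_sub_1_sub_le (- xi) ltac:(rewrite Cmod_opp; exact h)) as B.
  rewrite E, !Cmod_opp in B; replace (1 - u - 1 - - xi) with (xi - u) in B by ring.
  pose proof (Cmod_le_add_sub u xi) as T; rewrite (Cmod_sub_sym u) in T.
  pose proof (Cmod_ge_0 xi); nra.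
Qed.

Lemma Cmod_neg_log1m_upper (u : C) : Cmod u < 1 ->
  Cmod (neg_log1m u) <= - ln (Cmod (1 - u)) + (2 * ln 2 + PI).
Proof.
  intros Hu; pose proof (Re_one_minus_pos u Hu) as HX.
  unfold neg_log1m; rewrite Cmod_opp; eapply Rle_trans; [apply Cmod_le_re_im|]; unfold Cln; simpl.
  rewrite Carg_right by exact HX; set (r := Cmod (1 - u)).
  assert (Hr : 0 < r) by (apply Cmod_gt_0, Re_pos_neq_0, HX).
  assert (Hr2 : ln r <= ln 2).
  { apply ln_le; [exact Hr|]; unfold r; eapply Rle_trans; [apply Cmod_sub_le|]; rewrite Cmod_1; lra. }
  assert (Hl2 : 0 < ln 2) by (rewrite <- ln_1; apply ln_increasing; lra).
  apply Rle_trans with ((- ln r + 2 * ln 2) + PI)%R; [apply Rplus_le_compat|lra].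
  - apply Rabs_le; lra.
  - pose proof (atan_bound (Im (1 - u) / Re (1 - u))); pose proof PI_RGT_0; apply Rabs_le; lra.
Qed.

(** [zeta ^ (1 / m)] as a function of [sigma = (1 - exp (- zeta)) ^ (1 / m)]. *)
Definition zeta_root (m : nat) (sigma : C) : C :=
  sigma * cexp (Cln (neg_log1m (sigma ^ m) / sigma ^ m) / RtoC (INR m)).

Section Chart.
Variable m : nat.
Hypothesis m_ge_1 : (1 <= m)%nat.

Let INR_m_pos : 0 < INR m.
Proof. apply lt_0_INR; lia. Qed.

Lemma Cmod_pow_in_unit_disc (sigma : C) : 0 < Cmod sigma < 1 -> 0 < Cmod (sigma ^ m) < 1.
Proof.
  intros H; rewrite Cmod_pow; split; [apply pow_lt; lra|].
  apply Rle_lt_trans with (Cmod sigma); [apply pow_le_self; [exact m_ge_1|lra]|lra].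
Qed.

Section Point.
Variable sigma : C.
Hypothesis Hsigma : 0 < Cmod sigma < 1.

Let sigma_pow_neq_0 : sigma ^ m <> 0.
Proof. apply Cmod_gt_0, Cmod_pow_in_unit_disc, Hsigma. Qed.

Lemma zeta_root_pow : zeta_root m sigma ^ m = neg_log1m (sigma ^ m).
Proof.
  unfold zeta_root; rewrite Cpow_mult_l, cexp_pow.
  replace (RtoC (INR m) * (Cln (neg_log1m (sigma ^ m) / sigma ^ m) / RtoC (INR m)))
    with (Cln (neg_log1m (sigma ^ m) / sigma ^ m)) by (field; apply RtoC_neq_0; lra).
  rewrite cexp_Cln by now apply Re_neg_log1m_div_pos, Cmod_pow_in_unit_disc.
  field; exact sigma_pow_neq_0.
Qed.

Lemma ex_derive_zeta_root : ex_derive (zeta_root m) sigma.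
Proof.
  pose proof (Cmod_pow_in_unit_disc sigma Hsigma) as Hu.
  apply ex_derive_Cmult; [apply ex_derive_Cid|].
  apply (ex_derive_Ccomp (fun s => Cln (neg_log1m (s ^ m) / s ^ m) / RtoC (INR m)) cexp);
    [apply ex_derive_cexp|].
  apply ex_derive_Cmult; [|apply ex_derive_Cconst].
  apply (ex_derive_Ccomp (fun s => neg_log1m (s ^ m) / s ^ m) Cln);
    [now apply ex_derive_Cln, Re_neg_log1m_div_pos|].
  apply ex_derive_Cdiv; [|apply ex_derive_Cpow|exact sigma_pow_neq_0].
  apply (ex_derive_Ccomp (fun s => s ^ m) neg_log1m); [apply ex_derive_neg_log1m; lra|apply ex_derive_Cpow].
Qed.

Lemma zeta_root_neq_0 : zeta_root m sigma <> 0.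
Proof. apply Cmult_neq_0; [apply Cmod_gt_0; lra|apply cexp_neq_0]. Qed.

Lemma in_Omega_chart_zeta_root : in_Omega_chart m (zeta_root m sigma).
Proof.
  split; [apply zeta_root_neq_0|].
  rewrite zeta_root_pow; exists (1 - sigma ^ m); split; [|reflexivity].
  replace (1 - sigma ^ m - 1) with (- sigma ^ m) by ring.
  rewrite Cmod_opp; apply Cmod_pow_in_unit_disc, Hsigma.
Qed.

End Point.

Lemma zeta_root_RtoC (t : R) : 0 < t ->
  zeta_root m (RtoC (Rpower (1 - exp (- t)) (/ INR m))) = RtoC (Rpower t (/ INR m)).
Proof.
  intros Ht; pose proof (exp_opp_lt_1 t Ht) as Hs; set (sigma := Rpower (1 - exp (- t)) (/ INR m)).
  assert (Hsigma : 0 < sigma) by apply exp_pos.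
  assert (E : RtoC sigma ^ m = RtoC (1 - exp (- t))).
  { rewrite <- RtoC_pow, <- Rpower_pow by exact Hsigma; f_equal; unfold sigma.
    rewrite Rpower_mult, Rinv_l, Rpower_1; lra. }
  unfold zeta_root; rewrite E, neg_log1m_RtoC, <- RtoC_div, Cln_RtoC, <- RtoC_div, cexp_RtoC, <- RtoC_mult
    by (try apply Rdiv_lt_0_compat; lra).
  f_equal; unfold sigma, Rpower; rewrite <- exp_plus, ln_div by lra; f_equal; field; lra.
Qed.

End Chart.

(** * Growth of the coefficients *)

Lemma sin_lower (x : R) : 0 <= x <= 2 -> x / 3 <= sin x.
Proof.
  intros Hx; pose proof (pre_sin_bound x 0 ltac:(lra) ltac:(lra)) as [L _].
  unfold sin_approx, sin_term in L; simpl in L; eapply Rle_trans; [|exact L].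
  assert (x * x <= 4) by nra.
  replace (1 * (x * 1 / 1) + -1 * 1 * (x * (x * (x * 1)) / (1 + 1 + 1 + 1 + 1 + 1)))%R
    with (x * (1 - x * x / 6))%R by field; nra.
Qed.

Lemma one_minus_cos_lower (t : R) : 0 <= t <= PI -> t * t / 18 <= 1 - cos t.
Proof.
  intros H; pose proof PI_4; replace t with (2 * (t / 2))%R at 3 by field; rewrite cos_2a_sin.
  pose proof (sin_lower (t / 2) ltac:(lra)); nra.
Qed.

Lemma Cmod_one_minus_polar_sqr (r t : R) : (Cmod (1 - polar r t) ^ 2 = (1 - r) ^ 2 + 2 * r * (1 - cos t))%R.
Proof.
  rewrite Cmod2_alt; unfold polar; simpl; pose proof (sin2_cos2 t) as S; unfold Rsqr in S.
  replace ((1 - r) * ((1 - r) * 1))%R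
    with ((1 - r) * (1 - r) + r * r * (sin t * sin t + cos t * cos t - 1))%R by (rewrite S; ring).
  ring.
Qed.

Lemma Cmod_one_minus_polar_lower (r t : R) : 0 < r < 1 -> 0 <= t <= PI ->
  sqrt (r / 18) * (1 - r + t) <= Cmod (1 - polar r t).
Proof.
  intros Hr Ht; apply Rle_of_sqr_le; [apply Cmod_ge_0|].
  rewrite Rpow_mult_distr, pow2_sqrt, Cmod_one_minus_polar_sqr by lra.
  pose proof (one_minus_cos_lower t Ht) as L.
  assert (E1 : (1 - r + t) ^ 2 <= 2 * ((1 - r) ^ 2 + t * t)).
  { pose proof (pow2_ge_0 (1 - r - t)); nra. }
  assert (E2 : r / 18 * (1 - r + t) ^ 2 <= r / 18 * (2 * ((1 - r) ^ 2 + t * t)))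
    by (apply Rmult_le_compat_l; lra).
  assert (E3 : r * (t * t / 18) <= r * (1 - cos t)) by (apply Rmult_le_compat_l; lra).
  assert (E4 : r * (1 - r) ^ 2 <= (1 - r) ^ 2) by (pose proof (pow2_ge_0 (1 - r)); nra).
  pose proof (pow2_ge_0 (1 - r)); nra.
Qed.

Lemma continuous_Rpower_comp {U : UniformSpace} (f : U -> R) (e : R) (x : U) :
  continuous f x -> 0 < f x -> continuous (fun y => Rpower (f y) e) x.
Proof.
  intros Hf H0; apply (continuous_comp f (fun y => Rpower y e)); [exact Hf|].
  apply continuous_of_ex_derive; unfold Rpower; auto_derive; auto.
Qed.

Lemma continuous_circle_kernel (r e t : R) : 0 < r < 1 ->
  continuous (fun t => Rpower (Cmod (1 - polar r t)) e) t.
Proof.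
  intros Hr; apply continuous_Rpower_comp.
  - apply (continuous_comp (fun t => 1 - polar r t) Cmod); [|apply continuous_Cmod].
    apply continuous_Cminus; [apply continuous_const|apply continuous_polar].
  - apply Cmod_gt_0, Re_pos_neq_0, Re_one_minus_pos; rewrite Cmod_polar; lra.
Qed.

Lemma RInt_half_circle_kernel_le (r B : R) : 0 < r < 1 -> 1 < B ->
  RInt (fun t => Rpower (Cmod (1 - polar r t)) (- B)) 0 PI
    <= Rpower (sqrt (r / 18)) (- B) * Rpower (1 - r) (1 - B) / (B - 1).
Proof.
  intros Hr HB; pose proof PI_RGT_0.
  assert (Hs : 0 < sqrt (r / 18)) by (apply sqrt_lt_R0; lra).
  set (k := Rpower (sqrt (r / 18)) (- B)); assert (Hk : 0 < k) by apply exp_pos.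
  set (G := fun t => (- (k / (B - 1) * Rpower (1 - r + t) (1 - B)))%R).
  apply Rle_trans with (G PI - G 0)%R.
  - apply (RInt_le_of_derive _ G (fun t => k * Rpower (1 - r + t) (- B))%R); [lra|intros t Ht ..].
    + now apply continuous_circle_kernel.
    + replace (Rpower (1 - r + t) (- B)) with (Rpower (1 - r + t) (1 - B) / (1 - r + t))%R
        by (rewrite <- Rpower_minus_1 by lra; f_equal; ring).
      unfold G, Rpower; auto_derive; [lra|unfold Rminus; field; lra].
    + apply (continuous_mult (K := R_AbsRing) (fun _ => k)); [apply continuous_const|].
      apply continuous_Rpower_comp; [|lra].
      apply continuous_of_ex_derive; auto_derive; auto.
    + unfold k; rewrite Rpower_mult_distr by lra.
      apply Rpower_Ropp_le; [split|lra]; [apply Rmult_lt_0_compat; lra|].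
      now apply Cmod_one_minus_polar_lower.
  - unfold G; rewrite Rplus_0_r.
    assert (0 < k / (B - 1) * Rpower (1 - r + PI) (1 - B)).
    { apply Rmult_lt_0_compat; [apply Rdiv_lt_0_compat; lra|apply exp_pos]. }
    replace (k * Rpower (1 - r) (1 - B) / (B - 1))%R
      with (k / (B - 1) * Rpower (1 - r) (1 - B))%R by (field; lra); lra.
Qed.

Lemma Cmod_one_minus_polar_reflect (r t : R) : Cmod (1 - polar r (2 * PI - t)) = Cmod (1 - polar r t).
Proof.
  rewrite <- (Cmod_conj (1 - polar r t)); f_equal; unfold polar.
  rewrite cos_minus, sin_minus, cos_2PI, sin_2PI; unfold Cconj, Cminus, Cplus, Copp, RtoC; simpl.
  f_equal; ring.
Qed.

Lemma RInt_reflect (f : R -> R) (T a : R) : (forall t, continuous f t) -> (forall t, f (T - t)%R = f t) ->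
  RInt f (T - a) T = RInt f 0 a.
Proof.
  intros Hf Href; symmetry; apply is_RInt_unique.
  assert (Hint : is_RInt f (T - a) T (RInt f (T - a) T)) by (apply is_RInt_of_continuous; auto).
  replace (T - a)%R with (- (1) * a + T)%R in Hint at 1 by ring.
  replace T with (- (1) * 0 + T)%R in Hint at 2 by ring.
  apply (is_RInt_comp_lin (V := R_NormedModule) f), is_RInt_swap in Hint.
  apply (is_RInt_opp (V := R_NormedModule)) in Hint; rewrite opp_opp in Hint.
  eapply is_RInt_ext; [|exact Hint]; intros t _; cbv beta.
  rewrite <- (Href t); unfold opp, scal; simpl; unfold mult; simpl.
  replace (- (1) * t + T)%R with (T - t)%R by ring; ring.
Qed.

Lemma RInt_circle_kernel_le (r B : R) : 0 < r < 1 -> 1 < B ->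
  RInt (fun t => Rpower (Cmod (1 - polar r t)) (- B)) 0 (2 * PI)
    <= 2 * (Rpower (sqrt (r / 18)) (- B) * Rpower (1 - r) (1 - B) / (B - 1)).
Proof.
  intros Hr HB; set (f := fun t => Rpower (Cmod (1 - polar r t)) (- B)).
  assert (Hf : forall t, continuous f t) by (intros; now apply continuous_circle_kernel).
  assert (E : RInt f 0 (2 * PI) = (RInt f 0 PI + RInt f 0 PI)%R).
  { rewrite <- (RInt_reflect f (2 * PI) PI) at 2.
    - replace (2 * PI - PI)%R with PI by ring; apply is_RInt_unique.
      apply (is_RInt_Chasles (V := R_NormedModule) f 0 PI); apply is_RInt_of_continuous; auto.
    - exact Hf.
    - intros t; unfold f; now rewrite Cmod_one_minus_polar_reflect. }
  rewrite E; pose proof (RInt_half_circle_kernel_le r B Hr HB) as Half; fold f in Half; lra.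
Qed.

Section PeriodicIntegral.
Variables (f : R -> R) (T : R).
Hypothesis f_continuous : forall t, continuous f t.
Hypothesis f_periodic : forall t, f (t + T)%R = f t.

Lemma periodic_nat_mult (n : nat) (t : R) : f (t + INR n * T)%R = f t.
Proof.
  induction n; [simpl; f_equal; ring|]; rewrite S_INR, <- IHn, <- (f_periodic (t + INR n * T)); f_equal; ring.
Qed.

Lemma RInt_periods (n : nat) : RInt f 0 (INR n * T) = (INR n * RInt f 0 T)%R.
Proof.
  induction n; [simpl INR; rewrite !Rmult_0_l; exact (RInt_point (V := R_CompleteNormedModule) 0%R f)|].
  rewrite S_INR; apply is_RInt_unique.
  replace ((INR n + 1) * RInt f 0 T)%R with (plus (RInt f 0 (INR n * T)) (RInt f 0 T)).
  2:{ rewrite IHn; unfold plus; simpl; ring. }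
  apply (is_RInt_Chasles (V := R_NormedModule) f 0 (INR n * T)); [apply is_RInt_of_continuous; auto|].
  replace (RInt f 0 T) with (RInt f (INR n * T) ((INR n + 1) * T)); [apply is_RInt_of_continuous; auto|].
  symmetry; apply is_RInt_unique.
  apply (is_RInt_ext (V := R_NormedModule) (fun t => scal 1%R (f (1 * t + INR n * T)%R))).
  { intros t _; unfold scal; simpl; unfold mult; simpl; rewrite !Rmult_1_l; apply periodic_nat_mult. }
  apply (is_RInt_comp_lin (V := R_NormedModule) f).
  rewrite Rmult_0_r, Rplus_0_l; replace (1 * T + INR n * T)%R with ((INR n + 1) * T)%R by ring.
  apply is_RInt_of_continuous; auto.
Qed.

Lemma is_RInt_periodic_dilate (m : nat) : (1 <= m)%nat ->
  is_RInt (fun t => f (INR m * t)%R) 0 T (RInt f 0 T).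
Proof.
  intros Hm; assert (HmR : 0 < INR m) by (apply lt_0_INR; lia).
  replace (RInt f 0 T) with (scal (/ INR m)%R (RInt f 0 (INR m * T))).
  2:{ rewrite RInt_periods; unfold scal; simpl; unfold mult; simpl; field; lra. }
  apply (is_RInt_ext (V := R_NormedModule) (fun t => scal (/ INR m)%R (scal (INR m) (f (INR m * t + 0)%R)))).
  { intros t _; rewrite Rplus_0_r; unfold scal; simpl; unfold mult; simpl; field; lra. }
  apply (is_RInt_scal (V := R_NormedModule)), (is_RInt_comp_lin (V := R_NormedModule) f).
  rewrite Rmult_0_r, !Rplus_0_r; apply is_RInt_of_continuous; auto.
Qed.

End PeriodicIntegral.

Lemma polar_add_2PI (r t : R) : polar r (t + 2 * PI) = polar r t.
Proof. unfold polar; rewrite cos_plus, sin_plus, cos_2PI, sin_2PI; f_equal; ring. Qed.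

Lemma is_RInt_circle_kernel_pow (rho B : R) (m : nat) : 0 < rho < 1 -> (1 <= m)%nat ->
  is_RInt (fun t => Rpower (Cmod (1 - polar rho t ^ m)) (- B)) 0 (2 * PI)
    (RInt (fun t => Rpower (Cmod (1 - polar (rho ^ m) t)) (- B)) 0 (2 * PI)).
Proof.
  intros Hrho Hm; assert (0 < rho ^ m <= rho) by (split; [apply pow_lt; lra|apply pow_le_self; [exact Hm|lra]]).
  apply (is_RInt_ext (V := R_NormedModule) (fun t => Rpower (Cmod (1 - polar (rho ^ m) (INR m * t))) (- B))).
  { intros t _; now rewrite polar_pow by lra. }
  apply (is_RInt_periodic_dilate (fun t => Rpower (Cmod (1 - polar (rho ^ m) t)) (- B))); [| |exact Hm].
  - intros t; apply continuous_circle_kernel; lra.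
  - intros t; now rewrite polar_add_2PI.
Qed.

Lemma one_le_3_pow_ratio (n : nat) : 1 <= 3 * ((INR n + 1) / (INR n + 2)) ^ n.
Proof.
  pose proof (pos_INR n); set (rho := ((INR n + 1) / (INR n + 2))%R).
  assert (Hrho : 0 < rho) by (apply Rdiv_lt_0_compat; lra).
  assert (Hln : - ln rho <= / (INR n + 1)).
  { unfold rho; rewrite ln_div by lra; pose proof (ln_le_sub_1 ((INR n + 2) / (INR n + 1))
      ltac:(apply Rdiv_lt_0_compat; lra)) as L; rewrite ln_div in L by lra.
    replace ((INR n + 2) / (INR n + 1) - 1)%R with (/ (INR n + 1))%R in L by (field; lra); lra. }
  assert (Hn : INR n * / (INR n + 1) <= 1) by (apply Rle_div_l; lra).
  assert (L : - (1) <= INR n * ln rho) by nra.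
  apply exp_le_compat in L; rewrite exp_Ropp in L; pose proof exp_le_3; pose proof (exp_pos 1).
  assert (/ 3 <= / exp 1) by (apply Rinv_le_contravar; lra).
  rewrite <- Rpower_pow by exact Hrho; unfold Rpower; lra.
Qed.

Lemma RInt_circle_kernel_growth (m : nat) (B : R) : (1 <= m)%nat -> 1 < B ->
  exists D, 0 <= D /\ forall n, let rho := ((INR n + 1) / (INR n + 2))%R in
    RInt (fun t => Rpower (Cmod (1 - polar (rho ^ m) t)) (- B)) 0 (2 * PI)
      <= D * Rpower (INR n + 2) (B - 1).
Proof.
  intros Hm HB; set (k := Rpower (sqrt ((/ 2) ^ m / 18)) (- B)); assert (Hk : 0 < k) by apply exp_pos.
  exists (2 * (k / (B - 1)))%R; split.
  { apply Rmult_le_pos; [lra|left; apply Rdiv_lt_0_compat; lra]. }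
  intros n; cbv zeta; pose proof (pos_INR n) as Hn; set (rho := ((INR n + 1) / (INR n + 2))%R).
  assert (E : (1 - rho = / (INR n + 2))%R) by (unfold rho; field; lra).
  assert (Hinv : 0 < / (INR n + 2) <= / 2) by (split; [apply Rinv_0_lt_compat|apply Rinv_le_contravar]; lra).
  assert (Hpow : rho ^ m <= rho) by (apply pow_le_self; [exact Hm|lra]).
  assert (Hhalf : 0 < (/ 2) ^ m <= rho ^ m) by (split; [apply pow_lt|apply pow_incr]; lra).
  eapply Rle_trans; [apply RInt_circle_kernel_le; lra|].
  assert (Y1 : Rpower (sqrt (rho ^ m / 18)) (- B) <= k).
  { apply Rpower_Ropp_le; [split; [apply sqrt_lt_R0|apply sqrt_le_1]|]; lra. }
  assert (Y2 : Rpower (1 - rho ^ m) (1 - B) <= Rpower (INR n + 2) (B - 1)).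
  { replace (1 - B)%R with (- (B - 1))%R by ring.
    apply Rle_trans with (Rpower (/ (INR n + 2)) (- (B - 1))); [apply Rpower_Ropp_le; lra|].
    right; unfold Rpower; rewrite ln_Rinv by lra; f_equal; ring. }
  rewrite Rmult_assoc; apply Rmult_le_compat_l; [lra|].
  replace (k / (B - 1) * Rpower (INR n + 2) (B - 1))%R
    with (k * Rpower (INR n + 2) (B - 1) / (B - 1))%R by (field; lra).
  apply Rmult_le_compat_r; [left; apply Rinv_0_lt_compat; lra|].
  apply Rmult_le_compat; try (left; apply exp_pos); assumption.
Qed.

(** Averaging over the circle of radius [(n + 1) / (n + 2)] gains a factor [n] over the
    pointwise bound. *)
Lemma coefficient_growth (H : C -> C) (c : nat -> C) (r0 : R) (m : nat) (C0 B : R) :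
  (forall q, 0 < Cmod q < 1 -> ex_derive H q) -> 0 < r0 ->
  (forall q, 0 < Cmod q < r0 -> is_series (fun k => c k * q ^ k) (H q)) ->
  (1 <= m)%nat -> 1 < B -> 0 <= C0 ->
  (forall q, / 2 <= Cmod q < 1 -> Cmod (H q) <= C0 * Rpower (Cmod (1 - q ^ m)) (- B)) ->
  exists D, 0 <= D /\ forall n, Cmod (c n) <= D * Rpower (INR n + 2) (B - 1).
Proof.
  intros Hd Hr0 Hs Hm HB HC0 Hbound; pose proof PI_RGT_0 as Hpi.
  destruct (RInt_circle_kernel_growth m B Hm HB) as [D [HD Growth]].
  exists (3 * C0 * D / (2 * PI))%R; split.
  { apply Rmult_le_pos; [nra|left; apply Rinv_0_lt_compat; lra]. }
  intros n; specialize (Growth n); cbv zeta in Growth.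
  pose proof (pos_INR n); set (rho := ((INR n + 1) / (INR n + 2))%R) in *.
  assert (E : (1 - rho = / (INR n + 2))%R) by (unfold rho; field; lra).
  assert (Hinv : 0 < / (INR n + 2) <= / 2) by (split; [apply Rinv_0_lt_compat|apply Rinv_le_contravar]; lra).
  set (J := RInt (fun t => Rpower (Cmod (1 - polar (rho ^ m) t)) (- B)) 0 (2 * PI)) in *.
  assert (Cauchy : 2 * PI * (Cmod (c n) * rho ^ n) <= C0 * J).
  { apply (cauchy_coefficient_le H c r0 Hd Hr0 Hs n rho
      (fun t => C0 * Rpower (Cmod (1 - polar rho t ^ m)) (- B))%R); [lra| |].
    - intros t _; apply Hbound; rewrite Cmod_polar; lra.
    - apply (is_RInt_scal (V := R_NormedModule)), is_RInt_circle_kernel_pow; [lra|exact Hm]. }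
  pose proof (one_le_3_pow_ratio n) as Ratio; fold rho in Ratio; pose proof (Cmod_ge_0 (c n)).
  replace (3 * C0 * D / (2 * PI) * Rpower (INR n + 2) (B - 1))%R
    with (3 * (C0 * (D * Rpower (INR n + 2) (B - 1))) / (2 * PI))%R by (field; lra).
  apply Rle_div_r; [lra|].
  apply Rle_trans with (3 * (2 * PI * (Cmod (c n) * rho ^ n)))%R.
  - replace (3 * (2 * PI * (Cmod (c n) * rho ^ n)))%R
      with (Cmod (c n) * (2 * PI) * (3 * rho ^ n))%R by ring.
    rewrite <- (Rmult_1_r (Cmod (c n) * (2 * PI))) at 1; apply Rmult_le_compat_l; nra.
  - apply Rmult_le_compat_l; [lra|]; eapply Rle_trans; [exact Cauchy|].
    now apply Rmult_le_compat_l.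
Qed.

(** * The Borel transform in the coordinate [sigma] *)

Definition borel_sigma (m : nat) (F : C -> C) (q : C) : C := F (zeta_root m q) * q ^ (m - 1).

Lemma ex_derive_borel_sigma (m : nat) (F : C -> C) (q : C) : (1 <= m)%nat ->
  (forall w, in_Omega_chart m w -> ex_derive F w) -> 0 < Cmod q < 1 -> ex_derive (borel_sigma m F) q.
Proof.
  intros Hm HF Hq; apply ex_derive_Cmult; [|apply ex_derive_Cpow].
  apply (ex_derive_Ccomp (zeta_root m) F); [now apply HF, in_Omega_chart_zeta_root|].
  now apply ex_derive_zeta_root.
Qed.

Lemma Cmod_zeta_root_lower (m : nat) (q : C) : (1 <= m)%nat -> / 2 <= Cmod q < 1 ->
  (/ 2) ^ m / 4 <= Cmod (zeta_root m q).
Proof.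
  intros Hm Hq; assert (Hq' : 0 < Cmod q < 1) by lra.
  pose proof (Cmod_neg_log1m_lower (q ^ m) (proj2 (Cmod_pow_in_unit_disc m Hm q Hq'))) as L.
  rewrite <- (zeta_root_pow m Hm q Hq'), !Cmod_pow in L.
  assert (Hhalf : (/ 2) ^ m <= Cmod q ^ m) by (apply pow_incr; lra).
  assert (H1 : (/ 2) ^ m <= 1) by (apply pow_le_1; lra).
  apply Rnot_lt_le; intros Hlt.
  pose proof (pow_le_self (Cmod (zeta_root m q)) m Hm) as Self.
  pose proof (Cmod_ge_0 (zeta_root m q)); lra.
Qed.

Lemma exp_Cmod_neg_log1m_le (B B' : R) (u : C) : B <= B' -> 0 <= B' -> Cmod u < 1 ->
  exp (B * Cmod (neg_log1m u)) <= exp (B' * (2 * ln 2 + PI)) * Rpower (Cmod (1 - u)) (- B').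
Proof.
  intros HB HB' Hu; unfold Rpower; rewrite <- exp_plus; apply exp_le_compat.
  pose proof (Cmod_neg_log1m_upper u Hu) as Up; pose proof (Cmod_ge_0 (neg_log1m u)).
  apply Rle_trans with (B' * Cmod (neg_log1m u))%R; [apply Rmult_le_compat_r; lra|].
  apply (Rmult_le_compat_l B') in Up; lra.
Qed.

Lemma borel_sigma_bound (m : nat) (F : C -> C) (A B B' : R) :
  (1 <= m)%nat -> 0 < A -> B <= B' -> 0 <= B' ->
  (forall w, in_Omega_chart m w -> Cmod (F w * w ^ (m - 1)) <= A * exp (B * Cmod w ^ m)) ->
  exists C0, 0 <= C0 /\ forall q, / 2 <= Cmod q < 1 ->
    Cmod (borel_sigma m F q) <= C0 * Rpower (Cmod (1 - q ^ m)) (- B').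
Proof.
  intros Hm HA HBB HB' HF; set (kappa := ((/ 2) ^ m / 4)%R); set (E := exp (B' * (2 * ln 2 + PI))).
  assert (Hkappa : 0 < kappa) by (apply Rdiv_lt_0_compat; [apply pow_lt|]; lra).
  assert (Hkm : 0 < / kappa ^ (m - 1)) by (apply Rinv_0_lt_compat, pow_lt, Hkappa).
  assert (HE : 0 < E) by apply exp_pos.
  exists (A * E * / kappa ^ (m - 1))%R; split.
  { apply Rmult_le_pos; [apply Rmult_le_pos|]; lra. }
  intros q Hq; assert (Hq' : 0 < Cmod q < 1) by lra.
  pose proof (proj2 (Cmod_pow_in_unit_disc m Hm q Hq')) as Hu.
  pose proof (HF _ (in_Omega_chart_zeta_root m Hm q Hq')) as HFw.
  rewrite <- Cmod_pow, zeta_root_pow in HFw by assumption.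
  pose proof (Cmod_zeta_root_lower m q Hm Hq) as Hw; fold kappa in Hw.
  unfold borel_sigma; set (w := zeta_root m q) in *.
  assert (Hw0 : w <> 0) by (apply Cmod_gt_0; lra).
  replace (F w * q ^ (m - 1)) with ((F w * w ^ (m - 1)) * (q ^ (m - 1) * / w ^ (m - 1)))
    by (field; now apply Cpow_nz).
  replace (A * E * / kappa ^ (m - 1) * Rpower (Cmod (1 - q ^ m)) (- B'))%R
    with ((A * (E * Rpower (Cmod (1 - q ^ m)) (- B'))) * (1 * / kappa ^ (m - 1)))%R by ring.
  rewrite Cmod_mult; apply Rmult_le_compat; try apply Cmod_ge_0.
  - eapply Rle_trans; [exact HFw|]; apply Rmult_le_compat_l; [lra|now apply exp_Cmod_neg_log1m_le].
  - rewrite Cmod_mult, Cmod_inv, !Cmod_pow by now apply Cpow_nz.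
    apply Rmult_le_compat.
    + apply pow_le, Cmod_ge_0.
    + left; apply Rinv_0_lt_compat, pow_lt; lra.
    + apply pow_le_1; lra.
    + apply Rinv_le_contravar; [now apply pow_lt|apply pow_incr; lra].
Qed.

(** * Expansion at the origin *)

Lemma filter_forall_lt {T : Type} (F : (T -> Prop) -> Prop) {FF : Filter F} (P : nat -> T -> Prop) (n : nat) :
  (forall l, (l < n)%nat -> F (P l)) -> F (fun x => forall l, (l < n)%nat -> P l x).
Proof.
  induction n; intros H; [apply (filter_imp (fun _ => True)); [lia|apply filter_true]|].
  generalize (filter_and (F := F) _ _ (IHn ltac:(intros; apply H; lia)) (H n ltac:(lia))); apply filter_imp.
  intros x [H1 H2] l Hl; destruct (Nat.eq_dec l n) as [->|]; [exact H2|apply H1; lia].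
Qed.

Lemma csum_residues (u : nat -> C) (m J : nat) :
  csum u (m * J) = csum (fun l => csum (fun j => u (l + m * j)%nat) J) m.
Proof.
  induction J.
  - rewrite Nat.mul_0_r; simpl; clear; induction m; simpl; [reflexivity|rewrite <- IHm; ring].
  - rewrite Nat.mul_succ_r, csum_add, IHJ; simpl; now rewrite csum_Cplus.
Qed.

Lemma is_series_interleave (m : nat) (u L : nat -> C) : (1 <= m)%nat ->
  (forall l, (l < m)%nat -> is_series (fun j => u (l + m * j)%nat) (L l)) -> is_series u (csum L m).
Proof.
  intros Hm H; assert (HmR : 0 < INR m) by (apply lt_0_INR; lia).
  apply is_series_csum, (filterlim_Cmod eventually); intros eps Heps.
  assert (Blocks : filterlim (fun J => csum u (m * J)) eventually (locally (csum L m))).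
  { apply (filterlim_ext (fun J => csum (fun l => csum (fun j => u (l + m * j)%nat) J) m));
      [intros J; symmetry; apply csum_residues|].
    apply (filterlim_csum eventually (fun l J => csum (fun j => u (l + m * j)%nat) J)).
    intros l Hl; now apply is_series_csum, H. }
  assert (Small : eventually (fun J => forall l, (l < m)%nat -> Cmod (u (l + m * J)%nat) < eps / (2 * INR m))).
  { apply (filter_forall_lt eventually); intros l Hl.
    pose proof (proj1 (filterlim_Cmod eventually _ _) (is_series_terms_0 _ _ (H l Hl)) (eps / (2 * INR m))%R
      ltac:(apply Rdiv_lt_0_compat; lra)) as S.
    revert S; apply filter_imp; intros J; now replace (u (l + m * J)%nat - 0) with (u (l + m * J)%nat) by ring. }
  pose proof (proj1 (filterlim_Cmod eventually _ _) Blocks (eps / 2)%R ltac:(lra)) as Near.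
  destruct (filter_and (F := eventually) _ _ Near Small) as [N HN].
  exists (m * N)%nat; intros n Hn; set (J := (n / m)%nat); set (i := (n mod m)%nat).
  assert (Hi : (i < m)%nat) by (apply Nat.mod_upper_bound; lia).
  destruct (HN J ltac:(apply Nat.div_le_lower_bound; lia)) as [Block Rest].
  replace n with (m * J + i)%nat by (symmetry; apply Nat.div_mod_eq); rewrite csum_add.
  replace (csum u (m * J) + csum (fun k => u (k + m * J)%nat) i - csum L m)
    with ((csum u (m * J) - csum L m) + csum (fun k => u (k + m * J)%nat) i) by ring.
  eapply Rle_lt_trans; [apply Cmod_triangle|].
  assert (Cmod (csum (fun k => u (k + m * J)%nat) i) <= INR i * (eps / (2 * INR m))).
  { apply Cmod_csum_le; intros k Hk; left; apply Rest; lia. }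
  assert (INR i * (eps / (2 * INR m)) <= INR m * (eps / (2 * INR m))).
  { apply Rmult_le_compat_r; [left; apply Rdiv_lt_0_compat; lra|apply le_INR; lia]. }
  replace (INR m * (eps / (2 * INR m)))%R with (eps / 2)%R in * by (field; lra); lra.
Qed.

Lemma RtoC_RGamma_neq_0 (x : R) : 0 < x -> RtoC (RGamma x) <> 0.
Proof. intros Hx; rewrite <- CGamma_RtoC by exact Hx; now apply CGamma_neq_0. Qed.

(** The defining relations of [taylor_coeffs_d m a d (S l)] at the point [u = 1 - s]. *)
Definition residue_expansion (m : nat) (a d : nat -> C) (l : nat) (u sig : C) : Prop :=
  is_series (fun k => a (S l + m * k)%nat * neg_log1m u ^ k
    / RtoC (RGamma (INR (S l) / INR m + INR k))) sig /\
  is_series (fun j => d (S l + m * j)%nat * u ^ j)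
    (cpowc (qfun (neg_log1m u)) (RtoC (INR (S l) / INR m - 1)) * sig).

Lemma locally_residue_expansion (m : nat) (a d : nat -> C) :
  (forall l, (1 <= l <= m)%nat -> taylor_coeffs_d m a d l) ->
  locally (RtoC 0) (fun u => forall l, (l < m)%nat -> exists sig, residue_expansion m a d l u sig).
Proof.
  intros Hd; apply (filter_forall_lt (locally (RtoC 0))); intros l Hl.
  destruct (Hd (S l) ltac:(lia)) as [r [Hr H]].
  apply locally_Cmod; exists r; split; [exact Hr|]; intros u Hu.
  assert (E : 1 - (1 - u) = u) by ring.
  destruct (H (1 - u)) as [sig [Ha Hdj]].
  { replace (1 - u - 1) with (- (u - 0)) by ring; now rewrite Cmod_opp. }
  exists sig; split; [exact Ha|].
  revert Hdj; apply is_series_ext; intros j; now rewrite E.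
Qed.

Lemma is_series_borel_residues (m : nat) (a sig : nat -> C) (w xi : C) :
  (1 <= m)%nat -> w <> 0 -> w ^ m = xi ->
  (forall l, (l < m)%nat -> is_series (fun k => a (S l + m * k)%nat * xi ^ k
    / RtoC (RGamma (INR (S l) / INR m + INR k))) (sig l)) ->
  is_series (borel_term m a w) (csum (fun l => w ^ S l / w ^ m * sig l) m).
Proof.
  intros Hm Hw <- Hsig; assert (HmR : 0 < INR m) by (apply lt_0_INR; lia).
  apply is_series_interleave; [exact Hm|]; intros l Hl.
  refine (is_series_ext (V := C_NormedModule) _ _ _ _ (is_series_Cmult_l (w ^ S l / w ^ m) _ _ (Hsig l Hl))).
  enough (Term : forall j, w ^ S l / w ^ m * (a (S l + m * j)%nat * (w ^ m) ^ j
    / RtoC (RGamma (INR (S l) / INR m + INR j))) = borel_term m a w (l + m * j)) by exact Term.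
  intros j; unfold borel_term; replace (S (l + m * j)) with (S l + m * j)%nat by lia.
  replace (INR (S l + m * j) / INR m)%R with (INR (S l) / INR m + INR j)%R
    by (rewrite plus_INR, mult_INR; field; lra).
  assert (Hg : RtoC (RGamma (INR (S l) / INR m + INR j)) <> 0).
  { apply RtoC_RGamma_neq_0; pose proof (pos_INR j).
    assert (0 < INR (S l) / INR m) by (apply Rdiv_lt_0_compat; [apply lt_0_INR; lia|lra]); lra. }
  assert (Hwm : w ^ m <> 0) by now apply Cpow_nz.
  rewrite (Cpow_add_r w (S l)), (Cpow_mult_r w m j); field; split; assumption.
Qed.

Lemma is_series_taylor_residues (m : nat) (d L : nat -> C) (q : C) : (1 <= m)%nat ->
  (forall l, (l < m)%nat -> is_series (fun j => d (S l + m * j)%nat * (q ^ m) ^ j) (L l)) ->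
  is_series (fun k => d (S k) * q ^ k) (csum (fun l => q ^ l * L l) m).
Proof.
  intros Hm HL; apply is_series_interleave; [exact Hm|]; intros l Hl.
  generalize (is_series_Cmult_l (q ^ l) _ _ (HL l Hl)); apply is_series_ext; intros j.
  rewrite Cpow_add_r, Cpow_mult_r.
  change (q ^ l * (d (S l + m * j)%nat * (q ^ m) ^ j) = d (S (l + m * j)) * (q ^ l * (q ^ m) ^ j)).
  simpl; ring.
Qed.

Lemma neg_log1m_neq_0 (u : C) : 0 < Cmod u < 1 -> neg_log1m u <> 0.
Proof.
  intros Hu Z; pose proof (Re_neg_log1m_div_pos u Hu) as H.
  rewrite Z in H; unfold Cdiv in H; rewrite Cmult_0_l in H; simpl in H; lra.
Qed.

Lemma qfun_neg_log1m (u : C) : 0 < Cmod u < 1 -> qfun (neg_log1m u) = neg_log1m u / u.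
Proof.
  intros Hu; unfold qfun; destruct (excluded_middle_informative _) as [Z|_];
    [now apply neg_log1m_neq_0 in Z|].
  rewrite cexp_opp_neg_log1m by lra; f_equal; ring.
Qed.

Lemma zeta_root_power_ratio (m l : nat) (q : C) : (1 <= m)%nat -> 0 < Cmod q < 1 ->
  zeta_root m q ^ S l / zeta_root m q ^ m * q ^ (m - 1) =
  q ^ l * cpowc (qfun (neg_log1m (q ^ m))) (RtoC (INR (S l) / INR m - 1)).
Proof.
  intros Hm Hq; assert (HmR : 0 < INR m) by (apply lt_0_INR; lia).
  assert (Hq0 : q <> 0) by (apply Cmod_gt_0; lra).
  rewrite qfun_neg_log1m by now apply Cmod_pow_in_unit_disc.
  unfold cpowc; set (X := Cln (neg_log1m (q ^ m) / q ^ m)).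
  assert (Pow : forall k, zeta_root m q ^ k = q ^ k * cexp (RtoC (INR k / INR m) * X)).
  { intros k; unfold zeta_root; fold X; rewrite Cpow_mult_l, cexp_pow; f_equal; f_equal.
    rewrite RtoC_div by lra; field; apply RtoC_neq_0; lra. }
  assert (Exp : cexp (RtoC (INR (S l) / INR m - 1) * X)
    = cexp (RtoC (INR (S l) / INR m) * X) / cexp (RtoC (INR m / INR m) * X)).
  { unfold Cdiv; rewrite <- cexp_opp, <- cexp_plus; f_equal.
    replace (INR m / INR m)%R with 1%R by (field; lra); rewrite RtoC_minus; ring. }
  rewrite !Pow, Exp; destruct m as [|k]; [lia|].
  replace (S k - 1)%nat with k by lia; rewrite (Cpow_S q k), (Cpow_S q l); field.
  repeat split; try apply cexp_neq_0; try apply Cpow_nz; exact Hq0.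
Qed.

Lemma locally_Cpow_0 (m : nat) (P : C -> Prop) : (1 <= m)%nat ->
  locally (RtoC 0) P -> locally (RtoC 0) (fun q => P (q ^ m)).
Proof.
  intros Hm HP; apply (ex_derive_C_continuous (fun q => q ^ m) 0 (ex_derive_Cpow 0 m)).
  destruct m as [|k]; [lia|]; simpl; now rewrite Cmult_0_l.
Qed.

Lemma locally_Cmod_zeta_root_lt (m : nat) (rho : R) : (1 <= m)%nat -> 0 < rho ->
  locally (RtoC 0) (fun q => 0 < Cmod q < 1 -> Cmod (zeta_root m q) < rho).
Proof.
  intros Hm Hrho.
  assert (Small : locally (RtoC 0) (fun u => Cmod (neg_log1m u) < rho ^ m)).
  { pose proof (ex_derive_C_continuous _ _ (ex_derive_neg_log1m 0 ltac:(rewrite Cmod_0; lra))) as Hc.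
    apply (Hc (fun xi : C => Cmod xi < rho ^ m)); rewrite neg_log1m_0.
    apply locally_Cmod; exists (rho ^ m)%R; split; [now apply pow_lt|].
    intros xi; now replace (xi - 0) with xi by ring. }
  generalize (locally_Cpow_0 m _ Hm Small); apply filter_imp; intros q Hpow Hq.
  rewrite <- (zeta_root_pow m Hm q Hq), Cmod_pow in Hpow.
  apply Rnot_le_lt; intros Hle; pose proof (pow_incr rho (Cmod (zeta_root m q)) m ltac:(lra)); lra.
Qed.

(** Splitting both series according to the residue of the index modulo [m] reduces the
    expansion of the Borel transform to the definition of the coefficients [d n]. *)
Lemma is_series_borel_sigma_near_0 (m : nat) (a d : nat -> C) (F : C -> C) : (1 <= m)%nat ->
  (exists rho, 0 < rho /\ forall w, in_Omega_chart m w -> Cmod w < rho -> is_series (borel_term m a w) (F w)) ->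
  (forall l, (1 <= l <= m)%nat -> taylor_coeffs_d m a d l) ->
  exists r0, 0 < r0 /\ forall q, 0 < Cmod q < r0 ->
    is_series (fun k => d (S k) * q ^ k) (borel_sigma m F q).
Proof.
  intros Hm [rho [Hrho HF]] Hd.
  pose proof (filter_and _ _ (locally_Cmod_lt 0 1 Rlt_0_1) (filter_and _ _
    (locally_Cmod_zeta_root_lt m rho Hm Hrho)
    (locally_Cpow_0 m _ Hm (locally_residue_expansion m a d Hd)))) as Near.
  apply locally_Cmod in Near; destruct Near as [r0 [Hr0 Near]]; exists r0; split; [exact Hr0|]; intros q Hq.
  destruct (Near q) as [Hq1 [Hw Hres]]; [now replace (q - 0) with q by ring|].
  replace (q - 0) with q in Hq1 by ring; assert (Hq' : 0 < Cmod q < 1) by lra; specialize (Hw Hq').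
  set (sig := fun l => epsilon (inhabits (RtoC 0)) (residue_expansion m a d l (q ^ m))).
  assert (Hsig : forall l, (l < m)%nat -> residue_expansion m a d l (q ^ m) (sig l)).
  { intros l Hl; apply epsilon_spec; now apply Hres. }
  assert (Borel : F (zeta_root m q) = csum (fun l => zeta_root m q ^ S l / zeta_root m q ^ m * sig l) m).
  { apply (is_series_C_unique (borel_term m a (zeta_root m q))).
    - apply HF; [now apply in_Omega_chart_zeta_root|exact Hw].
    - apply (is_series_borel_residues m a sig _ _ Hm (zeta_root_neq_0 m q Hq') (zeta_root_pow m Hm q Hq')).
      intros l Hl; exact (proj1 (Hsig l Hl)). }
  unfold borel_sigma; rewrite Borel, Cmult_comm, <- csum_Cmult_l.
  rewrite (csum_ext _ (fun l => q ^ l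
    * (cpowc (qfun (neg_log1m (q ^ m))) (RtoC (INR (S l) / INR m - 1)) * sig l))).
  - apply is_series_taylor_residues; [exact Hm|]; intros l Hl; exact (proj2 (Hsig l Hl)).
  - intros l _; rewrite !Cmult_assoc, <- zeta_root_power_ratio by assumption; ring.
Qed.

(** * Termwise integration *)

Lemma ex_series_of_telescope (u g : nat -> R) :
  (forall n, 0 <= u n <= g n - g (S n)) -> (forall n, 0 <= g n) -> ex_series u.
Proof.
  intros Hu Hg.
  assert (Bound : forall n, sum_n u n <= g 0%nat - g (S n)).
  { induction n; [rewrite sum_O; apply Hu|]; rewrite sum_Sn; specialize (Hu (S n)).
    unfold plus; simpl; lra. }
  destruct (ex_finite_lim_seq_incr (sum_n u) (g 0%nat)) as [l Hl].
  - intros n; rewrite sum_Sn; specialize (Hu (S n)); unfold plus; simpl; lra.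
  - intros n; specialize (Bound n); specialize (Hg (S n)); lra.
  - now exists l.
Qed.

Lemma Rpower_telescope (del y : R) : 0 < del -> 1 < y ->
  del * Rpower y (- 1 - del) <= Rpower (y - 1) (- del) - Rpower y (- del).
Proof.
  intros Hd Hy; assert (HP : 0 < Rpower y (- del)) by apply exp_pos.
  assert (E1 : (Rpower y (- 1 - del) = Rpower y (- del) * / y)%R)
    by (replace (- 1 - del)%R with (- del - 1)%R by ring; apply Rpower_minus_1; lra).
  assert (E2 : (Rpower (y - 1) (- del) = Rpower y (- del) * exp (del * (ln y - ln (y - 1))))%R)
    by (unfold Rpower; rewrite <- exp_plus; f_equal; ring).
  pose proof (exp_ineq1_le (del * (ln y - ln (y - 1)))) as E.
  pose proof (Rmult_le_compat_l del _ _ (Rlt_le _ _ Hd) (Rinv_le_ln_sub y Hy)) as L.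
  rewrite E1, E2; nra.
Qed.

Definition zeta_tail (K del : R) (n : nat) : R := (K / del * Rpower (INR n + 1) (- del))%R.

Section ZetaTail.
Variables K del : R.
Hypotheses (K_ge_0 : 0 <= K) (del_pos : 0 < del).

Lemma zeta_tail_ge_0 (n : nat) : 0 <= zeta_tail K del n.
Proof.
  apply Rmult_le_pos; [|left; apply exp_pos].
  apply Rmult_le_pos; [exact K_ge_0|left; now apply Rinv_0_lt_compat].
Qed.

Lemma zeta_term_le (n : nat) :
  K * Rpower (INR n + 2) (- 1 - del) <= zeta_tail K del n - zeta_tail K del (S n).
Proof.
  unfold zeta_tail; rewrite S_INR; replace (INR n + 1 + 1)%R with (INR n + 2)%R by ring.
  pose proof (pos_INR n); pose proof (Rpower_telescope del (INR n + 2) del_pos ltac:(lra)) as T.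
  replace (INR n + 2 - 1)%R with (INR n + 1)%R in T by ring.
  replace (K * Rpower (INR n + 2) (- 1 - del))%R
    with (K / del * (del * Rpower (INR n + 2) (- 1 - del)))%R by (field; lra).
  rewrite <- Rmult_minus_distr_l; apply Rmult_le_compat_l; [|exact T].
  apply Rmult_le_pos; [exact K_ge_0|left; now apply Rinv_0_lt_compat].
Qed.

Lemma is_lim_seq_zeta_tail : is_lim_seq (zeta_tail K del) 0.
Proof.
  replace (Finite 0) with (Rbar_mult (Finite (K / del)) (Finite 0)) by (simpl; f_equal; ring).
  apply is_lim_seq_scal_l, is_lim_seq_incr_1.
  apply (is_lim_seq_ext (fun n => exp (- (del * ln (INR n + 2))))).
  { intros n; unfold Rpower; rewrite S_INR; replace (INR n + 1 + 1)%R with (INR n + 2)%R by ring.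
    f_equal; ring. }
  apply (filterlim_comp _ _ _ (fun n => ln (INR n + 2)) (fun y => exp (- (del * y))) _ (Rbar_locally p_infty));
    [|now apply filterlim_exp_decay].
  intros P [M HM]; destruct (INR_unbounded (exp M)) as [N HN]; exists N; intros n Hn; apply HM.
  rewrite <- (ln_exp M); apply ln_increasing; [apply exp_pos|].
  apply le_INR in Hn; lra.
Qed.

Lemma ex_series_zeta : ex_series (fun n => K * Rpower (INR n + 2) (- 1 - del))%R.
Proof.
  apply (ex_series_of_telescope _ (zeta_tail K del)); intros n; [split|apply zeta_tail_ge_0].
  - apply Rmult_le_pos; [exact K_ge_0|left; apply exp_pos].
  - apply zeta_term_le.
Qed.

End ZetaTail.

Lemma tannery {T : Type} (F : (T -> Prop) -> Prop) {FF : ProperFilter F}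
  (u : nat -> T -> C) (Phi : T -> C) (l : nat -> C) (s : C) (g : nat -> R) :
  (forall n, filterlim (u n) F (locally (l n))) -> is_series l s ->
  F (fun x => is_series (fun n => u n x) (Phi x) /\ forall n, Cmod (u n x) <= g n - g (S n)) ->
  (forall n, 0 <= g n) -> is_lim_seq g 0 -> filterlim Phi F (locally s).
Proof.
  intros Hu Hs HF Hg Hlim; apply (filterlim_Cmod F); intros eps Heps.
  apply is_series_csum in Hs.
  pose proof (proj1 (filterlim_Cmod eventually (csum l) s) Hs (eps / 3)%R ltac:(lra)) as Near.
  pose proof (proj2 (is_lim_seq_spec g 0) Hlim (mkposreal (eps / 3) ltac:(lra))) as Small.
  destruct (filter_and (F := eventually) _ _ Small Near) as [N HN].
  destruct (HN N (Nat.le_refl N)) as [HgN HlN]; simpl in HgN; rewrite Rminus_0_r in HgN.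
  pose proof (Rle_abs (g N)).
  pose proof (proj1 (filterlim_Cmod F _ _) (filterlim_csum F u l N (fun k _ => Hu k)) (eps / 3)%R ltac:(lra)) as Sums.
  generalize (filter_and _ _ HF Sums); apply filter_imp; intros x [[Hx Hux] HsumN].
  pose proof (Cmod_series_tail_le _ g Hux Hg (Phi x) N Hx).
  pose proof (Cmod_sub_triangle (Phi x) (csum (fun n => u n x) N) s).
  pose proof (Cmod_sub_triangle (csum (fun n => u n x) N) (csum l N) s).
  lra.
Qed.

Lemma is_series_RInt_uniform (u : nat -> R -> C) (f : R -> C) (a b : R) (I : nat -> C) (l : C) (e : nat -> R) :
  a <= b -> is_RInt f a b l -> (forall n, is_RInt (u n) a b (I n)) ->
  (forall n t, a <= t <= b -> Cmod (f t - csum (fun k => u k t) n) <= e n) ->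
  is_lim_seq e 0 -> is_series I l.
Proof.
  intros Hab Hf Hu Hunif He; apply (is_series_of_tail _ _ (fun n => (b - a) * e n)%R).
  - intros n; apply Cmod_RInt_le_const with (2 := Hunif n); [exact Hab|].
    apply is_RInt_Cminus; [exact Hf|now apply is_RInt_csum].
  - replace 0%R with ((b - a) * 0)%R by ring; apply is_lim_seq_mult'; [apply is_lim_seq_const|exact He].
Qed.

Lemma power_series_uniform_on_segment (H : C -> C) (c : nat -> C) (x2 : R) : 0 < x2 < 1 ->
  (forall x, 0 < x < 1 -> is_series (fun k => c k * RtoC x ^ k) (H (RtoC x))) ->
  exists e, is_lim_seq e 0 /\ forall n x, 0 < x <= x2 ->
    Cmod (H (RtoC x) - csum (fun k => c k * RtoC x ^ k) n) <= e n.
Proof.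
  intros Hx2 HS; set (r := ((1 + x2) / 2)%R); assert (Hr : x2 < r < 1) by (unfold r; lra).
  destruct (is_series_bounded _ _ (HS r ltac:(lra))) as [K HK].
  set (y := (x2 / r)%R); assert (Hy : 0 <= y < 1) by (split; [apply Rle_div_r|apply Rlt_div_l]; lra).
  exists (fun n => K / (1 - y) * y ^ n)%R; split.
  - replace 0%R with (K / (1 - y) * 0)%R by ring; apply is_lim_seq_mult'; [apply is_lim_seq_const|].
    apply is_lim_seq_geom; rewrite Rabs_pos_eq; lra.
  - intros n x Hx; replace (K / (1 - y) * y ^ n)%R with (K * y ^ n / (1 - y))%R by (field; lra).
    apply (Cmod_power_series_tail_le c r); [exact Hy| | |apply HS; lra].
    + intros k; specialize (HK k); rewrite Cmod_mult, Cmod_pow, Cmod_R, Rabs_pos_eq in HK; lra.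
    + rewrite Cmod_R, Rabs_pos_eq by lra; replace (y * r)%R with x2 by (unfold y; field; lra); lra.
Qed.

Definition laplace_integrand (m : nat) (F : C -> C) (z : C) (t : R) : C :=
  F (RtoC (Rpower t (/ INR m))) * cexp (- (z * RtoC t)).

Section LaplaceIntegral.
Variables (m : nat) (F : C -> C) (z : C).
Hypothesis m_ge_1 : (1 <= m)%nat.
Hypothesis F_derive : forall w, in_Omega_chart m w -> ex_derive F w.
Hypothesis Re_z_pos : 0 < Re z.

Let sigma (t : R) : R := Rpower (1 - exp (- t)) (/ INR m).

Let weight (t : R) : C := Cbeta_integrand z (/ INR m) t.

Let INR_m_ge_1 : 1 <= INR m.
Proof. apply (le_INR 1), m_ge_1. Qed.

Lemma in_Omega_chart_RtoC (t : R) : 0 < t -> in_Omega_chart m (RtoC (Rpower t (/ INR m))).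
Proof.
  intros Ht; split; [apply RtoC_neq_0, Rgt_not_eq, exp_pos|].
  exists (RtoC (exp (- t))); pose proof (exp_opp_lt_1 t Ht); split.
  - rewrite <- RtoC_minus, Cmod_R, Rabs_left; lra.
  - rewrite Cln_RtoC, ln_exp, <- RtoC_pow, <- RtoC_opp by lra; f_equal.
    rewrite <- Rpower_pow, Rpower_mult, Rinv_l, Rpower_1 by (try apply exp_pos; lra); ring.
Qed.

Lemma continuous_laplace_integrand : continuous_pos (laplace_integrand m F z).
Proof.
  intros t Ht; apply continuous_Cmult.
  - apply (continuous_comp (fun t => RtoC (Rpower t (/ INR m))) F).
    + apply continuous_RtoC, continuous_of_ex_derive; unfold Rpower; auto_derive; lra.
    + now apply ex_derive_C_continuous, F_derive, in_Omega_chart_RtoC.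
  - apply (continuous_ext (fun t => cexp (- z * RtoC t))); [intros s; f_equal; ring|].
    apply (continuous_cexp_Cmult (- z) (fun t => t)), continuous_id.
Qed.

Lemma sigma_range (t : R) : 0 < t -> 0 < sigma t < 1.
Proof.
  intros Ht; pose proof (exp_opp_lt_1 t Ht); split; [apply exp_pos|].
  rewrite <- (Rpower_base_1 (/ INR m)); apply Rlt_Rpower_l; [apply Rinv_0_lt_compat|]; lra.
Qed.

Lemma sigma_le (t t' : R) : 0 < t <= t' -> sigma t <= sigma t'.
Proof.
  intros Ht; pose proof (exp_opp_lt_1 t ltac:(lra)); pose proof (exp_le_compat (- t') (- t) ltac:(lra)).
  apply Rle_Rpower_l; [left; apply Rinv_0_lt_compat|]; lra.
Qed.

Lemma Cbeta_integrand_sigma (n : nat) (t : R) :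
  Cbeta_integrand z (INR (S n) / INR m) t = weight t * RtoC (sigma t) ^ n.
Proof.
  unfold weight, Cbeta_integrand; rewrite <- Cmult_assoc, <- RtoC_pow, <- RtoC_mult; do 2 f_equal.
  unfold sigma; rewrite <- Rpower_pow, Rpower_mult, <- Rpower_plus, S_INR by apply exp_pos.
  f_equal; field; lra.
Qed.

Lemma laplace_integrand_sigma (t : R) : 0 < t ->
  laplace_integrand m F z t = weight t * borel_sigma m F (RtoC (sigma t)).
Proof.
  intros Ht; unfold borel_sigma, sigma; rewrite zeta_root_RtoC by assumption; fold (sigma t).
  replace (weight t * (F (RtoC (Rpower t (/ INR m))) * RtoC (sigma t) ^ (m - 1)))
    with (F (RtoC (Rpower t (/ INR m))) * (weight t * RtoC (sigma t) ^ (m - 1))) by ring.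
  rewrite <- Cbeta_integrand_sigma; replace (S (m - 1)) with m by lia.
  unfold laplace_integrand, Cbeta_integrand; replace (INR m / INR m - 1)%R with 0%R by (field; lra).
  rewrite Rpower_O, Cmult_1_r by (pose proof (exp_opp_lt_1 t Ht); lra); do 2 f_equal; ring.
Qed.

Lemma Cmod_weight_le (t t' : R) : 0 < t <= t' -> Cmod (weight t') <= Rpower (1 - exp (- t)) (/ INR m - 1).
Proof.
  intros Ht; unfold weight; rewrite Cmod_Cbeta_integrand; unfold beta_integrand.
  assert (0 < / INR m <= 1).
  { split; [apply Rinv_0_lt_compat; lra|rewrite <- Rinv_1; apply Rinv_le_contravar; lra]. }
  rewrite <- (Rmult_1_l (Rpower (1 - exp (- t)) _)); apply Rmult_le_compat; try (left; apply exp_pos).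
  - apply exp_nonpos_le_1; nra.
  - replace (/ INR m - 1)%R with (- (1 - / INR m))%R by ring.
    pose proof (exp_opp_lt_1 t ltac:(lra)); pose proof (exp_le_compat (- t') (- t) ltac:(lra)).
    apply Rpower_Ropp_le; lra.
Qed.

Lemma is_series_RInt_laplace (c : nat -> C) (t1 t2 : R) :
  (forall x, 0 < x < 1 -> is_series (fun k => c k * RtoC x ^ k) (borel_sigma m F (RtoC x))) ->
  0 < t1 <= t2 ->
  is_series (fun n => c n * CRInt (Cbeta_integrand z (INR (S n) / INR m)) t1 t2)
    (CRInt (laplace_integrand m F z) t1 t2).
Proof.
  intros HS Ht; destruct (power_series_uniform_on_segment _ c _ (sigma_range t2 ltac:(lra)) HS) as [e [He Hunif]].
  apply (is_series_RInt_uniform (fun n t => c n * Cbeta_integrand z (INR (S n) / INR m) t)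
    (laplace_integrand m F z) t1 t2 _ _ (fun n => Rpower (1 - exp (- t1)) (/ INR m - 1) * e n)%R); [lra| | | |].
  - apply (is_RInt_pos (V := C_R_CompleteNormedModule)); [apply continuous_laplace_integrand|exact Ht].
  - intros n; apply is_RInt_Cmult_l, (is_RInt_pos (V := C_R_CompleteNormedModule)); [|exact Ht].
    apply continuous_Cbeta_integrand.
  - intros n t Htt; rewrite laplace_integrand_sigma by lra.
    rewrite (csum_ext _ (fun k => weight t * (c k * RtoC (sigma t) ^ k)))
      by (intros; rewrite Cbeta_integrand_sigma; ring).
    rewrite csum_Cmult_l.
    replace (weight t * _ - weight t * csum _ n) with
      (weight t * (borel_sigma m F (RtoC (sigma t)) - csum (fun k => c k * RtoC (sigma t) ^ k) n)) by ring.
    rewrite Cmod_mult; apply Rmult_le_compat; try apply Cmod_ge_0; [apply Cmod_weight_le; lra|].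
    apply Hunif; split; [apply sigma_range; lra|apply sigma_le; lra].
  - rewrite <- (Rmult_0_r (Rpower (1 - exp (- t1)) (/ INR m - 1))).
    apply is_lim_seq_mult'; [apply is_lim_seq_const|exact He].
Qed.

Lemma Cmod_RInt_Cbeta_root_decay :
  exists M, 0 <= M /\ forall n t1 t2, 0 < t1 <= t2 ->
    Cmod (CRInt (Cbeta_integrand z (INR (S n) / INR m)) t1 t2) <= M * Rpower (INR n + 2) (- Re z).
Proof.
  assert (Him : 0 < / INR m) by (apply Rinv_0_lt_compat; lra).
  destruct (Cmod_RInt_Cbeta_uniform_decay z (/ INR m) Re_z_pos Him) as [M [HM Decay]].
  exists (M * Rpower (INR m) (Re z))%R; split.
  { apply Rmult_le_pos; [exact HM|left; apply exp_pos]. }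
  intros n t1 t2 Ht; pose proof (pos_INR n).
  assert (Hb : (INR (S n) / INR m + 1 - (INR n + 2) / INR m = (INR m - 1) / INR m)%R)
    by (rewrite S_INR; field; lra).
  assert (Hb0 : (INR (S n) / INR m - / INR m = INR n / INR m)%R) by (rewrite S_INR; field; lra).
  assert (0 <= INR n / INR m) by (apply Rdiv_le_0_compat; lra).
  assert (0 <= (INR m - 1) / INR m) by (apply Rdiv_le_0_compat; lra).
  eapply Rle_trans; [apply Decay; [lra|exact Ht]|].
  rewrite Rmult_assoc, <- Rpower_Ropp_Rdiv by lra; apply Rmult_le_compat_l; [exact HM|].
  apply Rpower_Ropp_le; [|lra]; split; [apply Rdiv_lt_0_compat; lra|lra].
Qed.

Section Coefficients.
Variables (c : nat -> C) (D B : R).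
Hypothesis c_series :
  forall x, 0 < x < 1 -> is_series (fun k => c k * RtoC x ^ k) (borel_sigma m F (RtoC x)).
Hypothesis D_ge_0 : 0 <= D.
Hypothesis c_le : forall n, Cmod (c n) <= D * Rpower (INR n + 2) (B - 1).
Hypothesis B_lt : B < Re z.

Lemma Cmod_RInt_Cbeta_term_le :
  exists K, 0 <= K /\ forall n t1 t2, 0 < t1 <= t2 ->
    Cmod (c n * CRInt (Cbeta_integrand z (INR (S n) / INR m)) t1 t2)
      <= K * Rpower (INR n + 2) (- 1 - (Re z - B)).
Proof.
  destruct Cmod_RInt_Cbeta_root_decay as [M [HM Decay]].
  exists (D * M)%R; split; [now apply Rmult_le_pos|]; intros n t1 t2 Ht.
  replace (D * M * Rpower (INR n + 2) (- 1 - (Re z - B)))%R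
    with ((D * Rpower (INR n + 2) (B - 1)) * (M * Rpower (INR n + 2) (- Re z)))%R.
  - rewrite Cmod_mult; apply Rmult_le_compat; try apply Cmod_ge_0; [apply c_le|now apply Decay].
  - replace (- 1 - (Re z - B))%R with ((B - 1) + - Re z)%R by ring; rewrite Rpower_plus; ring.
Qed.

Let beta_term (n : nat) : C := c n * CBeta z (INR (S n) / INR m).

Let is_RInt_gen_beta_term (n : nat) :
  is_RInt_gen (fun t => c n * Cbeta_integrand z (INR (S n) / INR m) t) (at_right 0) (Rbar_locally p_infty)
    (beta_term n).
Proof.
  apply is_RInt_gen_Cmult_l, is_RInt_gen_CBeta; [exact Re_z_pos|].
  apply Rdiv_lt_0_compat; [apply lt_0_INR; lia|lra].
Qed.

Let continuous_beta_term (n : nat) :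
  continuous_pos (fun t => c n * Cbeta_integrand z (INR (S n) / INR m) t).
Proof. intros t Ht; apply continuous_Cmult; [apply continuous_const|now apply continuous_Cbeta_integrand]. Qed.

Let CRInt_beta_term (n : nat) (t1 t2 : R) : 0 < t1 <= t2 ->
  CRInt (fun t => c n * Cbeta_integrand z (INR (S n) / INR m) t) t1 t2
    = c n * CRInt (Cbeta_integrand z (INR (S n) / INR m)) t1 t2.
Proof.
  intros Ht; apply CRInt_unique, is_RInt_Cmult_l, (is_RInt_pos (V := C_R_CompleteNormedModule)); [|exact Ht].
  apply continuous_Cbeta_integrand.
Qed.

Lemma laplace_factorial_series :
  ex_series (fun n => Cmod (c n * CBeta z (INR (S n) / INR m))) /\
  exists s, is_series (fun n => c n * CBeta z (INR (S n) / INR m)) s /\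
    is_RInt_gen (laplace_integrand m F z) (at_right 0) (Rbar_locally p_infty) s.
Proof.
  destruct Cmod_RInt_Cbeta_term_le as [K [HK Terms]].
  assert (Hdel : 0 < Re z - B) by lra.
  assert (Beta_le : forall n, Cmod (beta_term n) <= K * Rpower (INR n + 2) (- 1 - (Re z - B))).
  { intros n; apply (Cmod_RInt_gen_le _ _ _ (continuous_beta_term n) (is_RInt_gen_beta_term n)).
    intros t1 t2 Ht; rewrite CRInt_beta_term by exact Ht; now apply Terms. }
  pose proof (ex_series_zeta K (Re z - B) HK Hdel) as Zeta; split.
  - apply (ex_series_le (V := R_CompleteNormedModule)) with (2 := Zeta); intros n.
    change (Rabs (Cmod (beta_term n)) <= K * Rpower (INR n + 2) (- 1 - (Re z - B))).
    rewrite Rabs_pos_eq by apply Cmod_ge_0; apply Beta_le.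
  - destruct (ex_series_le (V := C_CompleteNormedModule) beta_term _ Beta_le Zeta) as [s Hs].
    exists s; split; [exact Hs|].
    apply (is_RInt_gen_pos (V := C_R_CompleteNormedModule)); [apply continuous_laplace_integrand|].
    apply (tannery pos_ends (fun n p => CRInt (fun t => c n * Cbeta_integrand z (INR (S n) / INR m) t) (fst p) (snd p))
      _ beta_term s (zeta_tail K (Re z - B))); [|exact Hs| |now apply zeta_tail_ge_0|now apply is_lim_seq_zeta_tail].
    + intros n; apply (is_RInt_gen_pos (V := C_R_CompleteNormedModule)); auto.
    + generalize pos_ends_ordered; apply filter_imp; intros p Hp; split.
      * apply (is_series_ext (fun n => c n * CRInt (Cbeta_integrand z (INR (S n) / INR m)) (fst p) (snd p))).
        -- intros n; symmetry; apply CRInt_beta_term; lra.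
        -- apply is_series_RInt_laplace; [exact c_series|lra].
      * intros n; rewrite CRInt_beta_term by lra.
        eapply Rle_trans; [apply Terms; lra|now apply zeta_term_le].
Qed.

End Coefficients.

Lemma fact_term_CBeta (d : nat -> C) (n : nat) :
  fact_term m d z (S n) = d (S n) * CBeta z (INR (S n) / INR m).
Proof.
  unfold fact_term; set (b := (INR (S n) / INR m)%R).
  assert (Hb : 0 < b) by (apply Rdiv_lt_0_compat; [apply lt_0_INR; lia|lra]).
  pose proof (CBeta_CGamma z b Re_z_pos Hb) as E; rewrite CGamma_RtoC in E by exact Hb.
  rewrite <- E; field; apply CGamma_neq_0; rewrite re_plus, re_RtoC; lra.
Qed.

End LaplaceIntegral.

Theorem proposition5p2 (m : nat) (a d : nat -> C) (F : C -> C) (A B : R) :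
  (1 <= m)%nat ->
  gevrey1 m a ->
  (* the Borel transform extends analytically to Omega^star (F is the extension,
     read in the chart w = zeta^{1/m}) *)
  (forall w : C, in_Omega_chart m w -> @ex_derive C_AbsRing C_NormedModule F w) ->
  (exists rho : R, (0 < rho)%R /\
     forall w : C, in_Omega_chart m w -> (Cmod w < rho)%R ->
       is_series (borel_term m a w) (F w)) ->
  (* exponential bound |f~(zeta) zeta^{(m-1)/m}| <= A e^{B|zeta|} on Omega^star *)
  (0 < A)%R -> (0 < B)%R ->
  (forall w : C, in_Omega_chart m w ->
     (Cmod (F w * w ^ (m - 1)) <= A * exp (B * Cmod w ^ m))%R) ->
  (* definition of the coefficients d_n *)
  (forall l : nat, (1 <= l <= m)%nat -> taylor_coeffs_d m a d l) ->
  forall z : C, (Rmax B 1 < Re z)%R ->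
    ex_series (fun k => Cmod (fact_term m d z (S k))) /\
    exists Ssum I : C,
      is_series (fun k => fact_term m d z (S k)) Ssum /\
      is_RInt_gen (fun t : R => F (RtoC (Rpower t (/ INR m))) * cexp (- (z * RtoC t)))
                  (at_right 0) (Rbar_locally p_infty) I /\
      a 0%nat + Ssum = a 0%nat + I.
Proof.
  intros Hm _ F_derive F_series HA _ F_bound Hd z Hz.
  pose proof (Rmax_l B 1) as HB_max; pose proof (Rmax_r B 1) as H1_max.
  set (B' := ((Rmax B 1 + Re z) / 2)%R); assert (HB' : B <= B' /\ 1 < B' < Re z) by (unfold B'; lra).
  assert (Hz0 : 0 < Re z) by lra.
  destruct (borel_sigma_bound m F A B B') as [C0 [HC0 H_bound]]; try assumption; try lra.
  destruct (is_series_borel_sigma_near_0 m a d F Hm F_series Hd) as [r0 [Hr0 H_series]].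
  set (c := fun n => d (S n)); set (H := borel_sigma m F) in *.
  assert (H_derive : forall q, 0 < Cmod q < 1 -> ex_derive H q) by (intros; now apply ex_derive_borel_sigma).
  destruct (coefficient_growth H c r0 m C0 B') as [D [HD c_le]]; try assumption; try lra.
  assert (H_expansion : forall x, 0 < x < 1 -> is_series (fun k => c k * RtoC x ^ k) (H (RtoC x))).
  { intros x Hx; apply (is_series_in_unit_disc H c r0); auto; rewrite Cmod_R, Rabs_pos_eq; lra. }
  destruct (laplace_factorial_series m F z Hm F_derive Hz0 c D B') as [Abs [s [Hs HI]]]; try assumption; try lra.
  split.
  - apply (ex_series_ext (V := R_NormedModule)) with (2 := Abs); intros n; now rewrite fact_term_CBeta.
  - exists s, s; split; [|split; [exact HI|reflexivity]].
    apply (is_series_ext (V := C_NormedModule)) with (2 := Hs); intros n; now rewrite fact_term_CBeta.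
Qed.
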